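(* Let $A$ be a double chain with parameters $(l,m)$, let its interior top points be labelled $1,\dots,l$ and its interior bottom points $1,\dots,m$, and let $C_n=\frac1{n+1}\binom{2n}{n}$ be the Catalan numbers. Then (with implied constants independent of $l$, $m$, $V$, $W$): (1) For every set $V\subseteq\{1,\dots,l\}$ of interior top points and every set $W\subseteq\{1,\dots,m\}$ of interior bottom points, with $v=|V|$ and $w=|W|$, $$|\mathcal{PT}_{V\cup W}(A)| \in O\left(2^{l+m}\,(3/2)^{v+w}\,C_l C_m\right).$$ (2) In particular, $$|\mathcal{PPT}(A)| \in O(3^{l+m}\,C_l C_m) = O(12^{l+m}\,(lm)^{-3/2}).$$ (3) $$|\mathcal{PT}(A)| \in O(5^{l+m}\,C_l C_m) = O(20^{l+m}\,(lm)^{-3/2}).$$ (The forms involving $(lm)^{-3/2}$ are for $l,m\ge1$.)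
   Context: All point sets are finite planar sets in general position (no three points collinear). A pseudo-triangle is a planar simple polygon with exactly three convex vertices (internal angle less than $\pi$). A pseudo-triangulation of a point set $A$ is a partition of $\operatorname{conv}(A)$ into pseudo-triangles whose vertex set is exactly $A$. A vertex is pointed if it has an incident angle greater than $\pi$. $A_I$ is the set of points of $A$ in the interior of $\operatorname{conv}(A)$. $\mathcal{PT}(A)$ is the set of all pseudo-triangulations of $A$; for $U\subseteq A_I$, $\mathcal{PT}_U(A)$ is the set of those in which the points of $U$ are pointed and those of $A_I\setminus U$ are non-pointed; $\mathcal{PPT}(A)=\mathcal{PT}_{A_I}(A)$ is the set of pointed pseudo-triangulations. A double chain with parameters $(l,m)$, $l,m\ge0$, is the set of $l+m+4$ points consisting of the vertices of a convex 4-gon together with $l$ and $m$ points, respectively, placed inside it, forming concave chains (i.e. bulging towards the interior of the 4-gon) next to two opposite edges of the 4-gon, in such a way that the chains do not cross the two diagonals of the 4-gon. Thus the $l$ points together with the endpoints of their edge form a convex $(l+2)$-gon (the top part) having that edge as a side, and all lie in the triangle bounded by that edge and the two diagonals; similarly for the $m$ points (bottom part). In $V\cup W$ the union is disjoint (top points and bottom points are different points). *)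

(* Defs.v *)
From HB Require Import structures.
From mathcomp Require Import all_boot all_order all_algebra all_fingroup.
From mathcomp Require Import all_classical all_reals all_analysis.

Set Implicit Arguments.
Unset Strict Implicit.
Unset Printing Implicit Defensive.

Import Order.TTheory GRing.Theory Num.Theory.
Import numFieldNormedType.Exports.

Local Open Scope classical_set_scope.
Local Open Scope ring_scope.

Notation plane R := (R * R)%type.

Section Plane.
Variable R : realType.
Implicit Types a b c : plane R.

(* Twice the signed area of the triangle [abc]: positive iff [a -> b -> c] is a
   left turn, zero iff the three points are collinear. *)
Definition orient a b c : R :=
  (b.1 - a.1) * (c.2 - a.2) - (b.2 - a.2) * (c.1 - a.1).

Definition segment a b : set (plane R) :=
  [set (1 - t) *: a + t *: b | t in `[0, 1]].

Definition open_segment a b : set (plane R) :=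
  [set (1 - t) *: a + t *: b | t in `]0, 1[].

Definition conv_hull (I : finType) (p : I -> plane R) : set (plane R) :=
  [set x | exists w : I -> R,
     [/\ forall i, 0 <= w i, \sum_i w i = 1 & x = \sum_i w i *: p i]].

Definition triangle a b c : set (plane R) := conv_hull (tnth [tuple a; b; c]).

Definition rot90 a : plane R := (- a.2, a.1).

End Plane.

(* A finite point set is given as an injective family [p : I -> plane R]
   (injectivity is part of [general_position]).

   A simple polygon with vertices among the points is encoded by its
   counterclockwise boundary cycle, a permutation [s] of the labels: the
   vertices are the labels moved by [s], and the edges are the segments from
   [p i] to [p (s i)].  Each polygon has exactly one such code, so counting sets
   of codes counts sets of polygons. *)
Section PseudoTriangulations.
Variables (R : realType) (I : finType) (p : I -> plane R).
Implicit Types (s : {perm I}) (T : {set {perm I}}) (U : {set I}).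

Definition general_position : Prop :=
  injective p /\
  forall i j k : I, i != j -> j != k -> i != k -> orient (p i) (p j) (p k) != 0.

Definition vertices s : {set I} := [set i | s i != i].

Definition single_cycle s : Prop :=
  vertices s != finset.set0 /\
  forall i j, i \in vertices s -> j \in vertices s -> j \in porbit s i.

Definition boundary_chain s : set (plane R) :=
  \bigcup_(i in [set` vertices s]) segment (p i) (p (s i)).

(* Two distinct edges may only share an endpoint along which they are
   consecutive; this also rules out cycles of length 2. *)
Definition simple_chain s : Prop :=
  single_cycle s /\
  forall i j x, i \in vertices s -> j \in vertices s -> i != j ->
    segment (p i) (p (s i)) x -> segment (p j) (p (s j)) x ->
    (i = s j /\ x = p i) \/ (j = s i /\ x = p j).

(* [K] is the closed region enclosed by the simple closed chain [s], and [s]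
   runs counterclockwise around it.  By the Jordan curve theorem the enclosed
   region is the only nonempty compact regular closed set whose topological
   boundary is the chain; counterclockwise means that the region lies
   immediately to the left of every edge. *)
Definition polygon s (K : set (plane R)) : Prop :=
  [/\ simple_chain s,
      compact K,
      regclosed K,
      K `\` K° = boundary_chain s &
      forall i x, i \in vertices s -> open_segment (p i) (p (s i)) x ->
        \forall e \near (0 : R)^'+, K (x + e *: rot90 (p (s i) - p i))].

(* As the region lies on the left, the internal angle at a vertex is less than
   (greater than) pi iff the boundary turns left (right) there. *)
Definition turn s (i : I) : R := orient (p ((s^-1)%g i)) (p i) (p (s i)).

Definition convex_vertices s : {set I} := [set i in vertices s | 0 < turn s i].

Definition reflex_vertices s : {set I} := [set i in vertices s | turn s i < 0].

Definition pseudo_triangle s (K : set (plane R)) : Prop :=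
  polygon s K /\ #|convex_vertices s| = 3%N.

Definition pseudo_triangulation T : Prop :=
  (forall i : I, exists2 s, s \in T & i \in vertices s) /\
  exists K : {perm I} -> set (plane R),
    [/\ forall s, s \in T -> pseudo_triangle s (K s),
        forall s s', s \in T -> s' \in T -> s != s' ->
          (K s)° `&` (K s')° = set0 &
        \bigcup_(s in [set` T]) K s = conv_hull p].

Definition interior_points : {set I} := [set i | `[< (conv_hull p)° (p i) >]].

(* At a point that is not interior, the angle outside the convex hull exceeds
   pi; at an interior point all incident angles are internal angles of cells. *)
Definition is_pointed T (i : I) : bool :=
  (i \notin interior_points) || [exists s in T, i \in reflex_vertices s].

Definition PT : {set {set {perm I}}} :=
  [set T | `[< pseudo_triangulation T >]].

Definition PT_ U : {set {set {perm I}}} :=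
  [set T in PT | [forall i in interior_points, is_pointed T i == (i \in U)]].

Definition PPT : {set {set {perm I}}} := PT_ interior_points.

End PseudoTriangulations.

Section DoubleChain.
Variables (R : realType) (l m : nat).

(* [inl] labels the top part and [inr] the bottom part, both listed in the same
   direction, so that the 4-gon has corners [inl ord0], [inl ord_max],
   [inr ord_max], [inr ord0] in cyclic order. *)
Definition dc_index : finType := ('I_l.+2 + 'I_m.+2)%type.

Variable A : dc_index -> plane R.

Definition convex_polygon_in_order (n : nat) (t : 'I_n -> plane R) : Prop :=
  (forall i j k : 'I_n, (i < j)%N -> (j < k)%N -> 0 < orient (t i) (t j) (t k)) \/
  (forall i j k : 'I_n, (i < j)%N -> (j < k)%N -> orient (t i) (t j) (t k) < 0).

(* Together with general position, the common point [o] of the open diagonals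
   says that the four corners form a convex 4-gon. *)
Definition double_chain : Prop :=
  [/\ general_position A,
      convex_polygon_in_order (fun i => A (inl i)),
      convex_polygon_in_order (fun j => A (inr j)) &
      exists o : plane R,
        [/\ open_segment (A (inl ord0)) (A (inr ord_max)) o,
            open_segment (A (inl ord_max)) (A (inr ord0)) o,
            forall i, triangle (A (inl ord0)) (A (inl ord_max)) o (A (inl i)) &
            forall j, triangle (A (inr ord0)) (A (inr ord_max)) o (A (inr j))]].

End DoubleChain.

(* The label [i] in {0, ..., n-1} of an interior point of a chain, as a position
   in {1, ..., n} of the chain with endpoints at positions 0 and n+1. *)
Definition inner (n : nat) (i : 'I_n) : 'I_n.+2 := lift ord0 (lift ord_max i).

Definition interior_union (l m : nat) (V : {set 'I_l}) (W : {set 'I_m}) :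
    {set dc_index l m} :=
  ([set inl (inner i) | i in V] :|: [set inr (inner j) | j in W])%SET.

Definition catalan (R : realType) (n : nat) : R :=
  (n.+1)%:R^-1 * 'C(2 * n, n)%:R.

(* [O(f) = O(g)] as classes of functions of [l, m >= 1]. *)
Definition same_bigO (R : realType) (f g : nat -> nat -> R) : Prop :=
  exists2 c : R, 0 < c &
    forall l m : nat, (0 < l)%N -> (0 < m)%N ->
      `|f l m| <= c * `|g l m| /\ `|g l m| <= c * `|f l m|.

(* Main.v *)
Require Import Defs.
From mathcomp Require Import all_boot all_order all_algebra all_fingroup.
From mathcomp Require Import all_classical all_reals all_analysis.
From mathcomp Require Import ring lra zify.

(** Number the points of each chain of a double chain so that the other chain
    lies to the right.  The convexity of the chains and their position with
    respect to the diagonals of the 4-gon determine the orientation of every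
    triple that is used ([double_chain_frame]): three points of one chain turn
    left, and all points of the other chain lie to the right of the line through
    two points of a chain.  The proof encodes a pseudo-triangulation by a short
    combinatorial code and counts the codes.

    A pseudo-triangulation is determined by its set of edges
    ([adj_determines_sub]).  Near a vertex the cell is exactly its angular
    sector there ([sector_inside], [sector_outside]); no edge enters a sector
    ([adj_notin_sector]), and every direction that points into the hull lies in
    a sector ([cover_direction]).  Hence the boundary of a cell can be followed
    from the edges alone, and likewise edges do not cross ([noncrossing]).
    Moreover a vertex at which a linear functional is minimal on a cell is
    convex there ([extreme_convex]), and an inner point all of whose edges lie
    in a closed half plane is reflex in some cell ([reflex_exists]).

    The last two facts fix the shape of the cells.  A cell that meets both chains
    is convex at its first and last vertex on each chain; having only three
    convex vertices, it has a single vertex on one of the chains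
    ([single_side]).  Consequently the edges between the chains, ordered by
    their ends, move one end at a time ([cross_step]), so they form a lattice
    path; a non-pointed inner vertex, and an inner vertex without a cross edge,
    has neighbours on both sides along its own chain ([reflex_if_lacks],
    [no_cross_two_sided]); and a pointed vertex with a cross edge has them on
    exactly one side ([reflex_not_both], [reflex_some_side]).

    The code of a pseudo-triangulation records, for each vertex, whether it has
    no cross edge, one, or at least two.  This determines the lattice path
    ([cross_determines]).  A non-pointed inner vertex always has a cross edge,
    so it has two options and every other vertex has three.  On each chain it
    remains to describe a non-crossing graph in which it is known, for each
    inner vertex, whether it has neighbours on one side or on both.  The edges
    at a vertex that go to the left end at consecutive admissible vertices, so
    the numbers of such edges determine the graph ([left_degree_determines]);
    after subtracting the edges that must exist, these numbers form a ballot
    sequence ([left_degree_sum]), for which a chain with [n] inner points leaves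
    a Catalan number of choices, the one of index [n + 2].

    Altogether the number of pseudo-triangulations in which exactly the points
    of [V] and [W] are pointed is at most
    [2 ^ (l + m + 4) * (3 / 2) ^ (v + w + 4) * C_(l + 2) * C_(m + 2)], the four
    chain ends being counted with three options ([card_PT_le]), and
    [C_(n + 2) <= 16 * C_n].  Taking all inner points gives the bound for
    pointed pseudo-triangulations, and summing over [V] and [W] the bound for
    all of them, since [2 * (1 + 3 / 2) = 5]. *)
Set Implicit Arguments.
Unset Strict Implicit.
Unset Printing Implicit Defensive.

Import Order.TTheory GRing.Theory Num.Theory.
Import numFieldNormedType.Exports.

Local Open Scope classical_set_scope.
Local Open Scope ring_scope.

(** * Segments and orientations in the plane *)

Section PlaneGeometry.
Variable R : realType.
Implicit Types (a b c d x y z : plane R) (K : set (plane R)).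

Definition lerp a b (t : R) : plane R :=
  ((1 - t) * a.1 + t * b.1, (1 - t) * a.2 + t * b.2).

Lemma lerpE a b t : (1 - t) *: a + t *: b = lerp a b t.
Proof. by []. Qed.

Lemma segmentP a b x :
  segment a b x <-> exists t, [/\ 0 <= t, t <= 1 & x = lerp a b t].
Proof.
split; first by move=> [t /=]; rewrite in_itv /= => /andP[t0 t1] <-; exists t.
by move=> [t [t0 t1 ->]]; exists t => //=; rewrite in_itv /= t0 t1.
Qed.

Lemma open_segmentP a b x :
  open_segment a b x <-> exists t, [/\ 0 < t, t < 1 & x = lerp a b t].
Proof.
split; first by move=> [t /=]; rewrite in_itv /= => /andP[t0 t1] <-; exists t.
by move=> [t [t0 t1 ->]]; exists t => //=; rewrite in_itv /= t0 t1.
Qed.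

Lemma orient_lerp a b c d t :
  orient a b (lerp c d t) = (1 - t) * orient a b c + t * orient a b d.
Proof. rewrite /orient /lerp /=; ring. Qed.

Lemma orient_rot a b c : orient b c a = orient a b c.
Proof. rewrite /orient; ring. Qed.

Lemma orient_swap a b c : orient b a c = - orient a b c.
Proof. rewrite /orient; ring. Qed.

Lemma orient_aba a b : orient a b a = 0.
Proof. rewrite /orient; ring. Qed.

Lemma orient_abb a b : orient a b b = 0.
Proof. rewrite /orient; ring. Qed.

Lemma lerp0 a b : lerp a b 0 = a.
Proof. by case: a => ? ?; congr pair => /=; ring. Qed.

Lemma lerp1 a b : lerp a b 1 = b.
Proof. by case: b => ? ?; congr pair => /=; ring. Qed.

Definition box x (r : R) : set (plane R) :=
  [set z | `|z.1 - x.1| < r /\ `|z.2 - x.2| < r].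

Lemma nbhs_boxP x (A : set (plane R)) :
  nbhs x A <-> exists2 r, 0 < r & box x r `<=` A.
Proof.
split.
  move=> /nbhs_ballP[r /= r0 sub]; exists r => // z [z1 z2].
  by apply: sub; split; rewrite /ball /= distrC.
move=> [r r0 sub]; apply/nbhs_ballP; exists r => //= z [z1 z2].
by apply: sub; split; rewrite distrC.
Qed.

Lemma convex_lt (r u v t : R) : 0 <= t <= 1 -> u < r -> v < r ->
  (1 - t) * u + t * v < r.
Proof.
move=> /andP[t0 t1] ur vr; have [t1'|t1'] := ltP t 1.
  have : 0 < (1 - t) * (r - u) by apply: mulr_gt0; lra.
  have : 0 <= t * (r - v) by apply: mulr_ge0; lra.
  lra.
by have -> : t = 1 by [lra|]; lra.
Qed.

Lemma box_lerp x r a b t : 0 <= t <= 1 -> box x r a -> box x r b ->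
  box x r (lerp a b t).
Proof.
move=> t01 [a1 a2] [b1 b2]; split => /=.
  move: a1 b1; rewrite !ltr_norml => /andP[? ?] /andP[? ?].
  have := @convex_lt r (a.1 - x.1) (b.1 - x.1) t t01.
  have := @convex_lt r (x.1 - a.1) (x.1 - b.1) t t01.
  by lra.
move: a2 b2; rewrite !ltr_norml => /andP[? ?] /andP[? ?].
have := @convex_lt r (a.2 - x.2) (b.2 - x.2) t t01.
have := @convex_lt r (x.2 - a.2) (x.2 - b.2) t t01.
by lra.
Qed.

Lemma lerp_continuous a b : continuous (lerp a b).
Proof.
have h (u v t : R) : (fun t0 : R => (1 - t0) * u + t0 * v) x @[x --> t] --> (1 - t) * u + t * v.
  apply: cvgD; apply: cvgM => //.
  - by apply: cvgB => //; exact: cvg_cst.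
  - exact: cvg_cst.
  - exact: cvg_cst.
by move=> t; exact: (cvg_pair (h a.1 b.1 t) (h a.2 b.2 t)).
Qed.

Lemma lerp_near0 a b (A : set (plane R)) : nbhs a A ->
  \forall e \near 0^'+, A (lerp a b e).
Proof.
move=> nA; have h : \forall e \near (0 : R), A (lerp a b e).
  by apply: (@lerp_continuous a b 0); rewrite lerp0.
exact: cvg_within h.
Qed.

(** A segment that avoids the boundary of [K] is connected, and both [K] and
    its interior are clopen in it. *)
Lemma stay_inside K a b : closed K ->
  (forall t, 0 <= t <= 1 -> ~ (K `\` K°) (lerp a b t)) ->
  (K° a -> K° b) /\ (~ K a -> ~ K b).
Proof.
move=> clK off.
have cS : connected (lerp a b @` `[0, 1]).
  apply: connected_continuous_connected; first exact: segment_connected.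
  by apply: continuous_subspaceT => t; exact: lerp_continuous.
set S := _ @` _ in cS.
have Sa : S a by exists 0; rewrite /= ?lerp0 // in_itv /= lexx ler01.
have Sb : S b by exists 1; rewrite /= ?lerp1 // in_itv /= lexx ler01.
have SK : S `&` K° = S `&` K.
  apply/seteqP; split=> z [Sz Kz]; split=> //; first exact: interior_subset.
  apply: contrapT => nKz; move: Sz => [t]; rewrite /= in_itv /= => t01 zE.
  by apply: (off t t01); rewrite zE.
split=> [Ka|nKa Kb].
  have -> : K° b = (S `&` K°) b by apply/propext; split=> [|[]].
  rewrite (cS (S `&` K°)) //.
  - by exists a.
  - by exists K° => //; exact: open_interior.
  - by exists K.
have : (S `&` ~` K) = S.
  apply: cS.
  - by exists a.
  - by exists (~` K) => //; exact: closed_openC.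
  - exists (~` K°); first exact: open_closedC (open_interior _).
    apply/seteqP; split=> z [Sz Kz]; split=> // Kz'.
      by apply: Kz; apply: interior_subset.
    have : (S `&` K) z by [].
    by rewrite -SK => -[].
by move=> /seteqP[_ /(_ b Sb)] [].
Qed.

End PlaneGeometry.

Section Near.
Variable R : realType.
Implicit Types (a b c d x y z : plane R).

Lemma near0_lt1 : \forall e \near (0 : R)^'+, 0 < e < 1.
Proof. by near=> e; apply/andP; split; near: e; [exact: nbhs_right_gt|exact: nbhs_right_lt].
Unshelve. all: by end_near. Qed.

Lemma near0_mix_gt0 (u v : R) : 0 < u ->
  \forall e \near (0 : R)^'+, 0 < (1 - e) * u + e * v.
Proof.
move=> u0; near=> e.
have e0 : 0 < e by near: e; exact: nbhs_right_gt.
have : e * (u + `|v|) < u.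
  rewrite -ltr_pdivlMr; last by rewrite ltr_pwDl.
  by near: e; apply: nbhs_right_lt; rewrite divr_gt0// ltr_pwDl.
have : e * (- v) <= e * `|v| by rewrite ler_pM2l// ler_normr lexx orbT.
lra.
Unshelve. all: by end_near. Qed.

Lemma near0_orient_lt0 a b c d : orient a b c < 0 ->
  \forall e \near (0 : R)^'+, orient a b (lerp c d e) < 0.
Proof.
move=> h; have h' : 0 < - orient a b c by lra.
apply: filterS (near0_mix_gt0 (- orient a b d) h') => e.
by rewrite orient_lerp; lra.
Qed.

Lemma near0_ex (P : R -> Prop) : (\forall e \near (0 : R)^'+, P e) ->
  exists e, [/\ 0 < e, e < 1 & P e].
Proof.
move=> h; near ((0 : R)^'+) => e; exists e.
have /andP[-> ->] : 0 < e < 1 by near: e; exact: near0_lt1.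
by split=> //; near: e.
Unshelve. all: by end_near. Qed.

Lemma segment_closed a b : closed (segment a b).
Proof.
apply: compact_closed; first exact: norm_hausdorff.
apply: continuous_compact; last exact: segment_compact.
by apply: continuous_subspaceT => t; exact: lerp_continuous.
Qed.

End Near.

(** * Sides of an edge of a polygon *)

Section Polygon.
Variables (R : realType) (I : finType) (p : I -> plane R).
Hypothesis gp : general_position p.
Implicit Types (s : {perm I}) (i j k : I) (x y z q : plane R)
  (K : set (plane R)).

Lemma p_inj : injective p. Proof. by case: gp. Qed.

Lemma orient_neq0 i j k : i != j -> j != k -> i != k ->
  orient (p i) (p j) (p k) != 0.
Proof. by case: gp => _; exact. Qed.

Lemma vertices_s s i : (s i \in vertices s) = (i \in vertices s).
Proof. by rewrite !inE (inj_eq perm_inj). Qed.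

Lemma vertices_sV s i : ((s^-1)%g i \in vertices s) = (i \in vertices s).
Proof. by rewrite -[in RHS](permKV s i) vertices_s. Qed.

(** The edges that do not contain [x] are closed and finite in number. *)
Lemma chain_away s x : exists2 r : R, 0 < r &
  forall z, box x r z -> forall j, segment (p j) (p (s j)) z ->
    segment (p j) (p (s j)) x.
Proof.
have h : nbhs x (fun z => forall j, segment (p j) (p (s j)) z ->
    segment (p j) (p (s j)) x).
  apply: (@filter_forall _ _ (fun j z => segment (p j) (p (s j)) z ->
    segment (p j) (p (s j)) x) (nbhs x) _) => j.
  have [xj|xj] := pselect (segment (p j) (p (s j)) x).
    by apply: filterE.
  have /closed_openC op := @segment_closed R (p j) (p (s j)).
  have : nbhs x (~` segment (p j) (p (s j))) by apply: open_nbhs_nbhs; split.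
  by apply: filterS => z.
by move/nbhs_boxP : h.
Qed.

Lemma box_nbhs x r z : box x r z -> nbhs z (box x r).
Proof.
move=> [z1 z2]; apply/nbhs_boxP.
exists (Num.min (r - `|z.1 - x.1|) (r - `|z.2 - x.2|)).
  by rewrite lt_min !subr_gt0 z1 z2.
move=> y [/=]; rewrite !lt_min => /andP[y1 _] /andP[_ y2]; split.
  have := ler_normD (y.1 - z.1) (z.1 - x.1).
  by rewrite addrA subrK; move: y1; lra.
have := ler_normD (y.2 - z.2) (z.2 - x.2).
by rewrite addrA subrK; move: y2; lra.
Qed.

Lemma lerp_inj a b (t u : R) : a != b -> lerp a b t = lerp a b u -> t = u.
Proof.
move=> + [h1 h2]; rewrite /= in h1 h2.
have h1' : (t - u) * (b.1 - a.1) = 0 by lra.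
have h2' : (t - u) * (b.2 - a.2) = 0 by lra.
move: h1' h2' => /eqP; rewrite mulf_eq0 !subr_eq0 => /orP[/eqP//|/eqP e1].
move=> /eqP; rewrite mulf_eq0 !subr_eq0 => /orP[/eqP//|/eqP e2].
by rewrite [a]surjective_pairing -e1 -e2 -surjective_pairing eqxx.
Qed.

Lemma orient_on_segment a b x : segment a b x -> orient a b x = 0.
Proof.
by move=> /segmentP[t [_ _ ->]]; rewrite orient_lerp orient_aba orient_abb; lra.
Qed.

Lemma open_segmentW a b x : open_segment a b x -> segment a b x.
Proof.
move=> /open_segmentP[t [t0 t1 ->]]; apply/segmentP; exists t.
by split=> //; exact: ltW.
Qed.

Section Cell.
Variables (s : {perm I}) (K : set (plane R)).
Hypothesis sK : polygon p s K.

Let simple_s : simple_chain p s. Proof. by case: sK. Qed.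

Lemma polygon_closed : closed K.
Proof. by case: sK => _ cK _ _ _; apply: compact_closed => //; exact: norm_hausdorff. Qed.

Lemma polygon_boundary x : (K `\` K°) x <->
  exists2 j, j \in vertices s & segment (p j) (p (s j)) x.
Proof.
case: sK => _ _ _ -> _; split=> [[j /= js xj]|[j js xj]]; first by exists j.
by exists j.
Qed.

Lemma edge_neq i : i \in vertices s -> p i != p (s i).
Proof. by rewrite inE => h; apply: contra h => /eqP/p_inj <-. Qed.

Lemma edge_unique j k x : j \in vertices s -> k \in vertices s ->
  open_segment (p j) (p (s j)) x -> segment (p k) (p (s k)) x -> k = j.
Proof.
move=> js ks xj xk; apply: contrapT => /eqP kj.
have jk : j != k by rewrite eq_sym.
have pj := edge_neq js.
have := (simple_s.2 j k x js ks jk (open_segmentW xj) xk).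
move: xj => /open_segmentP[t [t0 t1 xE]] [[jE]|[kE]].
  rewrite xE => e; have : t = 0 by apply: (lerp_inj pj); rewrite lerp0.
  lra.
rewrite xE kE => e; have : t = 1 by apply: (lerp_inj pj); rewrite lerp1.
lra.
Qed.

Lemma vertex_unique i k : i \in vertices s -> k \in vertices s ->
  segment (p k) (p (s k)) (p i) -> k = i \/ k = (s^-1)%g i.
Proof.
move=> vi vk xk; have [->|ki] := eqVneq k i; first by left.
have ik : i != k by rewrite eq_sym.
have ii : segment (p i) (p (s i)) (p i).
  by apply/segmentP; exists 0; rewrite lerp0.
have := simple_s.2 i k (p i) vi vk ik ii xk.
move=> [[->]|[_ /p_inj ?]]; last by subst; rewrite eqxx in ki.
by right; rewrite permK.
Qed.

Lemma edge_local j x : j \in vertices s ->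
  open_segment (p j) (p (s j)) x -> exists2 r : R, 0 < r &
  forall z, box x r z -> (K `\` K°) z -> orient (p j) (p (s j)) z = 0.
Proof.
move=> js xj; have [r r0 h] := chain_away s x.
exists r => // z zr /polygon_boundary[k ks zk].
have kj := edge_unique js ks xj (h z zr k zk).
by apply: orient_on_segment; rewrite -kj.
Qed.

Definition normal_end (sg : R) j x : plane R :=
  (x.1 - sg * ((p (s j)).2 - (p j).2), x.2 + sg * ((p (s j)).1 - (p j).1)).

Definition normal_pt (sg : R) j x (e : R) := lerp x (normal_end sg j x) e.

Lemma normal_pt_orient sg j x e : j \in vertices s ->
  orient (p j) (p (s j)) x = 0 -> 0 < e -> 0 < sg * sg ->
  0 < sg * orient (p j) (p (s j)) (normal_pt sg j x e).
Proof.
move=> js x0 e0 sg0.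
rewrite /normal_pt orient_lerp x0.
set v := p (s j) - p j.
have -> : orient (p j) (p (s j)) (normal_end sg j x) =
    orient (p j) (p (s j)) x + sg * (v.1 ^+ 2 + v.2 ^+ 2).
  by rewrite /orient /v /=; ring.
rewrite x0 mulr0 !add0r mulrCA [sg * (sg * _)]mulrA mulr_gt0// mulr_gt0//.
have := edge_neq js; rewrite eq_sym -subr_eq0 -/v => v0.
rewrite lt_neqAle addr_ge0 ?sqr_ge0// andbT eq_sym.
rewrite paddr_eq0 ?sqr_ge0// !sqrf_eq0; apply: contra v0 => /andP[/eqP h1 /eqP h2].
by rewrite [v]surjective_pairing h1 h2.
Qed.

(** The region is only assumed to lie to the left along normals to the edge. A
    short normal at [x] gives one interior point in the half disc, and the
    half disc contains no boundary point, so the interior spreads over it. *)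
Lemma half_left j x : j \in vertices s ->
  open_segment (p j) (p (s j)) x -> exists2 r : R, 0 < r &
  forall z, box x r z -> 0 < orient (p j) (p (s j)) z -> K° z.
Proof.
move=> js xj; have [r r0 h] := edge_local js xj; exists r => // z zr z0.
case: sK => _ _ _ _ /(_ j x js xj) nK.
have : nbhs x (box x r) by apply/nbhs_boxP; exists r.
move=> /(lerp_near0 (normal_end 1 j x)) nb.
near ((0 : R)^'+) => e.
have e0 : 0 < e by near: e; exact: nbhs_right_gt.
have yr : box x r (normal_pt 1 j x e) by near: e; exact: nb.
pose y := normal_pt 1 j x e.
have yo : 0 < orient (p j) (p (s j)) y.
  have := @normal_pt_orient 1 j x e js
    (orient_on_segment (open_segmentW xj)) e0.
  by rewrite !mul1r; apply.
have yK : K y.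
  have -> : y = x + e *: rot90 (p (s j) - p j).
    by rewrite /normal_pt /normal_end /lerp /rot90 /GRing.scale/=; congr pair => /=; rewrite /GRing.scale/=; ring.
  by near: e.
have off t : 0 <= t <= 1 -> ~ (K `\` K°) (lerp y z t).
  move=> t01 /(h _ (box_lerp t01 yr zr)).
  rewrite orient_lerp; have /andP[t0 t1] := t01.
  have [t0'|t0'] := ltP 0 t.
    have : 0 < t * orient (p j) (p (s j)) z by apply: mulr_gt0.
    have : 0 <= (1 - t) * orient (p j) (p (s j)) y by apply: mulr_ge0; lra.
    lra.
  have -> : t = 0 by lra.
  lra.
apply: (stay_inside polygon_closed off).1.
apply: contrapT => nKy; apply: (off 0); rewrite ?lexx ?ler01//.
by rewrite lerp0.
Unshelve. all: by end_near. Qed.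

End Cell.
End Polygon.

(** * Angular sectors of a polygon at its vertices *)

Section Sectors.
Variables (R : realType) (I : finType) (p : I -> plane R).
Hypothesis gp : general_position p.
Implicit Types (s : {perm I}) (i j k : I) (x y z q : plane R).

(** For [sg = 1] this is the open internal angle at [i], an intersection or a
    union of two half planes according to the turn; for [sg = -1] it is the
    open external angle. *)
Definition sector (sg : R) s i z : bool :=
  if 0 < sg * turn p s i then
    (0 < sg * orient (p i) (p (s i)) z) &&
    (0 < sg * orient (p ((s^-1)%g i)) (p i) z)
  else (0 < sg * orient (p i) (p (s i)) z) ||
       (0 < sg * orient (p ((s^-1)%g i)) (p i) z).

Variables (s : {perm I}) (K : set (plane R)).
Hypothesis sK : polygon p s K.

(** If the right half disc contained one point of [K], it would lie in [K]
    entirely, and so would the full disc; then [x] would be an interior point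
    of [K] although it lies on the boundary. *)
Lemma half_right j x : j \in vertices s ->
  open_segment (p j) (p (s j)) x -> exists2 r : R, 0 < r &
  forall z, box x r z -> orient (p j) (p (s j)) z < 0 -> ~ K z.
Proof.
move=> js xj; have [r1 r10 h1] := edge_local gp sK js xj.
have [r2 r20 h2] := half_left gp sK js xj.
pose r := Num.min r1 r2.
have box1 z : box x r z -> box x r1 z.
  by move=> [/=]; rewrite !lt_min => /andP[? _] /andP[? _].
have box2 z : box x r z -> box x r2 z.
  by move=> [/=]; rewrite !lt_min => /andP[_ ?] /andP[_ ?].
exists r => [|z0 z0r z0o Kz0]; first by rewrite lt_min r10 r20.
have right z : box x r z -> orient (p j) (p (s j)) z < 0 -> K z.
  move=> zr zo; apply: interior_subset.
  have off t : 0 <= t <= 1 -> ~ (K `\` K°) (lerp z0 z t).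
    move=> t01 /(h1 _ (box1 _ (box_lerp t01 z0r zr))).
    rewrite orient_lerp => h.
    have : (1 - t) * - orient (p j) (p (s j)) z0 +
           t * - orient (p j) (p (s j)) z = 0 by lra.
    have /andP[t0 t1] := t01.
    have [t0'|t0'] := ltP 0 t.
      have : 0 < t * - orient (p j) (p (s j)) z by apply: mulr_gt0 => //; lra.
      have : 0 <= (1 - t) * - orient (p j) (p (s j)) z0 by apply: mulr_ge0; lra.
      lra.
    have -> : t = 0 by lra.
    lra.
  apply: (stay_inside (polygon_closed sK) off).1.
  apply: contrapT => nKy; apply: (off 0); rewrite ?lexx ?ler01//.
  by rewrite lerp0.
have sub : box x r `<=` K.
  move=> z zr; have [zo|zo|zo] := ltgtP (orient (p j) (p (s j)) z) 0.
  - exact: right.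
  - by apply: interior_subset; apply: h2 => //; exact: box2.
  apply: (polygon_closed sK) => B nB.
  near ((0 : R)^'+) => e.
  have e0 : 0 < e by near: e; exact: nbhs_right_gt.
  exists (lerp z (normal_end p s 1 j z) e); split; last first.
    by near: e; apply: lerp_near0.
  apply: interior_subset; apply: h2.
    by near: e; apply: lerp_near0; apply: box_nbhs; exact: box2.
  have := @normal_pt_orient _ _ _ gp s 1 j z e js zo e0.
  by rewrite !mul1r; apply.
have : K° x by apply/nbhs_boxP; exists r; rewrite // lt_min r10 r20.
have [_ ] : (K `\` K°) x.
  by apply/(polygon_boundary sK); exists j => //; exact: open_segmentW.
by [].
Unshelve. all: by end_near. Qed.

(** The interior of the polygon ([sg = 1]) and its exterior ([sg = -1]) are
    treated together, as a set [X] that lies on the side [sg] of each edge and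
    that a segment leaves only through the boundary. *)
Variables (sg : R) (X : set (plane R)).
Hypothesis sg2 : sg * sg = 1.
Hypothesis X_edge : forall j x, j \in vertices s ->
  open_segment (p j) (p (s j)) x -> exists2 r : R, 0 < r &
  forall z, box x r z -> 0 < sg * orient (p j) (p (s j)) z -> X z.
Hypothesis X_path : forall a b,
  (forall t, 0 <= t <= 1 -> ~ (K `\` K°) (lerp a b t)) -> X a -> X b.

(** A point of the sector close to the vertex can be joined, inside the
    sector, to a point close to one of the two edges at the vertex; no other
    edge is near. *)
Lemma sector_local i : i \in vertices s -> exists2 r : R, 0 < r &
  forall z, box (p i) r z -> sector sg s i z -> X z.
Proof.
move=> vi; pose u := (s^-1)%g i.
have su : s u = i by rewrite /u permKV.
have vu : u \in vertices s by rewrite /u vertices_sV.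
have [r r0 away] := chain_away p s (p i).
have loc z : box (p i) r z -> (K `\` K°) z ->
    segment (p i) (p (s i)) z \/ segment (p u) (p i) z.
  move=> zr /(polygon_boundary sK)[k vk zk].
  have [ki|ku] := vertex_unique gp sK vi vk (away z zr k zk).
    by left; rewrite -ki.
  by right; move: zk; rewrite ku -/u su.
have near_edge j x : j \in vertices s -> open_segment (p j) (p (s j)) x ->
    \forall e \near (0 : R)^'+, X (normal_pt p s sg j x e) /\
      0 < sg * orient (p j) (p (s j)) (normal_pt p s sg j x e).
  move=> vj xj; have [r' r'0 h] := X_edge vj xj.
  near=> e.
  have e0 : 0 < e by near: e; exact: nbhs_right_gt.
  have o : 0 < sg * orient (p j) (p (s j)) (normal_pt p s sg j x e).
    apply: normal_pt_orient => //; last by rewrite sg2.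
    by apply: orient_on_segment; exact: open_segmentW.
  split=> //; apply: h => //; near: e; apply: lerp_near0.
  by apply/nbhs_boxP; exists r'.
have pbox : nbhs (p i) (box (p i) r) by apply/nbhs_boxP; exists r.
have pos2 c d x y t : 0 <= t <= 1 -> 0 < sg * orient c d x ->
    0 < sg * orient c d y -> 0 < sg * orient c d (lerp x y t).
  move=> /andP[t0 t1] hx hy; rewrite orient_lerp.
  have [t0'|t0'] := ltP 0 t.
    have : 0 < t * (sg * orient c d y) by apply: mulr_gt0.
    have : 0 <= (1 - t) * (sg * orient c d x) by apply: mulr_ge0; lra.
    lra.
  have -> : t = 0 by lra.
  lra.
have turnE : turn p s i = orient (p u) (p i) (p (s i)) by [].
exists r => // z zr; rewrite /sector -/u.
(* Here [z] is joined to a point near the edge that leaves the vertex. *)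
have goW : 0 < sg * orient (p i) (p (s i)) z ->
    (0 < sg * turn p s i -> 0 < sg * orient (p u) (p i) z) -> X z.
  move=> zw zu.
  have [d [d0 d1 xr]] : exists d, [/\ 0 < d, d < 1 &
      box (p i) r (lerp (p i) (p (s i)) d)].
    by apply: near0_ex; exact: lerp_near0.
  set x := lerp _ _ _ in xr.
  have xe : open_segment (p i) (p (s i)) x by apply/open_segmentP; exists d.
  have nu : \forall e \near (0 : R)^'+, 0 < sg * turn p s i ->
      0 < sg * orient (p u) (p i) (normal_pt p s sg i x e).
    have [t0|] := ltP 0 (sg * turn p s i); last by move=> ?; apply: filterE.
    have : 0 < sg * orient (p u) (p i) x.
      by rewrite orient_lerp orient_abb mulr0 add0r -turnE mulrCA mulr_gt0.
    move=> /(near0_mix_gt0 (sg * orient (p u) (p i) (normal_end p s sg i x))).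
    by apply: filterS => e; rewrite /normal_pt orient_lerp; lra.
  near ((0 : R)^'+) => e.
  have [Xe oe] : X (normal_pt p s sg i x e) /\
      0 < sg * orient (p i) (p (s i)) (normal_pt p s sg i x e).
    by near: e; exact: near_edge.
  have er : box (p i) r (normal_pt p s sg i x e).
    by near: e; apply: lerp_near0; exact: box_nbhs.
  have eu : 0 < sg * turn p s i ->
      0 < sg * orient (p u) (p i) (normal_pt p s sg i x e) by near: e.
  apply: X_path Xe => t t01 /(loc _ (box_lerp t01 er zr)).
  have hw := pos2 _ _ _ _ _ t01 oe zw.
  move=> [/orient_on_segment h|]; first by move: hw; rewrite h mulr0 ltxx.
  have [t0|t0] := ltP 0 (sg * turn p s i).
    have hu := pos2 _ _ _ _ _ t01 (eu t0) (zu t0).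
    by move=> /orient_on_segment h; move: hu; rewrite h mulr0 ltxx.
  move=> /segmentP[c [c0 c1 cE]]; move: hw; rewrite cE orient_lerp orient_aba.
  rewrite mulr0 addr0 orient_rot -turnE.
  have : 0 <= (1 - c) * - (sg * turn p s i) by apply: mulr_ge0; lra.
  lra.
(* Here [z] is joined to a point near the edge that enters the vertex. *)
have goU : 0 < sg * orient (p u) (p i) z -> sg * turn p s i <= 0 -> X z.
  move=> zu t0.
  have [d [d0 d1 xr]] : exists d, [/\ 0 < d, d < 1 &
      box (p i) r (lerp (p i) (p u) d)].
    by apply: near0_ex; exact: lerp_near0.
  set x := lerp _ _ _ in xr.
  have xe : open_segment (p u) (p (s u)) x.
    apply/open_segmentP; exists (1 - d); split; [lra|lra|].
    by rewrite su /x /lerp; congr pair; ring.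
  near ((0 : R)^'+) => e.
  have [Xe] : X (normal_pt p s sg u x e) /\
      0 < sg * orient (p u) (p (s u)) (normal_pt p s sg u x e).
    by near: e; exact: near_edge.
  rewrite su => oe.
  have er : box (p i) r (normal_pt p s sg u x e).
    by near: e; apply: lerp_near0; exact: box_nbhs.
  apply: X_path Xe => t t01 /(loc _ (box_lerp t01 er zr)).
  have hu := pos2 _ _ _ _ _ t01 oe zu.
  move=> [|/orient_on_segment h]; last by move: hu; rewrite h mulr0 ltxx.
  move=> /segmentP[c [c0 c1 cE]]; move: hu; rewrite cE orient_lerp orient_abb.
  rewrite mulr0 add0r -turnE.
  have : 0 <= c * - (sg * turn p s i) by apply: mulr_ge0; lra.
  lra.
case: ltP => [t0 /andP[zw zu]|t0 /orP[zw|zu]]; last exact: goU.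
  exact: goW.
by apply: goW => //; lra.
Unshelve. all: by end_near. Qed.

End Sectors.

Section CellSectors.
Variables (R : realType) (I : finType) (p : I -> plane R).
Hypothesis gp : general_position p.
Variables (s : {perm I}) (K : set (plane R)).
Hypothesis sK : polygon p s K.

Lemma sector_inside i : i \in vertices s -> exists2 r : R, 0 < r &
  forall z, box (p i) r z -> sector p 1 s i z -> K° z.
Proof.
apply: (sector_local gp sK (mulr1 1)) => [j x vj xj|a b off].
  by have [r r0 h] := half_left gp sK vj xj; exists r => // z zr; rewrite mul1r; exact: h.
exact: (stay_inside (polygon_closed sK) off).1.
Qed.

Lemma sector_outside i : i \in vertices s -> exists2 r : R, 0 < r &
  forall z, box (p i) r z -> sector p (-1) s i z -> ~ K z.
Proof.
apply: (@sector_local _ _ _ gp _ _ sK (-1) (~` K)) => [|j x vj xj|a b off].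
- ring.
- have [r r0 h] := half_right gp sK vj xj; exists r => // z zr zo.
  by apply: h => //; lra.
exact: (stay_inside (polygon_closed sK) off).2.
Qed.

End CellSectors.

(** * Convex hulls *)

Section Hull.
Variables (R : realType) (I : finType) (p : I -> plane R).
Implicit Types (x y : plane R).

Lemma hull_lerp x y (t : R) : 0 <= t <= 1 -> conv_hull p x -> conv_hull p y ->
  conv_hull p (lerp x y t).
Proof.
move=> /andP[t0 t1] [w [w0 w1 ->]] [v [v0 v1 ->]].
exists (fun i => (1 - t) * w i + t * v i); split=> [i||].
- by rewrite addr_ge0// mulr_ge0// subr_ge0.
- by rewrite big_split/= -!big_distrr/= w1 v1; lra.
rewrite -lerpE !scaler_sumr -big_split/=; apply: eq_bigr => i _.
by rewrite !scalerA -scalerDl.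
Qed.

Lemma hull_pt i : conv_hull p (p i).
Proof.
exists (fun j => (j == i)%:R); split=> [j||]; first by rewrite ler0n.
  by rewrite (bigD1 i)//= eqxx big1 ?addr0// => j /negbTE->.
by rewrite (bigD1 i)//= eqxx scale1r big1 ?addr0// => j /negbTE->; rewrite scale0r.
Qed.

Lemma orient_sum (a b : plane R) (w : I -> R) : \sum_i w i = 1 ->
  orient a b (\sum_i w i *: p i) = \sum_i w i * orient a b (p i).
Proof.
move=> w1.
have e1 : (\sum_i w i *: p i).1 = \sum_i w i * (p i).1.
  by rewrite (raddf_sum (@fst R R : {additive plane R -> R})).
have e2 : (\sum_i w i *: p i).2 = \sum_i w i * (p i).2.
  by rewrite (raddf_sum (@snd R R : {additive plane R -> R})).
rewrite /orient e1 e2.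
have c (f : I -> R) u : \sum_i w i * f i - u = \sum_i w i * (f i - u).
  under [RHS]eq_bigr do rewrite mulrBr.
  by rewrite sumrB -big_distrl/= w1 mul1r.
rewrite !c !big_distrr/= -sumrB; apply: eq_bigr => i _; ring.
Qed.

Lemma hull_halfplane (a b : plane R) x :
  (forall i, 0 <= orient a b (p i)) -> conv_hull p x -> 0 <= orient a b x.
Proof.
move=> h [w [w0 w1 ->]]; rewrite orient_sum//.
by apply: sumr_ge0 => i _; rewrite mulr_ge0.
Qed.

End Hull.

(** * The sectors at a point partition the directions into the hull *)

Section Global.
Variables (R : realType) (I : finType) (p : I -> plane R).
Hypothesis gp : general_position p.
Implicit Types (s : {perm I}) (T : {set {perm I}}) (i j k u v w : I)
  (x y z q : plane R).

Definition adj T i j : bool :=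
  (i != j) && [exists s in T, (s i == j) || (s j == i)].

Lemma adj_sym T i j : adj T i j = adj T j i.
Proof.
rewrite /adj eq_sym; congr (_ && _); apply: eq_existsb => s.
by rewrite [in RHS]orbC.
Qed.

Lemma adj_next T s i : s \in T -> i \in vertices s -> adj T i (s i).
Proof.
rewrite inE eq_sym => sT vi; rewrite /adj vi; apply/existsP; exists s.
by rewrite sT eqxx.
Qed.

Lemma adj_prev T s i : s \in T -> i \in vertices s -> adj T i ((s^-1)%g i).
Proof.
move=> sT vi; rewrite adj_sym -[in X in adj T _ X](permKV s i).
by apply: adj_next; rewrite ?vertices_sV.
Qed.

Lemma adjP T i j : adj T i j -> exists2 s, s \in T &
  (i \in vertices s /\ s i = j) \/ (j \in vertices s /\ s j = i).
Proof.
move=> /andP[ij /existsP[s /andP[sT /orP[/eqP e|/eqP e]]]]; exists s => //.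
  by left; rewrite inE e eq_sym.
by right; rewrite inE e.
Qed.

Section SectorFacts.
Variables (s : {perm I}) (K : set (plane R)).
Hypothesis sK : polygon p s K.

Lemma no_two_cycle i : i \in vertices s -> s (s i) != i.
Proof.
move=> vi; apply/eqP => e.
pose x := lerp (p i) (p (s i)) (1 / 2).
have xi : open_segment (p i) (p (s i)) x.
  by apply/open_segmentP; exists (1 / 2); split => //; lra.
have xsi : segment (p (s i)) (p (s (s i))) x.
  rewrite e; apply/segmentP; exists (1 / 2); split; [lra|lra|].
  by rewrite /x /lerp; congr pair; lra.
have := edge_unique gp sK vi _ xi xsi; rewrite vertices_s => /(_ vi) sii.
by move: vi; rewrite inE sii eqxx.
Qed.

Lemma next_neq_prev i : i \in vertices s -> s i != (s^-1)%g i.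
Proof.
move=> vi; apply: contra (no_two_cycle vi) => /eqP e.
by rewrite e permKV.
Qed.

Lemma prev_neq i : i \in vertices s -> (s^-1)%g i != i.
Proof. by rewrite -(vertices_sV s) inE permKV eq_sym. Qed.

Lemma turn_neq0 i : i \in vertices s -> turn p s i != 0.
Proof.
move=> vi; apply: (orient_neq0 gp); first exact: prev_neq.
- by move: vi; rewrite inE eq_sym.
- by rewrite eq_sym; exact: next_neq_prev.
Qed.

End SectorFacts.

Lemma sector_lerp (sg e : R) s i q : 0 < e ->
  sector p sg s i (lerp (p i) q e) = sector p sg s i q.
Proof.
move=> e0; rewrite /sector !orient_lerp orient_aba orient_abb.
have h (a : R) : (0 < sg * (e * a)) = (0 < sg * a) by rewrite mulrCA pmulr_rgt0.
by rewrite !mulr0 !add0r !h.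
Qed.

(** The condition of [pseudo_triangulation] with the regions of the cells
    named, so that they can be used throughout. *)
Definition cell_family T (K : {perm I} -> set (plane R)) : Prop :=
  (forall i : I, exists2 s, s \in T & i \in vertices s) /\
  [/\ forall s, s \in T -> pseudo_triangle p s (K s),
      forall s s', s \in T -> s' \in T -> s != s' ->
        (K s)° `&` (K s')° = set0 &
      \bigcup_(s in [set` T]) K s = conv_hull p].

Section Triangulation.
Variables (T : {set {perm I}}) (K : {perm I} -> set (plane R)).
Hypothesis tri : cell_family T K.

Let T_vertex : forall i : I, exists2 s, s \in T & i \in vertices s.
Proof. by case: tri. Qed.

Let T_cell : forall s, s \in T -> pseudo_triangle p s (K s).
Proof. by case: tri => _ []. Qed.

Let T_disj : forall s s', s \in T -> s' \in T -> s != s' ->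
  (K s)° `&` (K s')° = set0.
Proof. by case: tri => _ []. Qed.

Let T_cover : \bigcup_(s in [set` T]) K s = conv_hull p.
Proof. by case: tri => _ []. Qed.

Lemma cell_polygon s : s \in T -> polygon p s (K s).
Proof. by move=> /T_cell[]. Qed.

(** A regular closed set is the closure of its interior, so an open set that
    meets it also meets its interior. *)
Lemma interior_unique s s' x : s \in T -> s' \in T -> (K s)° x -> K s' x ->
  s = s'.
Proof.
move=> sT s'T xs xs'; apply: contrapT => /eqP ss'.
have [_ _ rc _ _] := cell_polygon s'T.
have : closure (K s')° x by rewrite rc.
move=> /(_ (K s)°) []; first by apply: open_nbhs_nbhs; split => //; exact: open_interior.
by move=> y [y' y2]; have : ((K s)° `&` (K s')°) y by []; rewrite T_disj.
Qed.

(** An interior point of one cell lies in no other cell, so a boundary point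
    of some cell is an interior point of none. *)
Lemma edge_not_interior s s' j x : s \in T -> s' \in T -> j \in vertices s' ->
  segment (p j) (p (s' j)) x -> ~ (K s)° x.
Proof.
move=> sT s'T vj xj xs.
have [Kx nKx] : (K s' `\` (K s')°) x.
  by apply/(polygon_boundary (cell_polygon s'T)); exists j.
by apply: nKx; rewrite -(interior_unique sT s'T xs Kx).
Qed.

Lemma adj_segment i j x : adj T i j -> segment (p i) (p j) x ->
  forall s, s \in T -> ~ (K s)° x.
Proof.
move=> /adjP[s' s'T [[vi <-]|[vj <-]]] xj s sT.
  exact: edge_not_interior s'T vi xj.
apply: edge_not_interior s'T vj _ => //.
move: xj => /segmentP[t [t0 t1 ->]]; apply/segmentP; exists (1 - t).
by split; [lra|lra|rewrite /lerp; congr pair; ring].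
Qed.

(** Points of the edge close to [i] would be interior points of the cell. *)
Lemma adj_notin_sector s i j : s \in T -> i \in vertices s -> adj T i j ->
  ~~ sector p 1 s i (p j).
Proof.
move=> sT vi ij; apply/negP => js.
have [r r0 h] := sector_inside gp (cell_polygon sT) vi.
have [e [e0 e1 er]] : exists e, [/\ 0 < e, e < 1 & box (p i) r (lerp (p i) (p j) e)].
  by apply: near0_ex; apply: lerp_near0; apply/nbhs_boxP; exists r.
apply: (adj_segment ij _ sT (x := lerp (p i) (p j) e)).
  by apply/segmentP; exists e; split=> //; exact: ltW.
by apply: h; rewrite // sector_lerp.
Qed.

(** A direction that avoids all points of the set is not along an edge of the
    cell, so it points strictly inside or strictly outside. *)
Lemma generic_sector s i q : s \in T -> i \in vertices s ->
  (forall j, j != i -> orient (p i) (p j) q != 0) ->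
  sector p 1 s i q \/ sector p (-1) s i q.
Proof.
move=> sT vi gen; have t0 := turn_neq0 (cell_polygon sT) vi.
have a0 : orient (p i) (p (s i)) q != 0 by apply: gen; move: vi; rewrite inE.
have b0 : orient (p ((s^-1)%g i)) (p i) q != 0.
  rewrite orient_swap oppr_eq0; apply: gen.
  exact: prev_neq vi.
rewrite /sector !mul1r !mulN1r !oppr_gt0.
move: t0 a0 b0; rewrite !neq_lt.
move=> /orP[t|t] /orP[a|a] /orP[b|b];
  rewrite ?t ?a ?b ?(lt_gtF t) ?(lt_gtF a) ?(lt_gtF b) /=;
  by [left|right].
Qed.

(** Points close to [p i] in the given direction belong to some cell. A cell
    for which the direction is external, or that does not have [i] as a
    vertex, misses them: in the second case [p i] is not even in the cell,
    since it is not in the interior by [edge_not_interior] and, by general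
    position, not on the boundary. *)
Lemma cover_direction i q :
  (forall j, j != i -> orient (p i) (p j) q != 0) ->
  (\forall e \near (0 : R)^'+, conv_hull p (lerp (p i) q e)) ->
  exists s, [/\ s \in T, i \in vertices s & sector p 1 s i q].
Proof.
move=> gen nh; apply: contrapT => no.
have out s : s \in T -> \forall e \near (0 : R)^'+, ~ K s (lerp (p i) q e).
  move=> sT; have sK := cell_polygon sT.
  have [vi|vi] := boolP (i \in vertices s).
    have [sec|sec] := generic_sector sT vi gen; first by exfalso; apply: no; exists s.
    have [r r0 h] := sector_outside gp sK vi.
    near=> e.
    have e0 : 0 < e by near: e; exact: nbhs_right_gt.
    apply: h; last by rewrite sector_lerp.
    by near: e; apply: lerp_near0; apply/nbhs_boxP; exists r.
  apply: (@lerp_near0 _ _ _ (~` K s)).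
  have nKi : ~ K s (p i).
    move=> Ki; have [s1 s1T vi1] := T_vertex i.
    have ii : segment (p i) (p (s1 i)) (p i).
      by apply/segmentP; exists 0; rewrite lerp0.
    have nint := edge_not_interior sT s1T vi1 ii.
    have [j vj ij] : exists2 j, j \in vertices s & segment (p j) (p (s j)) (p i).
      by apply/(polygon_boundary sK).
    have ji : j != i by apply: contraNneq vi => <-.
    have sji : s j != i by apply: contraNneq vi => <-; rewrite vertices_s.
    have := @orient_neq0 _ _ _ gp j (s j) i.
    rewrite (orient_on_segment ij) eqxx.
    rewrite eq_sym in sji; rewrite inE eq_sym in vj.
    by move=> /(_ vj); rewrite eq_sym sji => /(_ isT ji).
  have op := closed_openC (polygon_closed sK).
  by apply: open_nbhs_nbhs; split.
have : \forall e \near (0 : R)^'+, forall s, s \in T -> ~ K s (lerp (p i) q e).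
  apply: (@filter_forall _ _ (fun s e => s \in T -> ~ K s (lerp (p i) q e)) _ _) => s.
  have [sT|sT] := boolP (s \in T); last by apply: filterE.
  by apply: filterS (out s sT).
move=> /filterI/(_ nh) /near0_ex [e [_ _ [h]]].
by rewrite -T_cover => -[s /= sT]; exact: h.
Unshelve. all: by end_near. Qed.

End Triangulation.
End Global.

(** * Edges of a pseudo-triangulation *)

Section Graph.
Variables (R : realType) (I : finType) (p : I -> plane R).
Hypothesis gp : general_position p.
Implicit Types (s : {perm I}) (T : {set {perm I}}) (i j k u v w : I)
  (x y z q c : plane R).

Lemma near0_mix_neq0 (a b : R) : a != 0 \/ b != 0 ->
  \forall e \near (0 : R)^'+, (1 - e) * a + e * b != 0.
Proof.
have [->|a0] := eqVneq a 0.
  move=> [/eqP//|b0]; near=> e.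
  have e0 : 0 < e by near: e; exact: nbhs_right_gt.
  by rewrite mulr0 add0r mulf_neq0// gt_eqF.
move=> _; move: a0; rewrite neq_lt => /orP[a0|a0].
  have a0' : 0 < - a by lra.
  apply: filterS (near0_mix_gt0 (- b) a0') => e h.
  by rewrite neq_lt; apply/orP; left; lra.
by apply: filterS (near0_mix_gt0 b a0) => e h; rewrite neq_lt h orbT.
Unshelve. all: by end_near. Qed.

Section Cells.
Variables (T : {set {perm I}}) (K : {perm I} -> set (plane R)).
Hypothesis tri : cell_family p T K.

Let polyT s : s \in T -> polygon p s (K s). Proof. exact: cell_polygon. Qed.

Lemma cell_sub_hull s x : s \in T -> K s x -> conv_hull p x.
Proof. by case: tri => _ [_ _ <-] sT Kx; exists s. Qed.

(** Turn the direction from [u] to [v] slightly towards [e]. The cell whose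
    sector contains it must start with the edge to [v]: the sector of a cell
    for which this edge is the other one at [u] lies across the edge, and any
    further sector would contain the direction of [v] itself, against
    [adj_notin_sector], or is bounded away from it. *)
Lemma directed_edge u v e : adj T u v -> 0 < orient (p u) (p v) (p e) ->
  exists2 s, s \in T & u \in vertices s /\ s u = v.
Proof.
move=> uv oe; pose q := lerp (p v) (p e).
have nuv : u != v by case/andP: uv.
have gen j : \forall t \near (0 : R)^'+, j != u -> orient (p u) (p j) (q t) != 0.
  have [->|ju] := eqVneq j u; first by apply: filterE.
  have [->|jv] := eqVneq j v.
    near=> t.
    have t0 : 0 < t by near: t; exact: nbhs_right_gt.
    by move=> _; rewrite orient_lerp orient_abb mulr0 add0r mulf_neq0// gt_eqF.
  have o : orient (p u) (p j) (p v) != 0.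
    by apply: (orient_neq0 gp) => //; rewrite eq_sym.
  have := near0_mix_neq0 (b := orient (p u) (p j) (p e)) (or_introl o).
  by apply: filterS => t h _; rewrite orient_lerp.
have miss s : \forall t \near (0 : R)^'+, s \in T -> u \in vertices s ->
    sector p 1 s u (q t) -> s u = v.
  have [sT|?] := boolP (s \in T); last by apply: filterE.
  have [vu|?] := boolP (u \in vertices s); last by apply: filterE.
  have [->|suv] := eqVneq (s u) v; first by apply: filterE.
  have t0 := turn_neq0 gp (polyT sT) vu.
  have Au : orient (p u) (p (s u)) (p v) != 0.
    by apply: (orient_neq0 gp) => //; move: vu; rewrite inE eq_sym.
  have := adj_notin_sector gp tri sT vu uv.
  rewrite /sector !mul1r.
  have [pv|pv] := eqVneq ((s^-1)%g u) v.
    move=> _; rewrite pv.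
    have nA : turn p s u < 0 ->
        \forall t \near (0 : R)^'+, orient (p u) (p (s u)) (q t) < 0.
      by move=> h; apply: near0_orient_lt0; rewrite orient_rot -pv.
    have nB : \forall t \near (0 : R)^'+, orient (p v) (p u) (q t) < 0.
      near=> t; have t1 : 0 < t by near: t; exact: nbhs_right_gt.
      by rewrite orient_swap orient_lerp orient_abb mulr0 add0r oppr_lt0 mulr_gt0.
    move: t0; rewrite neq_lt => /orP[t0|t0].
      apply: filterS2 nB (nA t0) => t B A _ _.
      by rewrite ?/sector !mul1r (lt_gtF t0) (lt_gtF A) (lt_gtF B).
    by apply: filterS nB => t B _ _; rewrite ?/sector !mul1r t0 (lt_gtF B) andbF.
  have Bu : orient (p ((s^-1)%g u)) (p u) (p v) != 0.
    apply: (orient_neq0 gp) => //; first exact: prev_neq.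
  have nA := near0_orient_lt0 (a := p u) (b := p (s u)) (c := p v) (p e).
  have nB := near0_orient_lt0 (a := p ((s^-1)%g u)) (b := p u) (c := p v) (p e).
  move: t0; rewrite neq_lt => /orP[t0|t0].
    rewrite (lt_gtF t0) negb_or -!leNgt => /andP[A0 B0].
    have {}A0 : orient (p u) (p (s u)) (p v) < 0 by rewrite lt_neqAle Au A0.
    have {}B0 : orient (p ((s^-1)%g u)) (p u) (p v) < 0 by rewrite lt_neqAle Bu B0.
    apply: filterS2 (nA A0) (nB B0) => t h1 h2 _ _.
    by rewrite ?/sector !mul1r (lt_gtF h1) (lt_gtF h2).
  rewrite t0 negb_and -!leNgt => /orP[A0|B0].
    have {}A0 : orient (p u) (p (s u)) (p v) < 0 by rewrite lt_neqAle Au A0.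
    by apply: filterS (nA A0) => t h1 _ _; rewrite ?/sector !mul1r (lt_gtF h1).
  have {}B0 : orient (p ((s^-1)%g u)) (p u) (p v) < 0 by rewrite lt_neqAle Bu B0.
  by apply: filterS (nB B0) => t h1 _ _; rewrite ?/sector !mul1r (lt_gtF h1) andbF.
have ngen : \forall t \near (0 : R)^'+, forall j, j != u ->
    orient (p u) (p j) (q t) != 0.
  exact: (@filter_forall _ _ (fun j t => j != u -> orient (p u) (p j) (q t) != 0)).
have nmiss : \forall t \near (0 : R)^'+, forall s, s \in T -> u \in vertices s ->
    sector p 1 s u (q t) -> s u = v.
  exact: (@filter_forall _ _ (fun s t => s \in T -> u \in vertices s ->
    sector p 1 s u (q t) -> s u = v)).
have [t [t0 t1 [g m]]] := near0_ex (filterI ngen nmiss).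
have [|s [sT vu sec]] := cover_direction gp tri g.
  apply: filterS (@near0_lt1 R) => d /andP[d0 d1].
  apply: hull_lerp; [by rewrite !ltW|exact: hull_pt|].
  by apply: hull_lerp; [rewrite !ltW|exact: hull_pt|exact: hull_pt].
by exists s => //; split=> //; exact: m.
Unshelve. all: by end_near. Qed.

(** At a crossing point, the second edge enters the half disc to the left of
    the first one, which is interior to a cell. *)
Lemma noncrossing i j k l : adj T i j -> adj T k l ->
  orient (p i) (p j) (p k) * orient (p i) (p j) (p l) < 0 ->
  orient (p k) (p l) (p i) * orient (p k) (p l) (p j) < 0 -> False.
Proof.
wlog [s [sT vi sij]] : i j / exists s, [/\ s \in T, i \in vertices s & s i = j].
  move=> wl ij; have [s sT [[vi e]|[vj e]]] := adjP ij.
    by apply: wl => //; exists s.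
  move=> kl o1 o2; apply: (wl j i) => //; first by exists s.
  - by rewrite adj_sym.
  - by move: o1; rewrite (orient_swap (p i) (p j)) (orient_swap (p i) (p j) (p l)) mulrNN.
  - by rewrite mulrC.
wlog kpos : k l / 0 < orient (p i) (p j) (p k).
  move=> wl ij kl o1 o2.
  have [k0|k0|k0] := ltgtP 0 (orient (p i) (p j) (p k)); first exact: (wl k l).
    apply: (wl l k) => //; first by move: o1; rewrite nmulr_rlt0.
    - by rewrite adj_sym.
    - by rewrite mulrC.
    - by move: o2; rewrite (orient_swap (p k) (p l)) (orient_swap (p k) (p l) (p j)) mulrNN.
  by move: o1; rewrite -k0 mul0r ltxx.
move=> ij kl; rewrite pmulr_rlt0// => lneg o2.
(* The values at the ends of each segment give the barycentric coordinates of
   the crossing point [x]. *)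
set a := orient (p i) (p j) (p k) in kpos; set b := orient (p i) (p j) (p l) in lneg.
set c := orient (p k) (p l) (p i) in o2; set d := orient (p k) (p l) (p j) in o2.
have ab : a - b != 0 by rewrite gt_eqF//; lra.
have dc : d - c != 0.
  apply/eqP => e; have e' : d = c by lra.
  by move: o2; rewrite e' -expr2 ltNge sqr_ge0.
have abcd : a - b = d - c by rewrite /a /b /c /d /orient; ring.
pose x := lerp (p k) (p l) (a / (a - b)).
have x01 : 0 < a / (a - b) < 1.
  apply/andP; split; first by rewrite divr_gt0//; lra.
  by rewrite ltr_pdivrMr; lra.
have xE : x = lerp (p i) (p j) (- c / (d - c)).
  have e1 : - b * (p k).1 + a * (p l).1 = d * (p i).1 - c * (p j).1.
    by rewrite /a /b /c /d /orient; ring.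
  have e2 : - b * (p k).2 + a * (p l).2 = d * (p i).2 - c * (p j).2.
    by rewrite /a /b /c /d /orient; ring.
  have dE : d = a - b + c by rewrite abcd; ring.
  rewrite /x /lerp -abcd; congr pair.
    transitivity ((- b * (p k).1 + a * (p l).1) / (a - b)); first by field.
    by rewrite e1 dE; field.
  transitivity ((- b * (p k).2 + a * (p l).2) / (a - b)); first by field.
  by rewrite e2 dE; field.
have y01 : 0 < - c / (d - c) < 1.
  have [c0 d0] : c < 0 /\ 0 < d.
    have [c0|c0|c0] := ltgtP c 0; last by move: o2; rewrite c0 mul0r ltxx.
      by split=> //; move: o2; rewrite nmulr_rlt0.
    by exfalso; move: o2; rewrite pmulr_rlt0//; lra.
  apply/andP; split; first by rewrite divr_gt0//; lra.
  by rewrite ltr_pdivrMr; lra.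
have xij : open_segment (p i) (p (s i)) x.
  by apply/open_segmentP; rewrite sij xE; exists (- c / (d - c)); case/andP: y01.
have [r r0 h] := half_left gp (polyT sT) vi xij.
have [e [e0 e1 er]] : exists e, [/\ 0 < e, e < 1 & box x r (lerp x (p k) e)].
  by apply: near0_ex; apply: lerp_near0; apply/nbhs_boxP; exists r.
apply: (adj_segment tri kl _ sT (x := lerp x (p k) e)).
  have /andP[x0 x1] := x01; set t := a / (a - b) in x0 x1.
  apply/segmentP; exists ((1 - e) * t); split; [by rewrite mulr_ge0//; lra|nra|].
  by rewrite /x -/t /lerp; congr pair => /=; ring.
apply: h => //; rewrite sij orient_lerp.
have -> : orient (p i) (p j) x = 0.
  by rewrite -sij; apply: orient_on_segment; exact: open_segmentW.
by rewrite mulr0 add0r mulr_gt0.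
Qed.

End Cells.
End Graph.

(** * Convex and reflex vertices, and reconstruction of the cells *)

Section Extremal.
Variables (R : realType) (I : finType) (p : I -> plane R).
Hypothesis gp : general_position p.
Implicit Types (s : {perm I}) (T : {set {perm I}}) (i j k u v w : I)
  (x y z q a c : plane R).

Lemma orient_continuous a c : continuous (orient a c).
Proof.
move=> z; apply: cvgB; apply: cvgM; do ?exact: cvg_cst.
  by apply: cvgB; [exact: cvg_snd|exact: cvg_cst].
by apply: cvgB; [exact: cvg_fst|exact: cvg_cst].
Qed.

(** The three vectors from [x] satisfy a linear relation, so an affine
    function vanishing at [x] is determined by its values at two other points. *)
Lemma orient_cramer a c x (u w q : plane R) : orient a c x = 0 ->
  orient a c q * orient u x w =
  orient u x q * orient a c w + orient x w q * orient a c u.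
Proof.
move=> e.
have -> : orient a c q * orient u x w =
  orient u x q * orient a c w + orient x w q * orient a c u +
  orient a c x * (orient u x w - orient u x q - orient x w q).
  by rewrite /orient; ring.
by rewrite e mul0r addr0.
Qed.

Lemma orient_smaller a c x : a != c -> exists q, orient a c q < orient a c x.
Proof.
move=> ac; exists (x.1 + (c.2 - a.2), x.2 - (c.1 - a.1)).
have -> : orient a c (x.1 + (c.2 - a.2), x.2 - (c.1 - a.1)) =
    orient a c x - ((c.1 - a.1) ^+ 2 + (c.2 - a.2) ^+ 2).
  by rewrite /orient /=; ring.
rewrite ltrBlDr ltrDl lt_neqAle addr_ge0 ?sqr_ge0// andbT eq_sym.
rewrite paddr_eq0 ?sqr_ge0// !sqrf_eq0 !subr_eq0.
apply: contra ac => /andP[/eqP h1 /eqP h2].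
by rewrite [a]surjective_pairing [c]surjective_pairing h1 h2.
Qed.

Section Cells.
Variables (T : {set {perm I}}) (K : {perm I} -> set (plane R)).
Hypothesis tri : cell_family p T K.

Let polyT s : s \in T -> polygon p s (K s). Proof. exact: cell_polygon. Qed.

(** An affine function on a cell attains its minimum on the boundary, hence at
    a vertex. *)
Lemma cell_halfplane s a c : s \in T -> a != c ->
  (forall j, j \in vertices s -> 0 <= orient a c (p j)) ->
  forall z, K s z -> 0 <= orient a c z.
Proof.
move=> sT ac h z Kz; have sK := polyT sT.
have cK : compact (K s) by case: sK.
have cf : {within K s, continuous (orient a c)}.
  by apply: continuous_subspaceT => ?; exact: orient_continuous.
have [m] := compact_EVT_min (ex_intro _ z Kz) cK cf.
rewrite inE => Km Km2; have := Km2 z; rewrite inE => /(_ Kz); apply: le_trans.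
have [mi|mi] := pselect ((K s)° m).
  have [q oq] := orient_smaller m ac.
  have [e [e0 e1 Ke]] := near0_ex (lerp_near0 q mi).
  have := Km2 (lerp m q e); rewrite inE orient_lerp => /(_ Ke).
  have : e * (orient a c m - orient a c q) > 0 by rewrite mulr_gt0// subr_gt0.
  lra.
have [j vj /segmentP[t [t0 t1 ->]]] : exists2 j, j \in vertices s &
    segment (p j) (p (s j)) m by apply/(polygon_boundary sK).
rewrite orient_lerp addr_ge0// mulr_ge0 ?h ?vertices_s//; lra.
Qed.

(** The complement of a reflex sector is the cone spanned by the two
    neighbours, on which the functional is nonnegative. So at a reflex vertex
    the sector would contain a direction in which the functional decreases,
    and the cell would leave the half plane. *)
Lemma extreme_convex s a c i : s \in T -> a != c -> i \in vertices s ->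
  orient a c (p i) = 0 ->
  (forall j, j \in vertices s -> 0 <= orient a c (p j)) ->
  i \in convex_vertices p s.
Proof.
move=> sT ac vi fi h; have sK := polyT sT; rewrite inE vi /=.
have := turn_neq0 gp sK vi; rewrite neq_lt => /orP[t0|//].
have [q oq] := orient_smaller (p i) ac; rewrite fi in oq.
have sec : sector p 1 s i q.
  rewrite /sector !mul1r (lt_gtF t0).
  have := orient_cramer (p ((s^-1)%g i)) (p (s i)) q fi.
  have fw := h _ (etrans (vertices_s s i) vi).
  have fu := h _ (etrans (vertices_sV s i) vi).
  case: ltP => //= A; case: ltP => // B e; exfalso; move: e.
  rewrite /turn in t0.
  have : 0 < orient a c q * orient (p ((s^-1)%g i)) (p i) (p (s i)).
    by rewrite nmulr_rgt0.
  have := mulr_le0_ge0 B fw; have := mulr_le0_ge0 A fu.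
  lra.
have [r r0 hr] := sector_inside gp sK vi.
have [e [e0 e1 er]] : exists e, [/\ 0 < e, e < 1 & box (p i) r (lerp (p i) q e)].
  by apply: near0_ex; apply: lerp_near0; apply/nbhs_boxP; exists r.
have : K s (lerp (p i) q e).
  by apply: interior_subset; apply: hr => //; rewrite sector_lerp.
move=> /(cell_halfplane sT ac h); rewrite orient_lerp fi mulr0 add0r.
by rewrite pmulr_rge0// leNgt oq.
Qed.

(** The open half plane free of edges contains directions into the hull, since
    [p i] is interior. The sector that covers one of them is bounded by two
    edges outside this half plane, so it has an angle greater than pi. *)
Lemma reflex_exists i c : i \in interior_points p -> c != p i ->
  (forall j, adj T i j -> 0 <= orient (p i) c (p j)) ->
  exists2 s, s \in T & i \in reflex_vertices p s.
Proof.
rewrite inE => /asboolP int ci h.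
have [q0 oq0] : exists q, orient (p i) c q < orient (p i) c (p i).
  by apply: orient_smaller; rewrite eq_sym.
rewrite orient_aba in oq0.
have ngen : \forall t \near (0 : R)^'+, forall j, j != i ->
    orient (p i) (p j) (lerp q0 c t) != 0.
  apply: (@filter_forall _ _ (fun j t => j != i ->
    orient (p i) (p j) (lerp q0 c t) != 0)) => j.
  have [->|ji] := eqVneq j i; first by apply: filterE.
  have : orient (p i) (p j) q0 != 0 \/ orient (p i) (p j) c != 0.
    have [z1|] := eqVneq (orient (p i) (p j) q0) 0; last by left.
    right; apply/eqP => z2.
    have e1 : ((p j).1 - (p i).1) * orient (p i) c q0 = 0.
      have -> : ((p j).1 - (p i).1) * orient (p i) c q0 =
        (c.1 - (p i).1) * orient (p i) (p j) q0 -
        (q0.1 - (p i).1) * orient (p i) (p j) c by rewrite /orient; ring.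
      by rewrite z1 z2; ring.
    have e2 : ((p j).2 - (p i).2) * orient (p i) c q0 = 0.
      have -> : ((p j).2 - (p i).2) * orient (p i) c q0 =
        (c.2 - (p i).2) * orient (p i) (p j) q0 -
        (q0.2 - (p i).2) * orient (p i) (p j) c by rewrite /orient; ring.
      by rewrite z1 z2; ring.
    move/eqP: e1; rewrite mulf_eq0 (lt_eqF oq0) orbF subr_eq0 => /eqP e1.
    move/eqP: e2; rewrite mulf_eq0 (lt_eqF oq0) orbF subr_eq0 => /eqP e2.
    move: ji => /eqP; apply; apply: (p_inj gp).
    by rewrite [p j]surjective_pairing e1 e2 -surjective_pairing.
  by move=> /near0_mix_neq0; apply: filterS => t ? _; rewrite orient_lerp.
have [t [t0 t1 gen]] := near0_ex ngen.
have [|s [sT vi]] := cover_direction gp tri gen; first exact: lerp_near0.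
have oq : orient (p i) c (lerp q0 c t) < 0.
  by rewrite orient_lerp orient_abb mulr0 addr0 pmulr_rlt0// subr_gt0.
move=> sec; exists s => //; rewrite inE vi /=.
have := turn_neq0 gp (polyT sT) vi; rewrite neq_lt => /orP[//|tp].
move: sec; rewrite /sector !mul1r tp => /andP[A B].
have fw := h _ (adj_next sT vi); have fu := h _ (adj_prev sT vi).
have := orient_cramer (p ((s^-1)%g i)) (p (s i)) (lerp q0 c t) (orient_aba (p i) c).
rewrite /turn in tp.
have : orient (p i) c (lerp q0 c t) * orient (p ((s^-1)%g i)) (p i) (p (s i)) < 0.
  by rewrite nmulr_rlt0.
have := mulr_ge0 (ltW B) fw; have := mulr_ge0 (ltW A) fu.
lra.
Qed.

End Cells.

(** The angular intervals of two cells that start at a common edge are nested,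
    so if they ended at different edges, the far edge of one would enter the
    other cell. Hence two cells that share a directed edge coincide. *)
Lemma adj_determines_sub T T' K K' : cell_family p T K -> cell_family p T' K' ->
  (forall i j, adj T i j = adj T' i j) -> T \subset T'.
Proof.
move=> tri tri' adjE; apply/fintype.subsetP => s sT.
have sK := cell_polygon tri sT.
have [[[[ne cyc] simp] cK _ _ _]] := sK.
have [u vu] : exists u, u \in vertices s by apply/set0Pn.
pose v := s u.
have vv : v \in vertices s by rewrite vertices_s.
have [e oe] : exists e, 0 < orient (p u) (p v) (p e).
  apply: contrapT => no.
  have h j : 0 <= orient (p v) (p u) (p j).
    by rewrite orient_swap oppr_ge0 leNgt; apply/negP => ?; apply: no; exists j.
  pose x := lerp (p u) (p v) (1 / 2).
  have xi : open_segment (p u) (p v) x.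
    by apply/open_segmentP; exists (1 / 2); split => //; lra.
  have [r r0 hr] := half_left gp sK vu xi.
  pose q := normal_end p s 1 u x.
  have [d [d0 d1 dr]] : exists d, [/\ 0 < d, d < 1 & box x r (lerp x q d)].
    by apply: near0_ex; apply: lerp_near0; apply/nbhs_boxP; exists r.
  have := @normal_pt_orient _ _ _ gp s 1 u x d vu
    (orient_on_segment (open_segmentW xi)) d0.
  rewrite !mul1r => /(_ ltr01) od.
  have Kd := interior_subset (hr _ dr od).
  have := hull_halfplane h (cell_sub_hull tri sT Kd).
  by rewrite orient_swap oppr_ge0 leNgt od.
have uv : adj T' u v by rewrite -adjE; exact: adj_next.
have [s' s'T [vu' s'u]] := directed_edge gp tri' uv oe.
have sK' := cell_polygon tri' s'T.
(* Both boundary walks turn to the same next vertex. *)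
have step (x : I) : x \in vertices s -> x \in vertices s' -> s' x = s x ->
    s' (s x) = s (s x).
  move=> vx vx' xE.
  have v1 : s x \in vertices s by rewrite vertices_s.
  have v1' : s x \in vertices s' by rewrite -xE vertices_s.
  apply: contrapT => /eqP ww.
  have n1 : adj T (s x) (s' (s x)) by rewrite adjE; exact: adj_next.
  have n2 : adj T' (s x) (s (s x)) by rewrite -adjE; exact: adj_next.
  have := adj_notin_sector gp tri sT v1 n1.
  have := adj_notin_sector gp tri' s'T v1' n2.
  have t0 := turn_neq0 gp sK v1; have t0' := turn_neq0 gp sK' v1'.
  have pv' : (s'^-1)%g (s x) = x by rewrite -xE permK.
  move: t0 t0'; rewrite /sector !mul1r /turn !permK pv'.
  have C : orient (p (s x)) (p (s (s x))) (p (s' (s x))) != 0.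
    apply: (orient_neq0 gp) => //; first by move: v1; rewrite inE eq_sym.
    - by rewrite eq_sym.
    - by move: v1'; rewrite inE eq_sym.
  have -> : orient (p (s x)) (p (s' (s x))) (p (s (s x))) =
    - orient (p (s x)) (p (s (s x))) (p (s' (s x))) by rewrite /orient; ring.
  move: C; rewrite oppr_gt0 !neq_lt.
  move=> /orP[C|C] /orP[A|A] /orP[B|B];
    by rewrite ?C ?A ?B ?(lt_gtF C) ?(lt_gtF A) ?(lt_gtF B).
have it n : [/\ iter n s u \in vertices s, iter n s u \in vertices s',
    iter n s' u = iter n s u & s' (iter n s u) = s (iter n s u)].
  elim: n => [|n [h1 h2 h3 h4]]; first by split=> //; rewrite s'u.
  rewrite !iterS; split.
  - by rewrite vertices_s.
  - by rewrite -h4 vertices_s.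
  - by rewrite h3 h4.
  - exact: step.
have on (x : I) : x \in vertices s -> s' x = s x.
  move=> vx; have /porbitP[n ->] := cyc u x vu vx; rewrite permX.
  by have [_ _ _] := it n.
suff -> : s = s' by [].
apply/permP => x; have [vx|] := boolP (x \in vertices s); first by rewrite on.
have [vx'|] := boolP (x \in vertices s').
  have [[_ cyc'] _] : simple_chain p s' by case: sK'.
  have /porbitP[n ->] := cyc' u x vu' vx'.
  by rewrite permX; have [h1 _ -> _] := it n; rewrite h1.
by rewrite !inE !negbK => /eqP-> /eqP->.
Qed.

End Extremal.

(** * A boundary walk cannot leave a pocket *)

(** [s] is a closed boundary walk, [b] a vertex of it, and all the other vertices
    have distinct positions [P] on a line, above which the edges avoiding [b] can
    be drawn as non-crossing arcs.  The walk enters [i] by an arc from [k] and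
    leaves it towards a position between those of [k] and [i].  It is then
    confined to the pocket below this arc: it moves steadily towards [k], as by
    the hypotheses [reflex_step] and [reflex_last] it neither turns back under
    the arc just used nor leaves for [b].  So it closes up at [k] without
    visiting [b], which contradicts [cyc]. *)
Section Pocket.
Variables (I : finType) (s : {perm I}) (b i : I) (P : I -> int).
Hypothesis P_inj : forall u v, u != b -> v != b -> s u != u -> s v != v ->
  P u = P v -> u = v.

Let edge u v := [/\ u != b, v != b & s u = v \/ s v = u].

Hypothesis cyc : forall Z : {set I}, i \in Z -> (forall z, z \in Z -> s z \in Z) ->
  b \in Z.
Hypothesis nc : forall u v u' v', edge u v -> edge u' v' ->
  (P u < P u')%R -> (P u' < P v)%R -> (P v < P v')%R -> False.

Let k := (s^-1)%g i.

Hypothesis ib : i != b.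
Hypothesis kb : k != b.
Hypothesis k'b : s i != b.
Hypothesis kk' : P k < P (s i).
Hypothesis k'i : P (s i) < P i.

Hypothesis reflex_step : forall v, v != b -> s v != b -> s (s v) != b ->
  P k < P (s v) -> P (s v) < P v -> P v <= P i ->
  P (s (s v)) < P (s v) \/ P v < P (s (s v)).
Hypothesis reflex_last : forall v, v != b -> s v != b -> s (s v) = b ->
  P k < P (s v) -> P (s v) < P v -> P v <= P i -> False.

Lemma no_pocket : False.
Proof.
have ski : s k = i by rewrite /k permKV.
(* The walk at [v] moves towards [k]; the last clause keeps it confined, as
   every arc over [v] reaches at least as far as [i]. *)
pose D v := [/\ v != b, s v != b, P k <= P (s v) < P v, P k < P v <= P i &
  (v = i \/ P v < P ((s^-1)%g v)) /\
  (forall a c, edge a c -> P a < P v -> P v < P c -> P c < P i -> False)].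
have edge_sym u v : edge u v -> edge v u by move=> [? ? [?|?]]; split=> //; tauto.
have Di : D i.
  split=> //; first by rewrite (ltW kk').
    by rewrite (lt_trans kk' k'i) lexx.
  by split; [left|move=> a c _ _ h1 h2; have := lt_trans h1 h2; rewrite ltxx].
have eki : edge k i by split=> //; left.
have step v : D v -> s v <> k -> D (s v).
  move=> [vb wb /andP[kw wv] /andP[kv vi] [prev Q]] wk.
  set w := s v in wb kw wv wk *.
  have wi : P w < P i by exact: lt_le_trans wv vi.
  have nfix u u' : s u = u' -> P u != P u' -> s u != u.
    by move=> <-; apply: contraNneq => ->.
  have fw : s v != v by apply: (nfix v w) => //; rewrite gt_eqF.
  have fk : s k != k.
    by apply: (nfix k i) => //; rewrite lt_eqF// (lt_trans kk' k'i).
  have fix_s x : s x != x -> s (s x) != s x by rewrite (inj_eq perm_inj).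
  have fsw : s w != w by exact: fix_s.
  have kw' : P k < P w.
    by rewrite lt_neqAle kw andbT; apply/eqP => e; apply: wk; apply/esym/P_inj.
  have rb : s w != b.
    by apply/eqP => e; apply: (reflex_last vb wb e kw' wv vi).
  set r := s w in rb *.
  have evw : edge w v by split=> //; right.
  have ewr : edge w r by split=> //; left.
  have fr : s r != r by exact: fix_s.
  have fi : s i != i by rewrite -ski; exact: fix_s.
  have Q2 : ~ P v < P r.
    move=> vr.
    have ri : P r < P i.
      have [//|ir|ri] := ltgtP (P r) (P i).
        exfalso; exact: (nc eki ewr kw' wi ir).
      have ri' : r = i by exact: P_inj.
      by exfalso; apply: wk; rewrite -[w](permK s) -/r ri'.
    have vi' : P v < P i by exact: lt_trans vr ri.
    by apply: (Q w r).
  have rw : P r < P w by case: (reflex_step vb wb rb kw' wv vi).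
  split=> //.
  - rewrite rw andbT leNgt; apply/negP => rk.
    exact: (nc (edge_sym _ _ ewr) eki rk kw' wi).
  - by rewrite kw' ltW.
  split; first by right; rewrite /w permK.
  move=> a c ac aw wc ci.
  have fa : s a != a /\ s c != c.
    have acn : P a != P c by rewrite lt_eqF// (lt_trans aw wc).
    case: ac => _ _ [e|e].
      have h : s a != a by apply: nfix e acn.
      by split=> //; rewrite -e; exact: fix_s.
    have h : s c != c by apply: nfix e _; rewrite eq_sym.
    by split=> //; rewrite -e; exact: fix_s.
  case: (fa) => fa1 fc.
  have [cv|vc|cv] := ltgtP (P c) (P v).
  - exact: (nc ac evw aw wc cv).
  - exact: (Q a c ac (lt_trans aw wv) vc ci).
  have [ab cb h] := ac.
  have cE : c = v by apply: P_inj.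
  rewrite cE in h; case: h => [h|h].
    case: prev => [pv|pv]; first by move: ci; rewrite cE pv ltxx.
    move: pv; rewrite -h permK => /lt_trans/(_ aw)/lt_trans/(_ wv).
    by rewrite h ltxx.
  by move: aw; rewrite -h ltxx.
pose Z := [set z | (z == k) || `[< D z >]]%SET.
suff : b \in Z.
  by rewrite !inE eq_sym (negbTE kb) => /asboolP[]; rewrite eqxx.
apply: cyc => [|z]; first by rewrite !inE; apply/orP; right; apply/asboolP.
rewrite !inE => /orP[/eqP->|/asboolP Dz].
  by rewrite ski; apply/orP; right; apply/asboolP.
have [//|wk] := eqVneq (s z) k.
by apply/asboolP; apply: step => //; apply/eqP.
Qed.

End Pocket.

(** * Non-crossing graphs on one chain *)

Local Open Scope nat_scope.

Definition left_degree (g : rel nat) (j : nat) : nat := \sum_(i < j) g i j.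

(** The graphs that a pseudo-triangulation induces on a chain with vertices 0,
    ..., N: non-crossing, with edges of the inner vertices in [B] going to one
    side only and those of the others to both sides, and such that some left
    neighbour of [z], if [z] is inner and has one, is joined to a vertex on
    the other side of [z]. *)
Definition chain_graph (N : nat) (B : pred nat) (g : rel nat) : Prop :=
  [/\ forall i j, g i j -> i < j <= N,
      forall a b c d, a < b -> b < c -> c < d -> g a c -> g b d -> False,
      forall z, 0 < z < N -> B z ->
        ((exists u, g u z) -> (exists w, g z w) -> False) /\
        ((exists u, g u z) \/ (exists w, g z w)),
      forall z, 0 < z < N -> ~~ B z -> (exists u, g u z) /\ (exists w, g z w) &
      forall z u, 0 < z < N -> g u z ->
        exists x w, [/\ x < z, z < w, g x z & g x w]].

Section ChainGraph.
Variables (N : nat) (B : pred nat).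
Implicit Types (g : rel nat).

Definition visible g j x := forall u w, u < x -> x < w -> w < j -> g u w -> False.
Definition eligible g x := ~~ B x \/ forall u, ~ g u x.

(** Let [z] be the farthest right neighbour of [x']. It cannot lie beyond [j]
    because of the edge from [x] to [j]; if it lay before [j], consider the
    edges from some [x0] to [z] and beyond it. The first would hide [x'] from
    [j], or the second would cross the edge from [x'] to [z], or [x0] would be
    [x'] and have a farther neighbour. So [z = j]. *)
Lemma contiguous g j x x' : chain_graph N B g ->
  x < x' < j -> g x j -> visible g j x' -> eligible g x' -> g x' j.
Proof.
move=> [lt nc hB hnB tri] /andP[xx' x'j] xj vis el.
have /andP[_ jN] := lt _ _ xj.
have inn : 0 < x' < N by lia.
have [z0 hz0] : exists w, g x' w.
  have [Bx|nB] := boolP (B x'); last by case: (hnB _ inn nB).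
  case: (hB _ inn Bx) => _ [[u ux]|//].
  by case: el => [|/(_ u)]; rewrite ?Bx.
have bnd w : g x' w -> w <= N by move=> /lt/andP[].
case: (@ex_maxnP (fun w => g x' w) N (ex_intro _ z0 hz0) bnd) => z hz zmax.
have [zj|jz|zj] := ltngtP z j.
- have /andP[x'z _] := lt _ _ hz.
  have innz : 0 < z < N by lia.
  have [x0 [w [x0z zw h1 h2]]] := tri _ _ innz hz.
  exfalso; have [h|h|h] := ltngtP x0 x'.
  + exact: (vis _ _ h x'z zj h1).
  + exact: (nc _ _ _ _ h x0z zw hz h2).
  + by have := zmax w; rewrite -h h2 leqNgt zw => /(_ isT).
- by case: (nc _ _ _ _ xx' x'j jz xj hz).
- by rewrite -zj.
Qed.

Section Two.
Variables (g g' : rel nat) (j : nat).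
Hypotheses (cg : chain_graph N B g) (cg' : chain_graph N B g').
Hypothesis agree : forall k i, k < j -> g i k = g' i k.

Lemma neighbour_ready x : 0 < x -> g' x j -> visible g j x /\ eligible g x.
Proof.
move=> x0 xj; have [lt nc hB _ _] := cg'; have /andP[xj' jN] := lt _ _ xj.
split=> [u w ux xw wj|].
  by rewrite (agree _ wj) => uw; exact: (nc _ _ _ _ ux xw wj uw xj).
have [Bx|nB] := boolP (B x); last by left.
right=> u; rewrite agree// => ux.
by apply: (hB x _ Bx).1; [lia|exists u|exists j].
Qed.

End Two.

(** Both sets of left neighbours of [j] are the last ones among the
    candidates, which are the same for both graphs, so they are nested. Vertex
    0 always comes first, so that its eligibility does not matter. *)
Lemma neighbours_sub g g' j x : chain_graph N B g -> chain_graph N B g' ->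
  (forall k i, k < j -> g i k = g' i k) -> g x j -> ~~ g' x j ->
  forall n, g' n j -> g n j.
Proof.
move=> cg cg' agree xj nxj n nj.
have agree' k i : k < j -> g' i k = g i k by move=> /agree->.
have /andP[xlj _] : x < j <= N by case: cg => lt _ _ _ _; exact: lt.
have /andP[nlj _] : n < j <= N by case: cg' => lt _ _ _ _; exact: lt.
have [xn|nx|e] := ltngtP x n; last by move: nxj; rewrite e nj.
  have n0 : 0 < n by exact: leq_trans xn.
  have [v e] := neighbour_ready cg' agree n0 nj.
  by apply: (contiguous cg _ xj v e); rewrite xn.
have x0 : 0 < x by exact: leq_trans nx.
have [v e] := neighbour_ready cg agree' x0 xj.
by move: nxj; rewrite (contiguous cg' _ nj v e) // nx.
Qed.

Lemma left_degree_lt g g' j x : x < j -> g x j -> ~~ g' x j ->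
  (forall n, g' n j -> g n j) -> left_degree g' j < left_degree g j.
Proof.
move=> xj gx g'x sub; rewrite /left_degree.
rewrite (bigD1 (Ordinal xj))//= [X in _ < X](bigD1 (Ordinal xj))//= gx (negbTE g'x).
rewrite add0n add1n ltnS; apply: leq_sum => i _.
by have [/sub->|] := boolP (g' i j).
Qed.

(** By induction on the right end: once the edges ending before [j] agree, the
    two sets of left neighbours of [j] are nested, and having the same size
    they are equal. *)
Lemma left_degree_determines g g' : chain_graph N B g -> chain_graph N B g' ->
  (forall j, j <= N -> left_degree g j = left_degree g' j) ->
  forall i j, g i j = g' i j.
Proof.
move=> cg cg' dE i j; elim/ltn_ind: j i => j IH i.
have lt0 : forall h, chain_graph N B h -> forall a b, h a b -> a < b <= N.
  by move=> h [].
have [gij|ngij] := boolP (g i j); have [g'ij|ng'ij] := boolP (g' i j) => //; exfalso.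
  have /andP[ij jN] := lt0 _ cg _ _ gij.
  have := left_degree_lt ij gij ng'ij
    (neighbours_sub cg cg' (fun k i kj => IH k kj i) gij ng'ij).
  by rewrite dE// ltnn.
have /andP[ij jN] := lt0 _ cg' _ _ g'ij.
have := left_degree_lt ij g'ij ngij
  (neighbours_sub cg' cg (fun k i kj => esym (IH k kj i)) g'ij ngij).
by rewrite dE// ltnn.
Qed.

Definition forced_edge (j : nat) : nat := (0 < j < N) && ~~ B j.

Lemma sum_le1 n (P : pred 'I_n) :
  (forall i j, P i -> P j -> i = j) -> \sum_(i < n) (P i : nat) <= 1.
Proof.
move=> u; have [/existsP[i Pi]|/existsPn no] := boolP [exists i, P i]; last first.
  by rewrite big1// => i _; rewrite (negbTE (no i)).
rewrite (bigD1 i)//= big1 ?addn0 ?leq_b1// => k ki.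
by have [/(u _ _ Pi)e|//] := boolP (P k); rewrite e eqxx in ki.
Qed.

Lemma forced_edge_le g j : chain_graph N B g -> j <= N ->
  forced_edge j <= left_degree g j.
Proof.
move=> [lt _ _ hnB _] jN; rewrite /forced_edge.
case: (boolP (_ && ~~ _)) => //= /andP[inn nB]; have [[u uj] _] := hnB _ inn nB.
have /andP[uj' _] := lt _ _ uj.
by rewrite /left_degree (bigD1 (Ordinal uj'))//= uj.
Qed.

(** Charge an edge to its right end if it is the longest one there, and to its
    left end otherwise: non-crossing edges give every vertex at most one
    charge of each kind, and a one-sided vertex only one in total. *)
Lemma left_degree_sum g y : chain_graph N B g -> y <= N ->
  \sum_(j < y.+1) left_degree g j <= \sum_(j < y) (1 + forced_edge j.+1).
Proof.
move=> [lt nc hB hnB _] yN.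
pose far i j := g i j && [exists k : 'I_i, g k j].
pose near_ i j := g i j && ~~ [exists k : 'I_i, g k j].
have -> : \sum_(j < y.+1) left_degree g j = \sum_(j < y.+1) \sum_(i < y.+1) (g i j : nat).
  apply: eq_bigr => j _; rewrite /left_degree.
  rewrite (big_ord_widen y.+1 (fun i => g i j : nat)) ?(ltnW (ltn_ord j))// big_mkcond.
  apply: eq_bigr => i _; case: ltnP => // ji.
  by have [/lt/andP[]|//] := boolP (g i j); rewrite ltnNge ji.
have -> : \sum_(j < y.+1) \sum_(i < y.+1) (g i j : nat) =
    \sum_(j < y.+1) (\sum_(i < y.+1) (near_ i j : nat) + \sum_(i < y.+1) (far j i : nat)).
  rewrite big_split /= [X in _ = _ + X]exchange_big -big_split /=.
  apply: eq_bigr => j _; rewrite -big_split /=; apply: eq_bigr => i _.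
  by rewrite /near_ /far; case: (g i j) => //=; case: [exists _, _].
(* Vertex 0 is charged nothing, so the sum starts at vertex 1. *)
have near0 : \sum_(i < y.+1) (near_ i 0 : nat) = 0.
  rewrite big1// => i _; rewrite /near_.
  by have [/lt|//] := boolP (g i 0); rewrite ltn0.
have far0 : \sum_(i < y.+1) (far 0 i : nat) = 0.
  rewrite big1// => i _; rewrite /far.
  by case: existsP => [[[]]//|]; rewrite andbF.
rewrite big_ord_recl /= near0 far0.
rewrite !add0n; apply: leq_sum => j _; rewrite /bump /= add1n; set k := j.+1.
have kN : k <= N by exact: leq_trans (ltn_ord j) yN.
have near1 : \sum_(i < y.+1) (near_ i k : nat) <= 1.
  apply: sum_le1 => i i' /andP[h1 /existsPn n1] /andP[h2 /existsPn n2].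
  apply: val_inj; have [h|h|//] := ltngtP (val i) (val i').
    by have := n2 (Ordinal h); rewrite h1.
  by have := n1 (Ordinal h); rewrite h2.
have far1 : \sum_(i < y.+1) (far k i : nat) <= 1.
  apply: sum_le1 => i i' /andP[h1 /existsP[a ha]] /andP[h2 /existsP[b hb]].
  have /andP[k1 _] := lt _ _ h1; have /andP[k2 _] := lt _ _ h2.
  apply: val_inj; have [h|h|//] := ltngtP (val i) (val i').
    by case: (nc _ _ _ _ (ltn_ord a) k1 h ha h2).
  by case: (nc _ _ _ _ (ltn_ord b) k2 h hb h1).
rewrite /forced_edge; case: (boolP (_ && ~~ _)) => [_|]; first exact: leq_add.
rewrite negb_and negbK addn0 => kB.
have [[u uk]|nou] : (exists u, g u k) \/ (forall u, u < y.+1 -> ~~ g u k).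
  have [/existsP[u uk]|/existsPn no] := boolP [exists u : 'I_y.+1, g u k].
    by left; exists u.
  by right=> u uy; exact: (no (Ordinal uy)).
  rewrite [X in _ + X]big1 ?addn0// => i _; rewrite /far.
  have [ki|//] := boolP (g k i); have /andP[ki' iN] := lt _ _ ki.
  have inn : 0 < k < N by rewrite (leq_trans ki').
  rewrite inn /= in kB.
  by case: (hB _ inn kB).1; [exists u|exists i].
by rewrite big1 ?add0n// => i _; rewrite /near_ (negbTE (nou _ _)).
Qed.

End ChainGraph.

(** * Non-crossing paths between two chains *)

(** The edges [X i j] from the vertex [i] of one chain to the vertex [j] of
    the other form a monotone lattice path from (0, N2) to (N1, 0): with each
    edge other than the last one there is another edge further along that
    shares one end with it, and likewise backwards. *)
Definition cross_graph (N1 N2 : nat) (X : rel nat) : Prop :=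
  [/\ forall i j, X i j -> (i <= N1) && (j <= N2),
      forall i j i' j', X i j -> X i' j' -> i < i' -> j < j' -> False,
      forall i j, X i j -> (i < N1) || (0 < j) ->
        (exists i', i < i' /\ X i' j) \/ (exists j', j' < j /\ X i j') &
      forall i j, X i j -> (0 < i) || (j < N2) ->
        (exists i', i' < i /\ X i' j) \/ (exists j', j < j' /\ X i j')].

Definition has_cross (X : rel nat) i := exists j, X i j.
Definition many_cross (X : rel nat) i := exists j j', [/\ j != j', X i j & X i j'].

Section CrossGraph.
Variables (N1 N2 : nat).
Implicit Types (X : rel nat).

Lemma cross_start X i j : cross_graph N1 N2 X -> X i j -> X 0 N2.
Proof.
move=> [bd _ _ W]; have [n] := ubnP (i + (N2 - j)); elim: n i j => // n IH i j lt ij.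
have /andP[iN jN] := bd _ _ ij.
have [h|] := boolP ((0 < i) || (j < N2)).
  have [[i' [lt' h']]|[j' [lt' h']]] := W _ _ ij h; apply: (IH _ _ _ h').
    by lia.
  by have /andP[_ ?] := bd _ _ h'; lia.
rewrite negb_or -!leqNgt leqn0 => /andP[/eqP i0 jN2].
have jE : j = N2 by lia.
by rewrite -i0 -jE.
Qed.

Let flip X : rel nat := fun i j => X j i.

Section Two.
Variables (X X' : rel nat).
Hypotheses (cg : cross_graph N1 N2 X) (cg' : cross_graph N1 N2 X').
Hypothesis S1 : forall i, has_cross X i -> has_cross X' i.
Hypothesis S2 : forall j, has_cross (flip X) j -> has_cross (flip X') j.
Hypothesis M1 : forall i, many_cross X i <-> many_cross X' i.
Hypothesis M2 : forall j, many_cross (flip X) j <-> many_cross (flip X') j.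

Lemma many_other (Y : rel nat) i j : many_cross Y i -> exists2 k, k != j & Y i k.
Proof.
move=> [a [b [ab ha hb]]]; have [aj|aj] := eqVneq a j; last by exists a.
by exists b; rewrite // -aj eq_sym.
Qed.

(** The edge of [X] before the present one is also in [X']. If [X'] moved the
    other end of it next, then both ends would need further edges in [X'],
    since the two graphs agree on which vertices have several edges, and these
    would cross. So [X'] moves the same end, and it goes equally far because
    the two graphs use the same vertices. *)
Lemma cross_sub i j :
  (forall a b, a + (N2 - b) < i + (N2 - j) -> b <= N2 -> X a b = X' a b) ->
  X i j -> X' i j.
Proof.
move=> IH ij.
have [bd nc E W] := cg; have [bd' nc' E' W'] := cg'.
have /andP[iN jN] := bd _ _ ij.
have [h|] := boolP ((0 < i) || (j < N2)); last first.
  rewrite negb_or -!leqNgt leqn0 => /andP[/eqP i0 jN2].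
  have jE : j = N2 by lia.
  have [j' ij'] := S1 (ex_intro _ j ij).
  by rewrite i0 jE; exact: cross_start cg' ij'.
(* The previous edge of [X], taken as close as possible to the present one. *)
have [[i0 [lt0 h0]]|[j0 [lt0 h0]]] := W _ _ ij h.
  have bnd a : (a < i) && X a j -> a <= i by lia.
  have ex0 : exists a, (a < i) && X a j by exists i0; rewrite lt0.
  case: (ex_maxnP ex0 bnd) => i1 /andP[i1i i1j] i1max {i0 lt0 h0}.
  have i1j' : X' i1 j by rewrite -IH//; lia.
  have [j2 ij2] := S1 (ex_intro _ j ij).
  have j2j : j2 <= j.
    by rewrite leqNgt; apply/negP => h2; exact: (nc' _ _ _ _ i1j' ij2 i1i h2).
  have [|[i2 [i12 i2j]]|[j' [j'j i1j'']]] := E' _ _ i1j'.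
  + by rewrite (leq_trans i1i).
  + have [i2i|ii2|<-//] := ltngtP i2 i.
      have i2jX : X i2 j by rewrite IH//; lia.
      by have := i1max i2; rewrite i2i i2jX leqNgt i12 => /(_ isT).
    have [j2j'|jj2|<-//] := ltngtP j2 j.
      by case: (nc' _ _ _ _ ij2 i2j ii2 j2j').
    by move: j2j; rewrite leqNgt jj2.
  exfalso; have m1 : many_cross X' i1.
    by exists j, j'; split=> //; rewrite gtn_eqF.
  have [j3 j3j i1j3] := many_other j ((M1 i1).2 m1).
  have jj3 : j < j3.
    rewrite ltn_neqAle eq_sym j3j leqNgt; apply/negP => h3.
    exact: (nc _ _ _ _ i1j3 ij i1i h3).
  have /andP[_ j3N] := bd _ _ i1j3.
  have i1j3' : X' i1 j3 by rewrite -IH//; lia.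
  have m2 : many_cross (flip X) j.
    by exists i1, i; split=> //; rewrite ltn_eqF.
  have [i3 i3i i3j] := many_other i1 ((M2 j).1 m2).
  have [lt3|lt3|e3] := ltngtP i3 i1.
  + exact: (nc' _ _ _ _ i3j i1j3' lt3 jj3).
  + exact: (nc' _ _ _ _ i1j'' i3j lt3 j'j).
  + by rewrite e3 eqxx in i3i.
have ex0 : exists b, (j < b) && X i b by exists j0; rewrite lt0.
case: (ex_minnP ex0) => j1 /andP[jj1 ij1] j1min {j0 lt0 h0}.
have /andP[_ j1N] := bd _ _ ij1.
have ij1' : X' i j1 by rewrite -IH//; lia.
have [i2 i2j] := S2 (ex_intro (fun a => flip X j a) i ij).
have ii2 : i <= i2.
  by rewrite leqNgt; apply/negP => h2; exact: (nc' _ _ _ _ i2j ij1' h2 jj1).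
have [|[i' [ii' i'j1]]|[j2 [j21 ij2]]] := E' _ _ ij1'.
+ by rewrite (leq_ltn_trans _ jj1) ?orbT.
+ exfalso; have m2 : many_cross (flip X') j1.
    by exists i, i'; split=> //; rewrite ltn_eqF.
  have [i3 i3i i3j1] := many_other i ((M2 j1).2 m2).
  have lt3 : i3 < i.
    rewrite ltn_neqAle i3i leqNgt; apply/negP => h3.
    exact: (nc _ _ _ _ ij i3j1 h3 jj1).
  have i3j1' : X' i3 j1 by rewrite -IH//; lia.
  have m1 : many_cross X i by exists j, j1; split=> //; rewrite ltn_eqF.
  have [j3 j3j ij3] := many_other j1 ((M1 i).1 m1).
  have [lt4|lt4|e4] := ltngtP j3 j1.
  + exact: (nc' _ _ _ _ ij3 i'j1 ii' lt4).
  + exact: (nc' _ _ _ _ i3j1' ij3 lt3 lt4).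
  + by rewrite e4 eqxx in j3j.
have [j2j|jj2|<-//] := ltngtP j2 j.
  have [lt|gt|e] := ltngtP i i2; last by rewrite e; exact: i2j.
    by case: (nc' _ _ _ _ ij2 i2j lt j2j).
  by move: ii2; rewrite leqNgt gt.
have ij2X : X i j2.
  by have /andP[_ ?] := bd' _ _ ij2; rewrite IH//; lia.
by have := j1min j2; rewrite jj2 ij2X leqNgt j21 => /(_ isT).
Qed.

End Two.

Lemma cross_determines X X' : cross_graph N1 N2 X -> cross_graph N1 N2 X' ->
  (forall i, has_cross X i <-> has_cross X' i) ->
  (forall j, has_cross (flip X) j <-> has_cross (flip X') j) ->
  (forall i, many_cross X i <-> many_cross X' i) ->
  (forall j, many_cross (flip X) j <-> many_cross (flip X') j) ->
  forall i j, X i j = X' i j.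
Proof.
move=> cg cg' S1 S2 M1 M2 i j.
have [jN|Nj] := leqP j N2; last first.
  have out Y : cross_graph N1 N2 Y -> Y i j = false.
    by move=> [bd _ _ _]; apply/negP => /bd/andP[_]; rewrite leqNgt Nj.
  by rewrite !out.
have [n] := ubnP (i + (N2 - j)); elim: n i j jN => // n IH i j jN lt.
have IH1 a b : a + (N2 - b) < i + (N2 - j) -> b <= N2 -> X a b = X' a b.
  by move=> h1 h2; apply: IH => //; lia.
apply/idP/idP.
  apply: (cross_sub cg cg' _ _ M1 M2 IH1) => [a|b]; [exact: (S1 a).1|exact: (S2 b).1].
apply: (cross_sub cg' cg _ _ (fun a => iff_sym (M1 a)) (fun b => iff_sym (M2 b))).
- by move=> a; exact: (S1 a).2.
- by move=> b; exact: (S2 b).2.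
by move=> a b h1 h2; rewrite IH1.
Qed.

End CrossGraph.

(** * Counting ballot sequences; central binomial coefficients *)

(** The sequences of length [n] whose sum over the first [i] terms is at most
    [h + i] for all [i]; the budget [h] makes the recursion possible. *)
Fixpoint ballots (n h : nat) : seq (seq nat) :=
  if n is n'.+1 then
    flatten [seq [seq p :: q | q <- ballots n' (h.+1 - p)] | p <- iota 0 h.+2]
  else [:: [::]].

Lemma ballotsP n h q : size q = n ->
  (forall i, i <= n -> sumn (take i q) <= h + i) -> q \in ballots n h.
Proof.
elim: n h q => [|n IH] h [|p q] // [sq] H.
have ph : p <= h.+1 by have := H 1 isT; rewrite /= take0 /= addn0 addn1.
apply/(@flatten_mapP _ _ (fun p => [seq p :: q | q <- ballots n (h.+1 - p)])
  (iota 0 h.+2)); exists p; first by rewrite mem_iota.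
apply: map_f; apply: IH => // i ni.
by have := H i.+1 ni; rewrite /=; lia.
Qed.

Lemma size_ballotsS n h :
  size (ballots n.+1 h) = \sum_(k < h.+2) size (ballots n k).
Proof.
rewrite -[ballots n.+1 h]/(flatten [seq [seq p :: q | q <- ballots n (h.+1 - p)]
  | p <- iota 0 h.+2]) size_flatten /shape -map_comp sumnE big_map.
rewrite -[iota 0 h.+2]/(index_iota 0 h.+2) big_mkord (reindex_inj rev_ord_inj) /=.
apply: eq_bigr => k _; rewrite size_map; congr (size (ballots n _)).
by have := ltn_ord k; lia.
Qed.

(** The reflection formula for ballot numbers; for [h = 0] the difference is
    the Catalan number of index [n + 2]. *)
Lemma size_ballots n h :
  size (ballots n.+1 h) + 'C(2 * n + h + 3, n) = 'C(2 * n + h + 3, n.+1).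
Proof.
elim: n h => [|n IHn] h.
  rewrite size_ballotsS (eq_bigr (fun=> 1))// sum1_card card_ord bin0 bin1.
  by lia.
have pas m k : 'C(m.+1, k.+1) = 'C(m, k.+1) + 'C(m, k) by rewrite binS.
elim: h => [|h IHh].
  case: n IHn => [|n] IHn; first by [].
  have -> : size (ballots n.+3 0) = size (ballots n.+2 0) + size (ballots n.+2 1).
    by rewrite size_ballotsS !big_ord_recl big_ord0 addn0.
  have := IHn 0; have := IHn 1; rewrite !addn0.
  have -> : 2 * n.+2 + 3 = (2 * n.+1 + 4).+1 by lia.
  have -> : 2 * n.+1 + 1 + 3 = (2 * n.+1 + 3).+1 by lia.
  have -> : 2 * n.+1 + 4 = (2 * n.+1 + 3).+1 by lia.
  have sym : 'C(2 * n.+1 + 3, n.+3) = 'C(2 * n.+1 + 3, n.+2).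
    rewrite -[in LHS]bin_sub; last by lia.
    by congr 'C(_, _); lia.
  by move: (2 * n.+1 + 3) sym => k sym; rewrite !pas; lia.
have -> : 2 * n.+1 + h.+1 + 3 = (2 * n.+1 + h + 3).+1 by lia.
have e : size (ballots n.+2 h.+1) = size (ballots n.+2 h) + size (ballots n.+1 h.+2).
  by rewrite [in LHS]size_ballotsS big_ord_recr -size_ballotsS.
rewrite e; have := IHn h.+2.
have -> : 2 * n + h.+2 + 3 = 2 * n.+1 + h + 3 by lia.
by move: (2 * n.+1 + h + 3) IHh => k IHh; rewrite !pas; lia.
Qed.

Lemma bin_step n k : 2 * k <= n.+1 -> 'C(n.+1, k) <= 2 * 'C(n, k).
Proof.
case: k => [|k] h; first by rewrite !bin0.
rewrite binS; suff : 'C(n, k) <= 'C(n, k.+1) by lia.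
have e := mul_bin_left n k.
have h' : k.+1 <= n - k by lia.
by have := leq_mul h' (leqnn 'C(n, k)); rewrite -e leq_pmul2l.
Qed.

(** Growing from the central binomial coefficient of [2 * n] to a row three
    higher at most doubles the entry three times, and a ballot count of this
    row is [2 / n.+1] times the entry. *)
Lemma size_ballots_le n : n.+1 * size (ballots n.+1 0) <= 16 * 'C(2 * n, n).
Proof.
have h := size_ballots n 0; rewrite addn0 in h.
have e := mul_bin_left (2 * n + 3) n.
have h1 : 'C((2 * n).+1, n) <= 2 * 'C(2 * n, n) by apply: bin_step; lia.
have h2 : 'C((2 * n).+2, n) <= 2 * 'C((2 * n).+1, n) by apply: bin_step; lia.
have h3 : 'C((2 * n).+3, n) <= 2 * 'C((2 * n).+2, n) by apply: bin_step; lia.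
rewrite -h in e.
have e3 : (2 * n + 3) - n = n + 3 by lia.
rewrite e3 in e.
have -> : n.+1 * size (ballots n.+1 0) = 2 * 'C(2 * n + 3, n).
  by move: e; rewrite mulnDr mulnDl; lia.
by have -> : 2 * n + 3 = (2 * n).+3 by [lia|]; lia.
Qed.

Lemma central_binS n : n.+1 * 'C(2 * n.+1, n.+1) = 2 * (2 * n).+1 * 'C(2 * n, n).
Proof.
have e1 := mul_bin_diag (2 * n).+2 n; have e2 := mul_bin_down (2 * n).+1 n.
rewrite /= in e1 e2.
have -> : 2 * n.+1 = (2 * n).+2 by lia.
have e3 : (2 * n).+1 - n = n.+1 by lia.
rewrite e3 in e2; rewrite -e1.
have -> : (2 * n).+2 = 2 * n.+1 by lia.
by rewrite -!mulnA -e2.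
Qed.

(** The lower bound [4 ^ n / (2 * sqrt n)], squared to stay within the
    integers. *)
Lemma central_bin_lower n : (0 < n) ->
  (16 ^ n <= 4 * n * ('C(2 * n, n) * 'C(2 * n, n))).
Proof.
case: n => // n _; elim: n => [|n IH]; first by [].
have e := central_binS n.+1; rewrite expnS.
move: e IH; set b := 'C(2 * n.+1, n.+1); set b' := 'C(2 * n.+2, n.+2) => e IH.
rewrite -(@leq_pmul2l n.+2)//.
have -> : (n.+2 * (4 * n.+2 * (b' * b')) = 4 * ((n.+2 * b') * (n.+2 * b'))) by lia.
rewrite e.
have -> : (4 * (2 * (2 * n.+1).+1 * b * (2 * (2 * n.+1).+1 * b)) =
  16 * ((2 * n.+1).+1 * (2 * n.+1).+1) * (b * b)) by lia.
apply: leq_trans (_ : n.+2 * (16 * (4 * n.+1 * (b * b))) <= _).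
  by rewrite !leq_mul2l IH !orbT.
have -> : (n.+2 * (16 * (4 * n.+1 * (b * b))) = 16 * (4 * n.+1 * n.+2) * (b * b)) by lia.
by apply: leq_mul => //; rewrite leq_mul2l; lia.
Qed.

Lemma central_bin_upper n :
  ((2 * n).+1 * ('C(2 * n, n) * 'C(2 * n, n)) <= 16 ^ n).
Proof.
elim: n => [|n IH]; first by [].
have e := central_binS n; rewrite expnS.
move: e IH; set b := 'C(2 * n, n); set b' := 'C(2 * n.+1, n.+1) => e IH.
rewrite -(@leq_pmul2l (n.+1 * n.+1))//.
have -> : (n.+1 * n.+1 * ((2 * n.+1).+1 * (b' * b')) =
  (2 * n.+1).+1 * ((n.+1 * b') * (n.+1 * b'))) by lia.
rewrite e.
apply: leq_trans (_ : n.+1 * n.+1 * (16 * ((2 * n).+1 * (b * b))) <= _); last first.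
  by rewrite !leq_mul2l IH !orbT.
have -> : ((2 * n.+1).+1 * (2 * (2 * n).+1 * b * (2 * (2 * n).+1 * b)) =
   4 * ((2 * n.+1).+1 * (2 * n).+1) * ((2 * n).+1 * (b * b))) by lia.
have -> : (n.+1 * n.+1 * (16 * ((2 * n).+1 * (b * b))) =
   16 * (n.+1 * n.+1) * ((2 * n).+1 * (b * b))) by lia.
by apply: leq_mul => //; lia.
Qed.

(** * Pseudo-triangulations of a double chain *)

Local Open Scope ring_scope.

Lemma uniq_leq_card (I : finType) (l : seq I) (A : {set I}) :
  uniq l -> all (fun x => x \in A) l -> (size l <= #|A|)%N.
Proof.
move=> ul /allP sub; rewrite cardE; apply: uniq_leq_size => // x /sub.
by rewrite mem_enum.
Qed.

Lemma uniq_card_mem (I : finType) (l : seq I) (A : {set I}) x :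
  uniq l -> all (fun x => x \in A) l -> #|A| = size l -> x \in A -> x \in l.
Proof.
move=> ul al cA xA; apply: contraT => xl.
have := @uniq_leq_card _ (x :: l) A; rewrite /= xl ul xA al cA ltnn.
by move=> /(_ isT isT).
Qed.

Lemma triangle_interior (R : realType) (I : finType) (p : I -> plane R)
    (a b c z : plane R) :
  conv_hull p a -> conv_hull p b -> conv_hull p c ->
  0 < orient a b z -> 0 < orient b c z -> 0 < orient c a z -> (conv_hull p)° z.
Proof.
move=> ha hb hc zab zbc zca.
have n a' b' : 0 < orient a' b' z -> \forall y \near z, 0 < orient a' b' y.
  exact: cvgr_gt (@orient_continuous R a' b' z) _.
have n1 := n _ _ zab; have n2 := n _ _ zbc; have n3 := n _ _ zca.
suff : \forall y \near z, conv_hull p y by [].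
near=> y.
have h1 : 0 < orient a b y by near: y.
have h2 : 0 < orient b c y by near: y.
have h3 : 0 < orient c a y by near: y.
pose u := orient a b y / orient a b c.
pose t := orient c a y / (orient b c y + orient c a y).
have S : orient a b c = orient a b y + (orient b c y + orient c a y).
  by rewrite /orient; ring.
have Sgt0 : 0 < orient a b c by rewrite S addr_gt0// addr_gt0.
have yE : y = lerp (lerp a b t) c u.
  have e1 : orient a b c * y.1 = orient b c y * a.1 + orient c a y * b.1 +
    orient a b y * c.1 by rewrite /orient; ring.
  have e2 : orient a b c * y.2 = orient b c y * a.2 + orient c a y * b.2 +
    orient a b y * c.2 by rewrite /orient; ring.
  have S0 : orient a b c != 0 by rewrite gt_eqF.
  have S1 : orient b c y + orient c a y != 0 by rewrite gt_eqF// addr_gt0.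
  apply: injective_projections; rewrite /lerp /u /t /=.
    apply: (mulfI S0); rewrite e1 S; rewrite S in S0.
    by field; rewrite S0 S1.
  apply: (mulfI S0); rewrite e2 S; rewrite S in S0.
  by field; rewrite S0 S1.
rewrite yE; apply: hull_lerp => //.
  apply/andP; split; first by rewrite divr_ge0 ?ltW.
  rewrite ler_pdivrMr//.
  by rewrite mul1r S lerDl addr_ge0// ltW.
apply: hull_lerp => //.
apply/andP; split; first by rewrite divr_ge0 ?ltW// addr_gt0.
by rewrite ler_pdivrMr; [rewrite mul1r lerDr ltW|exact: addr_gt0].
Unshelve. all: by end_near. Qed.

Ltac arith := repeat match goal with
  | H : forall _, _ |- _ => clear H
  | H : ?T |- _ => lazymatch T with
     | is_true (_ < _)%N => fail | is_true (_ <= _)%N => fail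
     | is_true (_ < _)%R => fail | is_true (_ <= _)%R => fail
     | is_true (_ != _) => fail | _ = _ => fail
     | is_true (_ && _) => fail
     | nat => fail | _ => clear H end end; lia.

Section DoubleChain.
Variables (R : realType) (I : finType) (p : I -> plane R).
Hypothesis gp : general_position p.
Variables (side : I -> bool) (pos : I -> nat) (len : bool -> nat)
  (at_ : bool -> nat -> I).

(** Coordinates for a double chain. The positions on both sides increase
    clockwise around the 4-gon, so that both chains obey the same sign rules
    and the two sides are interchangeable. *)
Definition chain_frame : Prop :=
  [/\ [/\ forall x, (pos x <= len (side x))%N,
          forall x, at_ (side x) (pos x) = x,
          forall c k, (k <= len c)%N -> side (at_ c k) = c,
          forall c k, (k <= len c)%N -> pos (at_ c k) = k &
          forall c, (0 < len c)%N],
      forall x y z, side x = side y -> side y = side z -> (pos x < pos y < pos z)%N ->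
        0 < orient (p x) (p y) (p z) &
      forall x y b, side x = side y -> side b != side x -> (pos x < pos y)%N ->
        orient (p x) (p y) (p b) < 0].

Hypothesis frame : chain_frame.
Implicit Types (x y u v w b : I) (c : bool).

Let pos_len x : (pos x <= len (side x))%N. Proof. by move: x; case: frame => -[]. Qed.
Let atK x : at_ (side x) (pos x) = x. Proof. by move: x; case: frame => -[]. Qed.
Let side_at c k : (k <= len c)%N -> side (at_ c k) = c.
Proof. by move: c k; case: frame => -[]. Qed.
Let pos_at c k : (k <= len c)%N -> pos (at_ c k) = k.
Proof. by move: c k; case: frame => -[]. Qed.
Let len_gt0 c : (0 < len c)%N. Proof. by move: c; case: frame => -[]. Qed.

Lemma pos_inj x y : side x = side y -> pos x = pos y -> x = y.
Proof. by move=> s e; rewrite -[x]atK s e atK. Qed.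

Lemma orient_same x y z : side x = side y -> side y = side z ->
  (pos x < pos y < pos z)%N -> 0 < orient (p x) (p y) (p z).
Proof. by case: frame => _ h _; exact: h. Qed.

Lemma orient_opp x y b : side x = side y -> side b != side x ->
  (pos x < pos y)%N -> orient (p x) (p y) (p b) < 0.
Proof. by case: frame => _ _ h; exact: h. Qed.

Lemma p_neq x y : x != y -> p x != p y.
Proof. by apply: contraNneq => /(p_inj gp)->. Qed.

Lemma other_side c c' : c != c' -> c' = ~~ c. Proof. by case: c; case: c'. Qed.

(** The point is inside the triangle spanned by the two ends of its chain and
    a point of the other chain. *)
Lemma inner_interior x : (0 < pos x < len (side x))%N -> x \in interior_points p.
Proof.
move=> /andP[x0 xl]; rewrite inE; apply/asboolP.
pose l := at_ (side x) 0; pose r := at_ (side x) (len (side x)).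
pose b := at_ (~~ side x) 0.
have sb : side b = ~~ side x by exact: side_at.
have sl : side l = side x by exact: side_at.
have sr : side r = side x by exact: side_at.
have pl : pos l = 0%N by exact: pos_at.
have pr : pos r = len (side x) by exact: pos_at.
have bx : side b != side x by rewrite sb; case: (side x).
apply: (@triangle_interior _ _ p (p l) (p b) (p r)); do ?exact: hull_pt.
- have : orient (p l) (p x) (p b) < 0 by apply: orient_opp; rewrite ?sl ?pl.
  rewrite /orient; lra.
- have : orient (p x) (p r) (p b) < 0 by apply: orient_opp; rewrite ?sr ?pr.
  rewrite /orient; lra.
- have : 0 < orient (p l) (p x) (p r).
    by apply: orient_same; rewrite ?sl ?sr ?pl ?pr ?x0.
  rewrite /orient; lra.
Qed.

(** A side of the 4-gon joining the two chains supports the hull at a chain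
    end. *)
Lemma end_not_interior x : (pos x == 0)%N || (pos x == len (side x))%N ->
  x \notin interior_points p.
Proof.
move=> xe.
have [q [qx h]] : exists q : plane R, q != p x /\ forall y, 0 <= orient q (p x) (p y).
  have [x0|x0] := eqVneq (pos x) 0%N.
    pose b := at_ (~~ side x) (len (~~ side x)).
    have sb : side b = ~~ side x by exact: side_at.
    have pb : pos b = len (~~ side x) by exact: pos_at.
    have bx : side b != side x by rewrite sb; case: (side x).
    exists (2 * (p x).1 - (p b).1, 2 * (p x).2 - (p b).2); split.
      have xb : p x != p b by apply: p_neq; apply: contraNneq bx => ->.
      apply: contra xb => /eqP e.
      rewrite [p x]surjective_pairing [p b]surjective_pairing.
      rewrite [p x]surjective_pairing in e; case: e => e1 e2.
      by apply/eqP; congr pair; lra.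
    move=> y.
    have -> : orient (2 * (p x).1 - (p b).1, 2 * (p x).2 - (p b).2) (p x) (p y)
      = orient (p x) (p b) (p y) by rewrite /orient /=; ring.
    have [yx|yx] := eqVneq (side y) (side x).
      have [ye|/eqP ye] := eqVneq y x; first by rewrite ye orient_aba.
      have : orient (p x) (p y) (p b) < 0.
        apply: orient_opp => //; rewrite x0 lt0n.
        by apply/eqP => y0; apply: ye; apply: pos_inj; rewrite ?y0.
      by rewrite /orient; lra.
    have yb : side y = side b by rewrite sb; apply: other_side; rewrite eq_sym.
    have [->|/eqP ye] := eqVneq y b; first by rewrite orient_abb.
    have : orient (p y) (p b) (p x) < 0.
      apply: orient_opp => //; first by rewrite eq_sym.
      rewrite ltn_neqAle pb -sb -yb pos_len andbT; apply/eqP => e; apply: ye.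
      by apply: pos_inj; rewrite // pb -sb -yb.
    by rewrite /orient; lra.
  move: xe; rewrite (negbTE x0) /= => /eqP xl.
  pose b := at_ (~~ side x) 0.
  have sb : side b = ~~ side x by exact: side_at.
  have pb : pos b = 0%N by exact: pos_at.
  have bx : side b != side x by rewrite sb; case: (side x).
  exists (p b); split; first by apply: p_neq; apply: contraNneq bx => ->.
  move=> y; have [yx|yx] := eqVneq (side y) (side x).
    have [ye|/eqP ye] := eqVneq y x; first by rewrite ye orient_abb.
    have : orient (p y) (p x) (p b) < 0.
      apply: orient_opp; rewrite ?yx// ltn_neqAle xl -yx pos_len andbT.
      by apply/eqP => e; apply: ye; apply: pos_inj; rewrite // xl -yx.
    by rewrite /orient; lra.
  have yb : side y = side b by rewrite sb; apply: other_side; rewrite eq_sym.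
  have [->|/eqP ye] := eqVneq y b; first by rewrite orient_aba.
  have : orient (p b) (p y) (p x) < 0.
    apply: orient_opp; [by []|by rewrite eq_sym|rewrite pb lt0n].
    by apply/eqP => e; apply: ye; apply: pos_inj; rewrite // e pb.
  by rewrite /orient; lra.
apply/negP; rewrite inE => /asboolP int.
have [z oz] := orient_smaller (p x) qx; rewrite orient_abb in oz.
have [e [e0 e1]] := near0_ex (lerp_near0 z int).
move=> /(hull_halfplane h); rewrite orient_lerp orient_abb mulr0 add0r.
by rewrite pmulr_rge0// leNgt oz.
Qed.

Section Triangulated.
Variables (T : {set {perm I}}) (K : {perm I} -> set (plane R)).
Hypothesis tri : cell_family p T K.
Implicit Types (l r : I) (s : {perm I}).

Lemma card_convex s : s \in T -> #|convex_vertices p s| = 3.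
Proof. by move=> sT; case: tri => _ [/(_ s sT)[]]. Qed.

Lemma vertex_cases s v : s \in T -> v \in vertices s ->
  (v \in convex_vertices p s) || (v \in reflex_vertices p s).
Proof.
move=> sT vv.
rewrite [v \in convex_vertices _ _]inE [v \in reflex_vertices _ _]inE vv /=.
by have := turn_neq0 gp (cell_polygon tri sT) vv; rewrite neq_lt orbC.
Qed.

Lemma convex_not_reflex s v : v \in convex_vertices p s ->
  v \in reflex_vertices p s -> False.
Proof.
by rewrite inE => /andP[_ h]; rewrite inE => /andP[_ /lt_trans/(_ h)]; rewrite ltxx.
Qed.

Lemma convexW s v : v \in convex_vertices p s -> v \in vertices s.
Proof. by rewrite inE => /andP[]. Qed.

Lemma reflexW s v : v \in reflex_vertices p s -> v \in vertices s.
Proof. by rewrite inE => /andP[]. Qed.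

Lemma cell_min s v : v \in vertices s -> exists u,
  [/\ u \in vertices s, side u = side v &
      forall z, z \in vertices s -> side z = side v -> (pos u <= pos z)%N].
Proof.
move=> vv; have Pv : (v \in vertices s) && (side v == side v) by rewrite vv eqxx.
case: (@arg_minnP _ v (fun z => (z \in vertices s) && (side z == side v)) pos Pv).
move=> u /andP[uv /eqP us] um; exists u; split=> // z zv zs.
by apply: um; rewrite zv zs eqxx.
Qed.

Lemma cell_max s v : v \in vertices s -> exists u,
  [/\ u \in vertices s, side u = side v &
      forall z, z \in vertices s -> side z = side v -> (pos z <= pos u)%N].
Proof.
move=> vv; have Pv : (v \in vertices s) && (side v == side v) by rewrite vv eqxx.
case: (@arg_maxnP _ v (fun z => (z \in vertices s) && (side z == side v)) pos Pv).
move=> u /andP[uv /eqP us] um; exists u; split=> // z zv zs.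
by apply: um; rewrite zv zs eqxx.
Qed.

Lemma pos_lt u z : side u = side z -> (pos u <= pos z)%N -> z != u ->
  (pos u < pos z)%N.
Proof.
move=> sd le zu; rewrite ltn_neqAle le andbT; apply: contra zu => /eqP e.
by apply/eqP/esym/pos_inj.
Qed.

(** The line from [u] to [v] supports the cell, whose other vertices all lie
    to its left. *)
Lemma extremes_convex s u v : s \in T -> u \in vertices s -> v \in vertices s ->
  side u != side v ->
  (forall z, z \in vertices s -> side z = side u -> (pos u <= pos z)%N) ->
  (forall z, z \in vertices s -> side z = side v -> (pos z <= pos v)%N) ->
  (u \in convex_vertices p s) * (v \in convex_vertices p s).
Proof.
move=> sT uu vv uv um vm.
have pos_line z : z \in vertices s -> 0 <= orient (p u) (p v) (p z).
  move=> zz; have [zu|zu] := eqVneq (side z) (side u).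
    have [->|ne] := eqVneq z u; first by rewrite orient_aba.
    have := orient_opp (esym zu) (_ : side v != side u) (pos_lt (esym zu) (um z zz zu) ne).
    by rewrite eq_sym => /(_ uv); rewrite /orient; lra.
  have zv : side z = side v by move: zu uv; case: (side z) (side u) (side v) => -[] [].
  have [->|ne] := eqVneq z v; first by rewrite orient_abb.
  rewrite eq_sym in ne.
  have := orient_opp zv (_ : side u != side z) (pos_lt zv (vm z zz zv) ne).
  by rewrite eq_sym => /(_ zu); rewrite /orient; lra.
have puv : p u != p v by apply: (p_neq); apply: contra uv => /eqP->.
split; apply: (extreme_convex gp tri sT puv) => //.
  by rewrite orient_aba.
by rewrite orient_abb.
Qed.

(** Otherwise the first and the last vertices on both sides would be four
    convex vertices. *)
Lemma single_side s u v : s \in T -> u \in vertices s -> v \in vertices s ->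
  side u != side v ->
  (forall z, z \in vertices s -> side z = side u -> z = u) \/
  (forall z, z \in vertices s -> side z = side v -> z = v).
Proof.
move=> sT uu vv uv.
have [u1 [u1v u1s u1m]] := cell_min uu; have [u2 [u2v u2s u2m]] := cell_max uu.
have [v1 [v1v v1s v1m]] := cell_min vv; have [v2 [v2v v2s v2m]] := cell_max vv.
have [c1 c2] : (u1 \in convex_vertices p s) * (v2 \in convex_vertices p s).
  by apply: extremes_convex; rewrite ?u1s ?v2s.
have [c3 c4] : (v1 \in convex_vertices p s) * (u2 \in convex_vertices p s).
  by apply: extremes_convex; rewrite ?v1s ?u2s// eq_sym.
have [eu|nu] := eqVneq u1 u2.
  left=> z zv zs; have h x : x \in vertices s -> side x = side u -> x = u1.
    move=> xv xs; apply: pos_inj; rewrite ?u1s//; apply/eqP.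
    by rewrite eqn_leq u1m// eu u2m.
  by rewrite (h z)// (h u).
have [ev|nv] := eqVneq v1 v2.
  right=> z zv zs; have h x : x \in vertices s -> side x = side v -> x = v1.
    move=> xv xs; apply: pos_inj; rewrite ?v1s//; apply/eqP.
    by rewrite eqn_leq v1m// ev v2m.
  by rewrite (h z)// (h v).
have ne a b' : side a = side u -> side b' = side v -> a != b'.
  by move=> ha hb; apply: contra uv => /eqP e; rewrite -ha e hb.
have := @uniq_leq_card _ [:: u1; u2; v1; v2] (convex_vertices p s).
rewrite (card_convex sT) /= !in_cons !in_nil !orbF !negb_or nu nv !ne//=.
rewrite c1 c2 c3 c4.
by move=> /(_ isT isT).
Qed.

(** The points of one chain are in convex position, so each of them is extreme
    for a line through an adjacent point of the chain. *)
Lemma one_sided_convex s i : s \in T -> i \in vertices s ->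
  (forall z, z \in vertices s -> side z = side i) -> i \in convex_vertices p s.
Proof.
move=> sT vi al.
have [il|il] := ltnP (pos i) (len (side i)).
  pose e := at_ (side i) (pos i).+1.
  have se : side e = side i by exact: side_at.
  have pe : pos e = (pos i).+1 by exact: pos_at.
  have ie : p i != p e.
    by apply: (p_neq); apply/eqP => h; move: pe; rewrite -h => /n_Sn.
  apply: (extreme_convex gp tri sT ie) => //; first by rewrite orient_aba.
  move=> z zv; have zs := al z zv.
  have [zi|zi|zi] := ltngtP (pos z) (pos i).
  - have : 0 < orient (p z) (p i) (p e) by apply: orient_same; rewrite ?zs ?se ?pe ?zi ?leqnn.
    by rewrite /orient; lra.
  - have [ze|ze] := eqVneq z e; first by rewrite ze orient_abb.
    apply/ltW/orient_same; rewrite ?zs ?se ?pe ?ltnSn//= ltn_neqAle zi andbT.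
    by apply: contra ze => /eqP h; apply/eqP/pos_inj; rewrite ?zs ?se ?pe.
  - by rewrite (pos_inj zs zi) orient_aba.
have iE : pos i = len (side i) by apply/eqP; rewrite eqn_leq pos_len.
pose e := at_ (side i) (pos i).-1.
have pl : ((pos i).-1 <= len (side i))%N by rewrite -iE leq_pred.
have se : side e = side i by exact: side_at.
have pe : pos e = (pos i).-1 by exact: pos_at.
have i0 : (0 < pos i)%N by rewrite iE len_gt0.
have ie : p e != p i.
  by apply: (p_neq); apply/eqP => h; move: pe; rewrite h; lia.
apply: (extreme_convex gp tri sT ie) => //; first by rewrite orient_abb.
move=> z zv; have zs := al z zv.
have [->|zi] := eqVneq z i; first by rewrite orient_abb.
have [->|ze] := eqVneq z e; first by rewrite orient_aba.
have zi' : (pos z < pos i)%N.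
  by apply: pos_lt; rewrite 1?eq_sym// iE -zs pos_len.
have : 0 < orient (p z) (p e) (p i).
  apply: orient_same; rewrite ?zs ?se ?pe// ltn_predL i0 andbT.
  have : pos z != (pos i).-1.
    by apply: contra ze => /eqP h; apply/eqP/pos_inj; rewrite ?zs ?se ?pe.
  by move: zi'; lia.
by rewrite /orient; lra.
Qed.

(** The cell meets both chains by [one_sided_convex]. As the ends of its part
    on the chain of [i] are convex, it has a single vertex [b] on the other
    chain by [single_side], and the three convex vertices are used up. *)
Lemma reflex_cell_shape s i : s \in T -> i \in reflex_vertices p s ->
  exists x y b,
  [/\ [/\ x \in vertices s, y \in vertices s & b \in convex_vertices p s],
      [/\ side x = side i, side y = side i & side b != side i],
      (pos x < pos i < pos y)%N,
      forall z, z \in vertices s -> side z = side i ->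
        (pos x <= pos z <= pos y)%N /\
        (z != x -> z != y -> z \in reflex_vertices p s) &
      forall z, z \in vertices s -> side z != side i -> z = b].
Proof.
move=> sT ri; have vi := reflexW ri.
have [b [bv bs]] : exists b, b \in vertices s /\ side b != side i.
  apply: contrapT => no; apply: (@convex_not_reflex s i) => //.
  apply: one_sided_convex => // z zv; apply: contrapT => /eqP zi.
  by apply: no; exists z.
have sbi : side i != side b by rewrite eq_sym.
have [x [xv xs xm]] := cell_min vi; have [y [yv ys ym]] := cell_max vi.
have [b1 [b1v b1s b1m]] := cell_min bv; have [b2 [b2v b2s b2m]] := cell_max bv.
have [cx cb2] : (x \in convex_vertices p s) * (b2 \in convex_vertices p s).
  by apply: extremes_convex; rewrite ?xs ?b2s.
have [cb1 cy] : (b1 \in convex_vertices p s) * (y \in convex_vertices p s).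
  by apply: extremes_convex; rewrite ?b1s ?ys.
have xi : x != i by apply/eqP => e; apply: (@convex_not_reflex s i); rewrite -?e// e.
have yi : y != i by apply/eqP => e; apply: (@convex_not_reflex s i); rewrite -?e// e.
have px : (pos x < pos i)%N by apply: pos_lt; rewrite 1?eq_sym// xm.
have py : (pos i < pos y)%N by apply: pos_lt => //; rewrite ym.
have [h|h] := single_side sT vi bv sbi.
  by move: xi; rewrite (h x xv xs) eqxx.
have b2E : b2 = b by exact: h.
exists x, y, b; split=> //.
- by split=> //; rewrite -b2E.
- by rewrite px py.
- move=> z zv zs; split; first by rewrite xm// ym.
  move=> zx zy; have := vertex_cases sT zv => /orP[zc|//].
  have zb : z != b by apply: contra bs => /eqP <-; rewrite zs.
  have xb : x != b by apply: contra bs => /eqP <-; rewrite xs.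
  have yb : y != b by apply: contra bs => /eqP <-; rewrite ys.
  have xy : x != y by apply/eqP => e; move: py; rewrite -e ltnNge (ltnW px).
  have := @uniq_leq_card _ [:: x; y; b; z] (convex_vertices p s).
  rewrite -b2E in zb xb yb *.
  rewrite (card_convex sT) /= !in_cons !in_nil !orbF !negb_or xy xb yb.
  rewrite (eq_sym x) (eq_sym y) (eq_sym b2) zx zy zb /=.
  rewrite cx cy cb2 zc.
  by move=> /(_ isT isT).
- move=> z zv zs; apply: h => //; move: zs sbi.
  by case: (side z) (side i) (side b) => -[] [].
Qed.

Definition inner_vertex x : bool := (0 < pos x < len (side x))%N.

Lemma same_side_noncrossing u v u' v' :
  side v = side u -> side u' = side u -> side v' = side u ->
  adj T u v -> adj T u' v' ->
  (pos u < pos u')%N -> (pos u' < pos v)%N -> (pos v < pos v')%N -> False.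
Proof.
move=> sv su' sv' uv uv' h1 h2 h3.
have o1 : 0 < orient (p u) (p u') (p v) by apply: orient_same; rewrite ?su' ?sv ?h1.
have o2 : 0 < orient (p u) (p v) (p v') by apply: orient_same; rewrite ?sv' ?sv ?h3 ?(ltn_trans h1).
have o3 : 0 < orient (p u) (p u') (p v').
  by apply: orient_same; rewrite ?sv' ?su' ?h1 ?(ltn_trans h2).
have o4 : 0 < orient (p u') (p v) (p v').
  by apply: orient_same; rewrite ?sv' ?su' ?sv ?h2.
apply: (noncrossing gp tri uv uv').
  rewrite pmulr_llt0// /orient; move: o1; rewrite /orient; lra.
have -> : orient (p u') (p v') (p u) = orient (p u) (p u') (p v') by rewrite /orient; ring.
rewrite pmulr_rlt0//; move: o4; rewrite /orient; lra.
Qed.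

Lemma cross_noncrossing u v u' v' : side v != side u ->
  side u' = side u -> side v' = side v -> adj T u v -> adj T u' v' ->
  (pos u < pos u')%N -> (pos v < pos v')%N -> False.
Proof.
move=> svu su' sv' uv uv' h1 h2.
have suv : side u != side v by rewrite eq_sym.
have o1 : orient (p u) (p u') (p v) < 0 by apply: orient_opp.
have o2 : orient (p u) (p u') (p v') < 0 by apply: orient_opp; rewrite ?sv'.
have o3 : orient (p v) (p v') (p u) < 0 by apply: orient_opp.
have o4 : orient (p v) (p v') (p u') < 0 by apply: orient_opp; rewrite ?su'.
apply: (noncrossing gp tri uv uv').
  have -> : orient (p u) (p v) (p u') = - orient (p u) (p u') (p v) by rewrite /orient; ring.
  have -> : orient (p u) (p v) (p v') = orient (p v) (p v') (p u) by rewrite /orient; ring.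
  by rewrite pmulr_rlt0// oppr_gt0.
have -> : orient (p u') (p v') (p u) = orient (p u) (p u') (p v') by rewrite /orient; ring.
have -> : orient (p u') (p v') (p v) = - orient (p v) (p v') (p u') by rewrite /orient; ring.
by rewrite nmulr_rlt0// oppr_gt0.
Qed.

Lemma closed_vertices s (Z : {set I}) i v : s \in T -> i \in vertices s -> i \in Z ->
  (forall z, z \in Z -> s z \in Z) -> v \in vertices s -> v \in Z.
Proof.
move=> sT vi iZ cl vv; have [[[_ cyc] _] _ _ _ _] := cell_polygon tri sT.
have /porbitP[n ->] := cyc i v vi vv; rewrite permX.
by elim: n => //= n IH; exact: cl.
Qed.

Lemma vertices_inv s : vertices (s^-1)%g = vertices s.
Proof.
by apply/setP => x; rewrite !inE -(inj_eq (@perm_inj _ s)) permKV eq_sym.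
Qed.

Lemma closedV_vertices s (Z : {set I}) i v : s \in T -> i \in vertices s -> i \in Z ->
  (forall z, z \in Z -> (s^-1)%g z \in Z) -> v \in vertices s -> v \in Z.
Proof.
move=> sT vi iZ cl vv; have [[[_ cyc] _] _ _ _ _] := cell_polygon tri sT.
have := cyc v i vv vi => /porbitP[n iE].
have -> : v = iter n (s^-1)%g i by rewrite -permX expgVn iE permK.
by elim: n {iE} => //= n IH; exact: cl.
Qed.

Lemma edge_adj s u v : s \in T -> u != v -> s u = v \/ s v = u -> adj T u v.
Proof.
move=> sT uv h; rewrite /adj uv; apply/existsP; exists s; rewrite sT /=.
by case: h => ->; rewrite eqxx ?orbT.
Qed.

Lemma reflex_turn s v : v \in reflex_vertices p s ->
  orient (p ((s^-1)%g v)) (p v) (p (s v)) < 0.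
Proof. by rewrite inE => /andP[]. Qed.

(** An instance of [no_pocket]: on the chain of [i], all the vertices of the
    cell strictly between the extreme ones are reflex, and the remaining
    vertex [b] is on the other chain. Reversing both the boundary and the
    positions gives the mirror image of the situation, so [sg] and [P] cover
    the two cases. *)
Lemma pocket_side s (sg : {perm I}) (P : I -> int) i : s \in T ->
  i \in reflex_vertices p s ->
  (sg = s /\ (forall v, P v = (pos v)%:Z)) \/
  (sg = (s^-1)%g /\ (forall v, P v = - (pos v)%:Z)) ->
  side (sg i) = side i -> side ((sg^-1)%g i) = side i ->
  P ((sg^-1)%g i) < P (sg i) -> P (sg i) < P i -> False.
Proof.
move=> sT ri sgP sn sp kk' k'i; have vi := reflexW ri.
have [x [y [b [[xv yv bc] [xs ys bs] /andP[xi iy] same other]]]] :=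
  reflex_cell_shape sT ri.
have bv := convexW bc.
have vsg : vertices sg = vertices s by case: sgP => -[-> _] //; rewrite vertices_inv.
have onside v : v \in vertices s -> v != b -> side v = side i.
  by move=> vv; apply: contraNeq => /(other v vv)->.
have mv v : sg v != v -> v \in vertices s by rewrite -vsg inE.
have PE u v : P u = P v -> pos u = pos v.
  by case: sgP => -[_ PE0]; rewrite !PE0 => h; arith.
have kv : (sg^-1)%g i \in vertices s by rewrite -vsg vertices_sV vsg.
have noB z : side z = side i -> z != b by move=> e; apply: contra bs => /eqP<-; rewrite e.
have medge u v : u != v -> sg u = v \/ sg v = u -> u \in vertices s /\ v \in vertices s.
  move=> uv [e|e].
    have uu : u \in vertices s by apply: mv; rewrite e eq_sym.
    by split=> //; rewrite -e -vsg vertices_s vsg.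
  have vv : v \in vertices s by apply: mv; rewrite e.
  by split=> //; rewrite -e -vsg vertices_s vsg.
have aedge u v : u != v -> sg u = v \/ sg v = u -> adj T u v.
  move=> uv h; apply: (edge_adj sT uv); case: sgP h => -[-> _] // [<-|<-].
    by right; rewrite permKV.
  by left; rewrite permKV.
have pk : forall w, w \in vertices s -> side w = side i -> P ((sg^-1)%g i) < P w ->
    P w < P i -> w \in reflex_vertices p s.
  move=> w wv ws kw wi; have [_ h] := same w wv ws.
  have [bnd _] := same _ kv sp.
  by apply: h; apply/eqP => wE; subst w; move: kw wi bnd xi iy;
    case: sgP => -[_ PE'']; rewrite !PE''; arith.
apply: (@no_pocket I sg b i P) => //.
- move=> u v ub vb mu mv' e.
  by apply: pos_inj; [rewrite !onside// ; exact: mv|exact: PE].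
- move=> Z iZ cl; case: sgP cl => -[-> _] cl.
    exact: (closed_vertices sT vi iZ cl bv).
  exact: (closedV_vertices sT vi iZ cl bv).
- move=> u v u' v' [ub vb e] [ub' vb' e'] h1 h2 h3.
  have uv : u != v by apply/eqP => h; move: h1 h2; rewrite h => /lt_trans h1 /h1; rewrite ltxx.
  have uv' : u' != v' by apply/eqP => h; move: h2 h3; rewrite h => /lt_trans h2 /h2; rewrite ltxx.
  have [m1 m2] := medge _ _ uv e; have [m1' m2'] := medge _ _ uv' e'.
  have a1 := aedge _ _ uv e; have a2 := aedge _ _ uv' e'.
  have [s1 s2] : side u = side i /\ side v = side i by split; exact: onside.
  have [s1' s2'] : side u' = side i /\ side v' = side i by split; exact: onside.
  case: sgP h1 h2 h3 => -[_ PE']; rewrite !PE'.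
    rewrite !ltz_nat => h1 h2 h3.
    by apply: (same_side_noncrossing _ _ _ a1 a2 h1 h2 h3); rewrite ?s1 ?s2 ?s1' ?s2'.
  rewrite !ltrN2 !ltz_nat => h1 h2 h3; rewrite adj_sym in a1; rewrite adj_sym in a2.
  by apply: (same_side_noncrossing _ _ _ a2 a1 h3 h2 h1); rewrite ?s1 ?s2 ?s1' ?s2'.
- exact: noB.
- exact: noB.
- exact: noB.
- move=> v vb wb rb kw wv vle.
  have fv : sg v != v by apply/eqP => h; move: wv; rewrite h ltxx.
  have vv := mv _ fv.
  have wv' : sg v \in vertices s by rewrite -vsg vertices_s vsg.
  have rv : sg (sg v) \in vertices s by rewrite -vsg vertices_s vsg.
  have [sv sw sr] : [/\ side v = side i, side (sg v) = side i & side (sg (sg v)) = side i].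
    by split; apply: onside.
  have rw := pk _ wv' sw kw (lt_le_trans wv vle).
  have nrv : sg (sg v) != v.
    case: sgP => -[-> _]; first exact: (no_two_cycle gp (cell_polygon tri sT)).
    have := no_two_cycle gp (cell_polygon tri sT) (i := v) vv.
    by apply: contra => /eqP h; apply/eqP; rewrite -{1}h !permKV.
  have nrw : sg (sg v) != sg v by rewrite (inj_eq perm_inj).
  have [?|rw'] := ltP (P (sg (sg v))) (P (sg v)); first by left.
  right; rewrite ltNge; apply/negP => rv'.
  have nP1 : P (sg (sg v)) != P (sg v).
    by apply: contra nrw => /eqP/PE h; apply/eqP/pos_inj; rewrite ?sr ?sw.
  have nP2 : P (sg (sg v)) != P v.
    by apply: contra nrv => /eqP/PE h; apply/eqP/pos_inj; rewrite ?sr ?sv.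
  have lt1 : P (sg v) < P (sg (sg v)) by rewrite lt_neqAle eq_sym nP1.
  have lt2 : P (sg (sg v)) < P v by rewrite lt_neqAle nP2.
  have := reflex_turn rw.
  case: sgP sr sw lt1 lt2 => -[-> PE']; rewrite !PE' => sr sw.
    rewrite !ltz_nat permK => h1 h2 o.
    have : 0 < orient (p (s v)) (p (s (s v))) (p v).
      by apply: orient_same; rewrite ?sr ?sw ?sv// h1 h2.
    by move: o; rewrite /orient; lra.
  rewrite !ltrN2 !ltz_nat permKV => h1 h2 o.
  have : 0 < orient (p v) (p ((s^-1)%g ((s^-1)%g v))) (p ((s^-1)%g v)).
    by apply: orient_same; rewrite ?sr ?sw ?sv// h1 h2.
  by move: o; rewrite /orient; lra.
- move=> v vb wb rb kw wv vle.
  have fv : sg v != v by apply/eqP => h; move: wv; rewrite h ltxx.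
  have vv := mv _ fv.
  have wv' : sg v \in vertices s by rewrite -vsg vertices_s vsg.
  have [sv sw] : side v = side i /\ side (sg v) = side i by split; apply: onside.
  have rw := pk _ wv' sw kw (lt_le_trans wv vle).
  have := reflex_turn rw.
  case: sgP sw wv rb => -[-> PE']; rewrite !PE' => sw.
    rewrite ltz_nat permK => h rb; rewrite rb => o.
    have : orient (p (s v)) (p v) (p b) < 0 by apply: orient_opp; rewrite ?sw ?sv.
    by move: o; rewrite /orient; lra.
  rewrite ltrN2 ltz_nat permKV => h rb; rewrite rb => o.
  have : orient (p v) (p ((s^-1)%g v)) (p b) < 0 by apply: orient_opp; rewrite ?sw ?sv.
  by move: o; rewrite /orient; lra.
Qed.

Definition left_nbr z u := [/\ adj T z u, side u = side z & (pos u < pos z)%N].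
Definition right_nbr z u := [/\ adj T z u, side u = side z & (pos z < pos u)%N].
Definition cross_nbr z u := adj T z u /\ side u != side z.

Lemma adj_neq u v : adj T u v -> u != v.
Proof. by case/andP. Qed.

Lemma nbr_cases z u : adj T z u ->
  [\/ left_nbr z u, right_nbr z u | cross_nbr z u].
Proof.
move=> zu; have [s|s] := eqVneq (side u) (side z); last by constructor 3.
have [h|h|h] := ltgtP (pos u) (pos z); [by constructor 1|by constructor 2|].
by have := adj_neq zu; rewrite (pos_inj s h) eqxx.
Qed.

(** The directions from [i] to a left, a right and a cross neighbour
    positively span the plane, so they cannot all avoid the reflex sector,
    which contains an open half plane. *)
Lemma reflex_not_both s i l r b : s \in T -> i \in reflex_vertices p s ->
  left_nbr i l -> right_nbr i r -> cross_nbr i b -> False.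
Proof.
move=> sT ri [il sl pl] [ir sr pr] [ib sb]; have vi := reflexW ri.
have t0 := reflex_turn ri.
have out z : adj T i z -> orient (p i) (p (s i)) (p z) <= 0.
  move=> iz; have := adj_notin_sector gp tri sT vi iz.
  rewrite /sector !mul1r /turn (lt_gtF t0) negb_or -!leNgt.
  by case/andP.
have c1 : orient (p l) (p i) (p b) < 0 by apply: orient_opp; rewrite ?sl.
have c2 : orient (p i) (p r) (p b) < 0 by apply: orient_opp; rewrite ?sr.
have c3 : 0 < orient (p l) (p i) (p r) by apply: orient_same; rewrite ?sl ?sr ?pl.
have := out _ il; have := out _ ir; have := out _ ib.
set w := s i; move=> ob or_ ol.
(* A positive combination of three nonpositive terms vanishes, so the left
   and the right neighbour are both on the line through [i] and [w]. *)
have e : - orient (p l) (p i) (p b) * orient (p i) (p w) (p r) +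
   (- orient (p i) (p r) (p b) * orient (p i) (p w) (p l) +
   orient (p l) (p i) (p r) * orient (p i) (p w) (p b)) = 0.
  by rewrite /orient; ring.
have h1 : - orient (p l) (p i) (p b) * orient (p i) (p w) (p r) <= 0.
  by rewrite pmulr_rle0// oppr_gt0.
have h2 : - orient (p i) (p r) (p b) * orient (p i) (p w) (p l) <= 0.
  by rewrite pmulr_rle0// oppr_gt0.
have h3 : orient (p l) (p i) (p r) * orient (p i) (p w) (p b) <= 0.
  by rewrite pmulr_rle0.
have e1 : - orient (p l) (p i) (p b) * orient (p i) (p w) (p r) = 0 by lra.
have e2 : - orient (p i) (p r) (p b) * orient (p i) (p w) (p l) = 0 by lra.
have iw : i != w by rewrite eq_sym; move: vi; rewrite inE.
have h z : adj T i z -> orient (p i) (p w) (p z) = 0 -> z = w.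
  move=> /adj_neq iz oz; apply: contrapT => /eqP zw.
  have := @orient_neq0 _ _ _ gp i w z iw; rewrite eq_sym zw iz oz eqxx.
  by move=> /(_ isT isT).
have rw : r = w.
  apply: h => //; move/eqP: e1; rewrite mulf_eq0 oppr_eq0 lt_eqF//.
  by move=> /eqP.
have lw : l = w.
  apply: h => //; move/eqP: e2; rewrite mulf_eq0 oppr_eq0 lt_eqF//.
  by move=> /eqP.
by move: pl pr; rewrite rw lw => h4 /(ltn_trans h4); rewrite ltnn.
Qed.

Lemma reflex_of_halfplane i e : inner_vertex i -> e != i ->
  (forall j, adj T i j -> 0 <= orient (p i) (p e) (p j)) \/
  (forall j, adj T i j -> orient (p i) (p e) (p j) <= 0) ->
  exists2 s, s \in T & i \in reflex_vertices p s.
Proof.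
move=> inn ei h; have int := inner_interior inn.
have pe : p e != p i by exact: (p_neq).
case: h => h; first exact: (reflex_exists gp tri int pe).
apply: (@reflex_exists _ _ _ gp _ _ tri i
  (2 * (p i).1 - (p e).1, 2 * (p i).2 - (p e).2) int).
  apply: contra pe => /eqP; rewrite [p i]surjective_pairing [p e]surjective_pairing /=.
  by case=> e1 e2; apply/eqP; congr pair; lra.
move=> j ij; have := h j ij.
have -> : orient (p i) (2 * (p i).1 - (p e).1, 2 * (p i).2 - (p e).2) (p j) =
  - orient (p i) (p e) (p j) by rewrite /orient /=; ring.
by rewrite oppr_ge0.
Qed.

(** Without edges to the left, to the right or across, all edges at [i] lie on
    one side of the line through [i] and respectively the last vertex of the
    other chain, its first vertex, or the next vertex of the chain of [i]. *)
Lemma reflex_if_lacks i : inner_vertex i ->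
  [\/ forall u, ~ left_nbr i u, forall u, ~ right_nbr i u | forall u, ~ cross_nbr i u] ->
  exists2 s, s \in T & i \in reflex_vertices p s.
Proof.
move=> inn; have /andP[i0 il] := inn.
have oth : ~~ side i != side i by case: (side i).
have sideN z : side z != side i -> side z = ~~ side i.
  by case: (side z) (side i) => -[].
case=> no.
- pose e := at_ (~~ side i) (len (~~ side i)).
  have se : side e = ~~ side i by exact: side_at.
  have pe : pos e = len (~~ side i) by exact: pos_at.
  apply: (@reflex_of_halfplane i e inn); first by apply/eqP => h; move: oth; rewrite -se h eqxx.
  left=> j ij; have [h|[_ sj pj]|[_ sj]] := nbr_cases ij; first by case: (no j).
    have : orient (p i) (p j) (p e) < 0 by apply: orient_opp; rewrite ?se.
    by rewrite /orient; lra.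
  have sj' := sideN _ sj.
  have [->|je] := eqVneq j e; first by rewrite orient_abb.
  have : orient (p j) (p e) (p i) < 0.
    apply: orient_opp; rewrite ?se ?pe ?sj'//; first by rewrite eq_sym.
    rewrite ltn_neqAle -sj' pos_len andbT; apply: contra je => /eqP h.
    by apply/eqP/pos_inj; rewrite ?se ?pe ?h ?sj'.
  by rewrite /orient; lra.
- pose e := at_ (~~ side i) 0.
  have se : side e = ~~ side i by exact: side_at.
  have pe : pos e = 0%N by exact: pos_at.
  apply: (@reflex_of_halfplane i e inn); first by apply/eqP => h; move: oth; rewrite -se h eqxx.
  right=> j ij; have [[_ sj pj]|h|[_ sj]] := nbr_cases ij; last 1 first.
  + have sj' := sideN _ sj.
    have [->|je] := eqVneq j e; first by rewrite orient_abb.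
    have : orient (p e) (p j) (p i) < 0.
      apply: orient_opp; rewrite ?se ?pe ?sj'//; first by rewrite eq_sym.
      rewrite lt0n; apply: contra je => /eqP h.
      by apply/eqP/pos_inj; rewrite ?se ?pe ?h ?sj'.
    by rewrite /orient; lra.
  + have : orient (p j) (p i) (p e) < 0 by apply: orient_opp; rewrite ?sj ?se.
    by rewrite /orient; lra.
  + by case: (no j).
pose e := at_ (side i) (pos i).+1.
have se : side e = side i by exact: side_at.
have pe : pos e = (pos i).+1 by exact: pos_at.
apply: (@reflex_of_halfplane i e inn).
  by apply/eqP => h; move: pe; rewrite h => /n_Sn.
left=> j ij; have [[_ sj pj]|[_ sj pj]|h] := nbr_cases ij; last by case: (no j).
  have : 0 < orient (p j) (p i) (p e) by apply: orient_same; rewrite ?sj ?se ?pe ?pj /=.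
  by rewrite /orient; lra.
have [->|je] := eqVneq j e; first by rewrite orient_abb.
apply/ltW/orient_same; rewrite ?sj ?se ?pe ?ltnSn//= ltn_neqAle pj andbT.
by apply: contra je => /eqP h; apply/eqP/pos_inj; rewrite ?sj ?se ?pe.
Qed.

(** If both boundary neighbours of [i] were on the same side of it, the reflex
    turn at [i] would put one of them in the pocket under the edge to the
    other, which is excluded by [pocket_side]. *)
Lemma reflex_two_sided s i : s \in T -> i \in reflex_vertices p s ->
  side (s i) = side i -> side ((s^-1)%g i) = side i ->
  (exists u, left_nbr i u) /\ (exists u, right_nbr i u).
Proof.
move=> sT ri sn sp; have vi := reflexW ri; have sK := cell_polygon tri sT.
have an := adj_next sT vi; have ap := adj_prev sT vi.
have t0 := reflex_turn ri.
have nn : s i != (s^-1)%g i by exact: (next_neq_prev gp sK).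
have [cn|cn|] := nbr_cases an; last by case=> _; rewrite sn eqxx.
  have [cp|cp|] := nbr_cases ap; last by case=> _; rewrite sp eqxx.
    exfalso; case: cn cp => _ _ nl [_ _ pl].
    apply: (@pocket_side s s (fun v => (pos v)%:Z) i) => //.
    - by left.
    - rewrite ltz_nat ltn_neqAle; apply/andP; split.
        by apply: contra nn => /eqP h; apply/eqP/pos_inj; rewrite ?sn ?sp.
      rewrite leqNgt; apply/negP => h.
      have : 0 < orient (p (s i)) (p ((s^-1)%g i)) (p i).
        by apply: orient_same; rewrite ?sn ?sp ?h.
      by move: t0; rewrite /orient; lra.
  by split; [exists (s i)|exists ((s^-1)%g i)].
have [cp|cp|] := nbr_cases ap; last by case=> _; rewrite sp eqxx.
  by split; [exists ((s^-1)%g i)|exists (s i)].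
exfalso; case: cn cp => _ _ nl [_ _ pl].
apply: (@pocket_side s (s^-1)%g (fun v => - (pos v)%:Z) i) => //.
- by right.
- by rewrite invgK.
- rewrite invgK ltrN2 ltz_nat ltn_neqAle; apply/andP; split.
    by apply: contra nn => /eqP h; apply/eqP/pos_inj; rewrite ?sn ?sp ?h.
  rewrite leqNgt; apply/negP => h.
  have : 0 < orient (p i) (p (s i)) (p ((s^-1)%g i)).
    by apply: orient_same; rewrite ?sn ?sp ?h ?nl.
  by move: t0; rewrite /orient; lra.
- by rewrite ltrN2 ltz_nat.
Qed.

Lemma no_cross_two_sided i : inner_vertex i ->
  (forall u, ~ cross_nbr i u) ->
  [/\ exists u, left_nbr i u, exists u, right_nbr i u &
      exists2 s, s \in T & i \in reflex_vertices p s].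
Proof.
move=> inn no; have [s sT ri] := reflex_if_lacks inn (Or33 _ _ no).
have vi := reflexW ri.
have same j : adj T i j -> side j = side i.
  by move=> ij; apply: contrapT => /eqP h; apply: (no j).
have [h1 h2] := reflex_two_sided sT ri (same _ (adj_next sT vi)) (same _ (adj_prev sT vi)).
by split=> //; exists s.
Qed.

Lemma reflex_some_side s i : s \in T -> i \in reflex_vertices p s ->
  (exists u, left_nbr i u) \/ (exists u, right_nbr i u).
Proof.
move=> sT ri; have vi := reflexW ri; have sK := cell_polygon tri sT.
have an := adj_next sT vi; have ap := adj_prev sT vi.
have [h|h|[_ n]] := nbr_cases an; [by left; eexists; exact: h|by right; eexists; exact: h|].
have [h|h|[_ m]] := nbr_cases ap; [by left; eexists; exact: h|by right; eexists; exact: h|].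
have [x [y [b [_ _ _ _ other]]]] := reflex_cell_shape sT ri.
have := next_neq_prev gp sK vi.
rewrite (other _ _ n) ?vertices_s// (other ((s^-1)%g i) _ m) ?vertices_sV//.
by rewrite eqxx.
Qed.

(** In the cell where [z] is reflex, the boundary comes from a left neighbour
    [w] to [z] and goes on to the vertex [b] of the other chain. The vertex
    [w'] before [w] must lie to the right of [z]: a vertex between [w] and [z]
    would lead the boundary backwards into the pocket below the edge from [w]
    to [z], with no way out, and a vertex before [w] would make [w] convex. So
    [w] is joined to both [z] and [w']. *)
Lemma triangle_left_of_reflex z u : inner_vertex z ->
  left_nbr z u -> (forall r, ~ right_nbr z r) ->
  exists x w, [/\ side x = side z, side w = side z, (pos x < pos z < pos w)%N,
    adj T x z & adj T x w].
Proof.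
move=> inn lu nor.
have [s sT rz] := reflex_if_lacks inn (Or32 _ _ nor).
have vz := reflexW rz; have sK := cell_polygon tri sT; have t0 := reflex_turn rz.
have [x [y [b [[xv yv bc] [xs ys bs] /andP[xz zy] same other]]]] :=
  reflex_cell_shape sT rz.
have bv := convexW bc.
have an := adj_next sT vz; have ap := adj_prev sT vz.
have nv : s z \in vertices s by rewrite vertices_s.
have pv : (s^-1)%g z \in vertices s by rewrite vertices_sV.
have nn := next_neq_prev gp sK vz.
have nextb : s z = b.
  have [[_ sn pn]|h|[_ sn]] := nbr_cases an; [|by case: (nor _ h)|exact: other].
  have [[_ sp pp]|h|[_ sp]] := nbr_cases ap; [|by case: (nor _ h)|].
    have [_ [r h]] := reflex_two_sided sT rz sn sp.
    by case: (nor r h).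
  exfalso.
  have : orient (p (s z)) (p z) (p ((s^-1)%g z)) < 0 by apply: orient_opp; rewrite ?sn.
  by move: t0; rewrite /orient; lra.
set w := (s^-1)%g z in pv ap nn t0 *.
have sw : side w = side z.
  apply: contrapT => /eqP h; move: nn; rewrite nextb (other w pv h) eqxx.
  by [].
have wz : (pos w < pos z)%N.
  by have [[]//|h|[_ h]] := nbr_cases ap; [case: (nor _ h)|move: h; rewrite sw eqxx].
have swE : s w = z by rewrite /w permKV.
set w' := (s^-1)%g w.
have sw'E : s w' = w by rewrite /w' permKV.
have wv' : w' \in vertices s by rewrite /w' vertices_sV.
have zb : z != b by apply: contraNneq bs => <-.
have wb : w != b by apply: contraNneq bs => <-; rewrite sw.
have w'z : w' != z by apply: contraNneq wb => h; rewrite -nextb -h sw'E.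
have w'w : w' != w by rewrite eq_sym; move: wv'; rewrite inE sw'E.
have ww' : adj T w w'.
  by apply: (edge_adj sT); [rewrite eq_sym|right].
have w'b : w' != b.
  apply/eqP => e.
  have : y \in [set w; z; b]%SET.
    apply: (closed_vertices sT vz) => //; first by rewrite !inE eqxx orbT.
    move=> v; rewrite !inE => /orP[/orP[/eqP->|/eqP->]|/eqP->].
    - by rewrite swE eqxx orbT.
    - by rewrite nextb eqxx !orbT.
    - by rewrite -e sw'E eqxx.
  rewrite !inE => /orP[/orP[/eqP h|/eqP h]|/eqP h].
  - by move: zy; rewrite h ltnNge (ltnW wz).
  - by move: zy; rewrite h ltnn.
  - by move: bs; rewrite -h ys eqxx.
have sw' : side w' = side z.
  by apply: contrapT => /eqP h; move: w'b; rewrite (other w' wv' h) eqxx.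
have [zw'|w'z'|e] := ltngtP (pos z) (pos w').
- by exists w, w'; rewrite sw sw' wz zw'; split=> //; rewrite adj_sym.
- exfalso; have [ww|ww|e] := ltngtP (pos w) (pos w').
  (* The vertices in the pocket are closed under going backwards, but [z] is
     not among them. *)
  + pose Z := [set v in vertices s | [&& side v == side z, pos w < pos v & pos v < pos z]%N]%SET.
    have : z \in Z.
      apply: (closedV_vertices sT wv') => //.
        by rewrite inE wv' sw' eqxx ww.
      move=> v; rewrite inE => /and4P[vv /eqP sv wv vz'].
      set v' := (s^-1)%g v.
      have sv'E : s v' = v by rewrite /v' permKV.
      have vv' : v' \in vertices s by rewrite /v' vertices_sV.
      have v'v : v' != v by rewrite eq_sym; move: vv'; rewrite inE sv'E.
      have v'b : v' != b.
        apply/eqP => e.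
        have bt : 0 < turn p s b by move: bc; rewrite inE => /andP[].
        have : 0 < orient (p z) (p b) (p v).
          have -> : z = (s^-1)%g b by rewrite -nextb permK.
          have -> : v = s b by rewrite -e.
          exact: bt.
        have : orient (p v) (p z) (p b) < 0 by apply: orient_opp => //; rewrite sv.
        by rewrite /orient; lra.
      have sv' : side v' = side z.
        by apply: contrapT => /eqP h; move: v'b; rewrite (other v' vv' h) eqxx.
      have v'w : v' != w.
        apply/eqP => e; move: vz'; rewrite -sv'E e swE ltnn; by [].
      have v'z : v' != z.
        apply/eqP => e; have bE : b = v by rewrite -nextb -sv'E e.
        by move: bs; rewrite bE sv eqxx.
      have avv : adj T v v' by apply: (edge_adj sT); [rewrite eq_sym|right].
      rewrite inE vv' sv' eqxx /=; apply/andP; split.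
        rewrite ltnNge; apply/negP => h.
        have h' : (pos v' < pos w)%N.
          rewrite ltn_neqAle h andbT; apply: contra v'w => /eqP e.
          by apply/eqP/pos_inj; rewrite ?sv' ?sw.
        have av'v : adj T v' v by rewrite adj_sym.
        have awz : adj T w z by rewrite adj_sym.
        apply: (same_side_noncrossing _ _ _ av'v awz h' wv vz').
        * by rewrite sv sv'.
        * by rewrite sw sv'.
        * by rewrite sv'.
      rewrite ltnNge; apply/negP => h.
      have h' : (pos z < pos v')%N.
        rewrite ltn_neqAle h andbT; apply: contra v'z => /eqP e.
        by apply/eqP/pos_inj; rewrite ?sv'.
      have awz : adj T w z by rewrite adj_sym.
      by apply: (same_side_noncrossing _ _ _ awz avv wv vz' h'); rewrite ?sw ?sv ?sv'.
    by rewrite inE ltnn !andbF.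
  + have rw : w \in reflex_vertices p s.
      have [bw hw] := same w pv sw.
      have [bw' _] := same w' wv' sw'.
      apply: hw; apply/eqP => e.
        by move: bw'; rewrite -e leqNgt ww.
      by move: zy; rewrite -e ltnNge (ltnW wz).
    have := reflex_turn rw; rewrite swE -/w'.
    have : 0 < orient (p w') (p w) (p z) by apply: orient_same; rewrite ?sw' ?sw ?ww ?wz.
    lra.
  + by move: w'w => /eqP; apply; apply: pos_inj; rewrite ?sw ?sw'.
- by exfalso; move: w'z => /eqP; apply; apply: pos_inj; rewrite ?sw'.
Qed.

(** A vertex on the other chain would add a fourth convex vertex to [z] and
    the two extreme vertices on its chain. So all vertices are on one chain,
    all are convex, and there are three of them. *)
Lemma convex_cell_triangle s z : s \in T -> z \in convex_vertices p s ->
  side (s z) = side z -> side ((s^-1)%g z) = side z ->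
  (pos ((s^-1)%g z) < pos z < pos (s z))%N -> s (s z) = (s^-1)%g z.
Proof.
move=> sT zc sn sp /andP[pz zn]; have vz := convexW zc.
have sK := cell_polygon tri sT.
have nv : s z \in vertices s by rewrite vertices_s.
have pv : (s^-1)%g z \in vertices s by rewrite vertices_sV.
have one v : v \in vertices s -> side v = side z.
  move=> vv; apply: contrapT => /eqP vz'; have zv : side z != side v by rewrite eq_sym.
  have [x [xv xs xm]] := cell_min vz; have [y [yv ys ym]] := cell_max vz.
  have [b1 [b1v b1s b1m]] := cell_min vv.
  have [b2 [b2v b2s b2m]] := cell_max vv.
  have [cx _] : (x \in convex_vertices p s) * (b2 \in convex_vertices p s).
    by apply: (extremes_convex); rewrite ?xs ?b2s.
  have [cb cy] : (b1 \in convex_vertices p s) * (y \in convex_vertices p s).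
    by apply: (extremes_convex); rewrite ?b1s ?ys.
  have hx := xm _ pv sp; have hy := ym _ nv sn.
  have xz : (pos x < pos z)%N by exact: leq_ltn_trans hx pz.
  have zy : (pos z < pos y)%N by exact: leq_trans zn hy.
  have n1 : x != z by apply: contraTneq xz => ->; rewrite ltnn.
  have n2 : z != y by apply: contraTneq zy => ->; rewrite ltnn.
  have n3 : x != y by apply: contraTneq (ltn_trans xz zy) => ->; rewrite ltnn.
  have nb t : side t = side z -> t != b1.
    by move=> st; apply: contraNneq vz' => h; rewrite -b1s -h st.
  have := @uniq_leq_card _ [:: x; z; y; b1] (convex_vertices p s).
  rewrite (card_convex sT) /= !in_cons !in_nil !orbF !negb_or n1 n2 n3 !nb//=.
  by rewrite cx zc cy cb => /(_ isT isT).
have conv v : v \in vertices s -> v \in convex_vertices p s.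
  move=> vv; apply: (one_sided_convex) => // t tv.
  by rewrite (one t tv) (one v vv).
have nn := next_neq_prev gp sK vz.
have nz : s z != z by move: vz; rewrite inE.
have pz' : (s^-1)%g z != z by exact: prev_neq vz.
have := @uniq_card_mem _ [:: z; s z; (s^-1)%g z] (convex_vertices p s) (s (s z)).
rewrite (card_convex sT) /= !in_cons !in_nil !orbF !negb_or.
rewrite eq_sym nz eq_sym pz' nn !conv//= => [|]; last by rewrite vertices_s.
move=> /(_ isT isT erefl isT) /or3P[/eqP h|/eqP h|/eqP//].
  by have := no_two_cycle gp sK vz; rewrite h eqxx.
by move: nz; have /perm_inj-> := h; rewrite eqxx.
Qed.

(** The case without right neighbours is [triangle_left_of_reflex]. Otherwise
    take the farthest one, [r]. The cell above the edge from [z] to [r] is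
    convex at [z] because of the left neighbour [u], and its other edge at [z]
    goes to the left by the choice of [r]; so this cell is a triangle. *)
Lemma triangle_above z u : inner_vertex z -> left_nbr z u ->
  exists x w, [/\ side x = side z, side w = side z, (pos x < pos z < pos w)%N,
    adj T x z & adj T x w].
Proof.
move=> inn lu.
have [nor|[r0 hr0]] : (forall r, ~ right_nbr z r) \/ exists r, right_nbr z r.
  by have [|h] := pselect (exists r, right_nbr z r); [right|left=> r hr; apply: h; exists r].
  exact: triangle_left_of_reflex inn lu nor.
have Pr0 : [&& adj T z r0, side r0 == side z & pos z < pos r0]%N.
  by case: hr0 => -> -> ->; rewrite eqxx.
case: (@arg_maxnP _ r0 (fun r => [&& adj T z r, side r == side z & pos z < pos r]%N) pos Pr0).
move=> r /and3P[zr /eqP sr pr] rmax.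
case: lu => zu su pu.
have o1 : 0 < orient (p z) (p r) (p u).
  have : 0 < orient (p u) (p z) (p r) by apply: orient_same; rewrite ?su ?sr ?pu.
  by rewrite /orient; lra.
have [s sT [vz sz]] := directed_edge gp tri zr o1.
have sK := cell_polygon tri sT.
have ap := adj_prev sT vz.
set k := (s^-1)%g z in ap.
have t0 : 0 < turn p s z.
  have := turn_neq0 gp sK vz; rewrite neq_lt => /orP[t0|//].
  have := adj_notin_sector gp tri sT vz zu.
  by rewrite /sector !mul1r (lt_gtF t0) sz o1.
have sk : side k = side z.
  apply: contrapT => /eqP h.
  have : orient (p z) (p r) (p k) < 0 by apply: orient_opp; rewrite ?sr.
  by move: t0; rewrite /turn sz -/k /orient; lra.
have kr : k != r by rewrite -sz eq_sym; exact: (next_neq_prev gp sK vz).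
have kz : (pos k < pos z)%N.
  have [[]//|[_ _ h]|[_ h]] := nbr_cases ap; last by move: h; rewrite sk eqxx.
  exfalso; have := rmax k; rewrite ap sk eqxx h => /(_ isT) kr'.
  have kr'' : (pos k < pos r)%N.
    rewrite ltn_neqAle (kr' : pos k <= pos r)%N andbT; apply: contra kr => /eqP e.
    by apply/eqP/pos_inj; rewrite ?sk ?sr.
  have : 0 < orient (p z) (p k) (p r) by apply: orient_same; rewrite ?sk ?sr ?h.
  by move: t0; rewrite /turn sz -/k /orient; lra.
have zc : z \in convex_vertices p s by rewrite inE vz.
have sE : s r = k.
  by rewrite -sz; apply: convex_cell_triangle; rewrite ?sz ?sr -/k ?sk ?kz.
exists k, r; rewrite sk sr kz pr; split=> //; first by rewrite adj_sym.
by apply: (edge_adj sT); [|right].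
Qed.

(** The cell to one side of a cross edge has a single vertex on one of the
    chains, so its boundary returns to this vertex by another cross edge,
    which the convexity of the cell there places on the expected side. *)
Lemma cross_step u v : adj T u v -> side u != side v ->
  (pos u < len (side u))%N || (0 < pos v)%N ->
  (exists u', [/\ adj T u' v, side u' = side u & (pos u < pos u')%N]) \/
  (exists v', [/\ adj T u v', side v' = side v & (pos v' < pos v)%N]).
Proof.
move=> uv suv h.
have svu : side v != side u by rewrite eq_sym.
have [e oe] : exists e, 0 < orient (p u) (p v) (p e).
  move: h => /orP[h|h].
    exists (at_ (side u) (len (side u))).
    have : orient (p u) (p (at_ (side u) (len (side u)))) (p v) < 0.
      by apply: orient_opp; rewrite ?side_at ?pos_at.
    by rewrite /orient; lra.
  exists (at_ (side v) 0).
  have : orient (p (at_ (side v) 0)) (p v) (p u) < 0.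
    by apply: orient_opp; rewrite ?side_at ?pos_at.
  by rewrite /orient; lra.
have [s sT [vu sE]] := directed_edge gp tri uv oe.
have sK := cell_polygon tri sT.
have vv : v \in vertices s by rewrite -sE vertices_s.
have sideN z c : side z != c -> side z = ~~ c by case: (side z) c => -[].
have [only|only] := single_side sT vu vv suv.
  right; pose v' := (s^-1)%g u.
  have v'v : v' \in vertices s by rewrite vertices_sV.
  have v'u : v' != u by exact: prev_neq vu.
  have sv' : side v' = side v.
    rewrite (sideN v (side u))//; apply: sideN.
    by apply: contra v'u => /eqP e'; apply/eqP/only.
  have ne : v != v' by rewrite -sE; exact: (next_neq_prev gp sK vu).
  exists v'; split=> //; first exact: adj_prev.
  have uc : u \in convex_vertices p s.
    have [u1 [u1v u1s u1m]] := cell_min vu.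
    have [v2 [v2v v2s v2m]] := cell_max vv.
    have -> : u = u1 by rewrite (only u1).
    have [//] : (u1 \in convex_vertices p s) * (v2 \in convex_vertices p s).
    by apply: (extremes_convex sT u1v v2v); rewrite ?u1s ?v2s.
  have : 0 < orient (p v') (p u) (p v) by move: uc; rewrite inE /turn sE => /andP[].
  rewrite ltnNge => o; apply/negP => le.
  have lt : (pos v < pos v')%N.
    rewrite ltn_neqAle le andbT; apply: contra ne => /eqP e'.
    by apply/eqP/pos_inj; rewrite ?sv'.
  have : orient (p v) (p v') (p u) < 0 by apply: orient_opp.
  by move: o; rewrite /orient; lra.
left; pose u' := s v.
have u'v : u' \in vertices s by rewrite vertices_s.
have u'n : u' != v by move: vv; rewrite inE.
have su' : side u' = side u.
  rewrite (sideN u (side v))//; apply: sideN.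
  by apply: contra u'n => /eqP e'; apply/eqP/only.
have prevv : (s^-1)%g v = u by rewrite -sE permK.
have ne : u' != u by rewrite -prevv; exact: (next_neq_prev gp sK vv).
exists u'; split=> //; first by rewrite adj_sym; exact: adj_next.
have vc : v \in convex_vertices p s.
  have [u1 [u1v u1s u1m]] := cell_max vu.
  have [v2 [v2v v2s v2m]] := cell_min vv.
  have -> : v = v2 by rewrite (only v2).
  have [//] : (v2 \in convex_vertices p s) * (u1 \in convex_vertices p s).
  by apply: (extremes_convex sT v2v u1v); rewrite ?u1s ?v2s.
have : 0 < orient (p u) (p v) (p u').
  by move: vc; rewrite inE /turn prevv => /andP[].
rewrite ltnNge => o; apply/negP => le.
have lt : (pos u' < pos u)%N.
  rewrite ltn_neqAle le andbT; apply: contra ne => /eqP e'.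
  by apply/eqP/pos_inj; rewrite ?su'.
have : orient (p u') (p u) (p v) < 0 by apply: orient_opp; rewrite ?su'.
by move: o; rewrite /orient; lra.
Qed.

End Triangulated.

(** * The code of a pseudo-triangulation *)

Section Coding.
Variable U : {set I}.
Implicit Types (i j k : nat) (T : {set {perm I}}).

Definition same_graph c T : rel nat :=
  fun i j => [&& (i < j)%N, (j <= len c)%N & adj T (at_ c i) (at_ c j)].
Definition cross_rel c T : rel nat :=
  fun i j => [&& (i <= len c)%N, (j <= len (~~ c))%N & adj T (at_ c i) (at_ (~~ c) j)].
Definition crossed T v : bool := [exists u, adj T v u && (side u != side v)].
Definition many_crossed T v : bool :=
  [exists u, [exists u', [&& u != u', adj T v u, side u != side v, adj T v u' &
    side u' != side v]]].
(** Expressed by [U] and [crossed] alone, so that it agrees for two pseudo-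
    triangulations with the same pointed vertices and the same crossed
    vertices. *)
Definition one_sided T c : pred nat :=
  fun k => (at_ c k \in U) && crossed T (at_ c k).

Lemma same_graph_left c T z u : (z <= len c)%N -> left_nbr T (at_ c z) u ->
  same_graph c T (pos u) z.
Proof.
move=> zc [zu su pu]; rewrite side_at// in su; rewrite pos_at// in pu.
by rewrite /same_graph pu zc adj_sym -su atK /= su.
Qed.

Lemma same_graph_right c T z u : (z <= len c)%N -> right_nbr T (at_ c z) u ->
  same_graph c T z (pos u).
Proof.
move=> zc [zu su pu]; rewrite side_at// in su; rewrite pos_at// in pu.
by rewrite /same_graph pu -su atK pos_len su.
Qed.

Lemma left_same_graph c T z i : same_graph c T i z -> left_nbr T (at_ c z) (at_ c i).
Proof.
move=> /and3P[iz zc a]; have ic := leq_trans (ltnW iz) zc.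
by split; rewrite ?side_at ?pos_at// adj_sym.
Qed.

Lemma right_same_graph c T z i : same_graph c T z i -> right_nbr T (at_ c z) (at_ c i).
Proof.
move=> /and3P[iz zc a]; have ic := leq_trans (ltnW iz) zc.
by split; rewrite ?side_at ?pos_at.
Qed.

Section One.
Variables (T : {set {perm I}}) (K : {perm I} -> set (plane R)).
Hypothesis tri : cell_family p T K.
Hypothesis pointedU : forall v, inner_vertex v ->
  (exists2 s, s \in T & v \in reflex_vertices p s) <-> v \in U.

Lemma crossedP v : reflect (exists u, cross_nbr T v u) (crossed T v).
Proof.
apply: (iffP existsP) => [[u /andP[h1 h2]]|[u [h1 h2]]]; exists u; first by split.
by rewrite h1 h2.
Qed.

Lemma inner_at c z : (0 < z < len c)%N -> inner_vertex (at_ c z).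
Proof.
move=> /andP[z0 zc]; have zc' := ltnW zc.
by rewrite /inner_vertex side_at// pos_at// z0.
Qed.

Lemma same_graph_chain c : chain_graph (len c) (one_sided T c) (same_graph c T).
Proof.
split.
- by move=> i j /and3P[-> ->].
- move=> a b d e ab bd de /and3P[_ h1 h2] /and3P[_ h3 h4].
  have [h5 h6] : (a <= len c)%N /\ (b <= len c)%N.
    by split; apply: ltnW; [exact: leq_trans (ltn_trans ab bd) h1|exact: leq_trans bd h1].
  by apply: (same_side_noncrossing tri _ _ _ h2 h4);
    rewrite ?side_at ?pos_at.
- move=> z inn; have zc : (z <= len c)%N by case/andP: inn => _ /ltnW.
  have inn' := inner_at inn.
  move=> /andP[/(pointedU inn')[s sT rs] /crossedP[b hb]]; split.
    move=> [u hu] [w hw].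
    exact: (reflex_not_both tri sT rs (left_same_graph hu) (right_same_graph hw) hb).
  have [[u hu]|[u hu]] := reflex_some_side tri sT rs.
    by left; exists (pos u); exact: same_graph_left.
  by right; exists (pos u); exact: same_graph_right.
- move=> z inn; have zc : (z <= len c)%N by case/andP: inn => _ /ltnW.
  have inn' := inner_at inn; move=> nB.
  suff [[u hu] [w hw]] : (exists u, left_nbr T (at_ c z) u) /\
      (exists u, right_nbr T (at_ c z) u).
    split; first by exists (pos u); exact: same_graph_left.
    by exists (pos w); exact: same_graph_right.
  have [/crossedP cr|ncr] := boolP (crossed T (at_ c z)).
    have nU : at_ c z \notin U.
      by apply: contra nB => h; rewrite /one_sided h; apply/crossedP.
    have nor : ~ exists2 s, s \in T & at_ c z \in reflex_vertices p s.
      by move=> /(pointedU inn') h; rewrite h in nU.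
    split; apply: contrapT => no; apply: nor; apply: (reflex_if_lacks tri inn').
      by constructor 1 => u hu; apply: no; exists u.
    by constructor 2 => u hu; apply: no; exists u.
  have [] := no_cross_two_sided tri inn'; last by [].
  by move=> u hu; move/negP: ncr; apply; apply/crossedP; exists u.
- move=> z u inn hu; have zc : (z <= len c)%N by case/andP: inn => _ /ltnW.
  have [x [w [sx sw /andP[h1 h2] a1 a2]]] :=
    triangle_above tri (inner_at inn) (left_same_graph hu).
  rewrite side_at// in sx sw; rewrite pos_at// in h1 h2.
  have aw : at_ c (pos w) = w by rewrite -sw atK.
  have ax : at_ c (pos x) = x by rewrite -sx atK.
  exists (pos x), (pos w); split=> //; rewrite /same_graph ax ?aw ?a1 ?a2 ?h1 ?zc//.
  by rewrite (ltn_trans h1 h2) -sw pos_len.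
Qed.

Lemma cross_rel_graph c : cross_graph (len c) (len (~~ c)) (cross_rel c T).
Proof.
have ncc : ~~ c != c by case: c.
have onside v c' : side v = c' -> at_ c' (pos v) = v by move=> <-.
split.
- by move=> i j /and3P[-> ->].
- move=> i j i' j' /and3P[h1 h2 h3] /and3P[h4 h5 h6] ii jj.
  by apply: (cross_noncrossing tri _ _ _ h3 h6); rewrite ?side_at ?pos_at.
- move=> i j /and3P[h1 h2 h3] h.
  have [||[u [uv su pu]]|[v [uv sv pv]]] := cross_step tri h3.
  + by rewrite !side_at// eq_sym.
  + by rewrite side_at// !pos_at.
  + rewrite side_at// in su; rewrite pos_at// in pu.
    by left; exists (pos u); rewrite /cross_rel (onside u c su) uv h2 -{1}su pos_len.
  + rewrite side_at// in sv; rewrite pos_at// in pv.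
    by right; exists (pos v); rewrite /cross_rel (onside v _ sv) uv h1 -{1}sv pos_len.
move=> i j /and3P[h1 h2 h3] h; rewrite adj_sym in h3.
have [||[u [uv su pu]]|[v [uv sv pv]]] := cross_step tri h3.
+ by rewrite !side_at.
+ by rewrite side_at// !pos_at// orbC.
+ rewrite side_at// in su; rewrite pos_at// in pu.
  by right; exists (pos u); rewrite /cross_rel (onside u _ su) adj_sym uv h1 -{1}su pos_len.
rewrite side_at// in sv; rewrite pos_at// in pv.
by left; exists (pos v); rewrite /cross_rel (onside v c sv) adj_sym uv h2 -{1}sv pos_len.
Qed.

Lemma cross_nbr_rel c i u : (i <= len c)%N -> cross_nbr T (at_ c i) u ->
  at_ (~~ c) (pos u) = u /\ cross_rel c T i (pos u).
Proof.
move=> ic [iu su]; rewrite side_at// in su.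
have su' : side u = ~~ c by move: su; case: (side u); case: (c).
have e : at_ (~~ c) (pos u) = u by rewrite -su'.
by rewrite /cross_rel e iu ic -{1}su' pos_len.
Qed.

Lemma rel_cross_nbr c i j : cross_rel c T i j -> cross_nbr T (at_ c i) (at_ (~~ c) j).
Proof. by move=> /and3P[h1 h2 h3]; split; rewrite ?side_at//; case: (c). Qed.

Lemma has_cross_rel c i : has_cross (cross_rel c T) i <->
  (i <= len c)%N /\ crossed T (at_ c i).
Proof.
split=> [[j h]|[ic /crossedP[u /(cross_nbr_rel ic)[_ h]]]]; last by exists (pos u).
split; first by case/and3P: h.
by apply/crossedP; exists (at_ (~~ c) j); exact: rel_cross_nbr.
Qed.

Lemma many_cross_rel c i : many_cross (cross_rel c T) i <->
  (i <= len c)%N /\ many_crossed T (at_ c i).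
Proof.
split=> [[j [k [jk hj hk]]]|[ic /existsP[u /existsP[w /and5P[uw h1 h2 h3 h4]]]]].
  have [ic jc _] := and3P hj; have [_ kc _] := and3P hk.
  split=> //; apply/existsP; exists (at_ (~~ c) j); apply/existsP; exists (at_ (~~ c) k).
  have [a1 a2] := rel_cross_nbr hj; have [a3 a4] := rel_cross_nbr hk.
  rewrite a1 a2 a3 a4 !andbT; apply: contra jk => /eqP e.
  by rewrite -(pos_at jc) -(pos_at kc) e.
have [e1 r1] := cross_nbr_rel ic (conj h1 h2).
have [e2 r2] := cross_nbr_rel ic (conj h3 h4).
exists (pos u), (pos w); split=> //; apply: contra uw => /eqP e.
by rewrite -e1 -e2 e.
Qed.

Definition ends : {set I} := [set v | (pos v == 0)%N || (pos v == len (side v))]%SET.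

(** An inner vertex without cross edges is pointed, since all its edges lie in
    a half plane. *)
Lemma uncrossed_mem v : ~~ crossed T v -> v \in U :|: ends.
Proof.
move=> nc; rewrite !inE; have [//|] := boolP (v \in U) => nU /=.
apply: contraT; rewrite negb_or => /andP[v0 vl].
have inn : inner_vertex v by rewrite /inner_vertex lt0n v0 ltn_neqAle vl pos_len.
have [|_ _ /(pointedU inn)] := no_cross_two_sided tri inn; last by rewrite (negbTE nU).
by move=> u hu; move/negP: nc; apply; apply/crossedP; exists u.
Qed.

Definition degree_code c : seq nat :=
  mkseq (fun j => (left_degree (same_graph c T) j.+1 -
    forced_edge (len c) (one_sided T c) j.+1)%N) (len c).

(** The forced edges are subtracted because they make up the whole excess over
    one edge per vertex in [left_degree_sum]. *)
Lemma degree_code_ballot c : degree_code c \in ballots (len c) 0.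
Proof.
apply: ballotsP; first by rewrite size_mkseq.
move=> i ic; have cg := same_graph_chain c.
have := left_degree_sum cg ic.
rewrite big_ord_recl {1}/left_degree big_ord0 add0n big_split /= sum1_card card_ord.
rewrite /degree_code -map_take take_iota (minn_idPl ic) sumnE big_map.
have -> : iota 0 i = index_iota 0 i by rewrite /index_iota subn0.
rewrite big_mkord => h.
have : (\sum_(j < i) (left_degree (same_graph c T) j.+1 -
    forced_edge (len c) (one_sided T c) j.+1) +
    \sum_(j < i) forced_edge (len c) (one_sided T c) j.+1 <=
    i + \sum_(j < i) forced_edge (len c) (one_sided T c) j.+1)%N.
  apply: leq_trans h; rewrite -big_split /=; apply: leq_sum => j _.
  rewrite subnK//; apply: (forced_edge_le cg).
  exact: leq_trans (ltn_ord j) ic.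
by rewrite leq_add2r.
Qed.

End One.

Definition pointed_as T : Prop := forall v, inner_vertex v ->
  (exists2 s, s \in T & v \in reflex_vertices p s) <-> v \in U.

Lemma cross_rel_flip c T :
  (fun i j => cross_rel c T j i) = cross_rel (~~ c) T.
Proof.
apply/funext => i; apply/funext => j; rewrite /cross_rel negbK adj_sym.
by rewrite andbCA.
Qed.

Lemma code_injective T T' K K' : cell_family p T K -> cell_family p T' K' ->
  pointed_as T -> pointed_as T' ->
  (forall v, crossed T v = crossed T' v) ->
  (forall v, crossed T v -> many_crossed T v = many_crossed T' v) ->
  (forall c, degree_code T c = degree_code T' c) -> T = T'.
Proof.
move=> tri tri' pU pU' cE mE dE.
have m_c S v : many_crossed S v -> crossed S v.
  move=> /existsP[u /existsP[w /and5P[_ h1 h2 _ _]]].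
  by apply/existsP; exists u; rewrite h1 h2.
have {}mE v : many_crossed T v = many_crossed T' v.
  have [/mE//|nc] := boolP (crossed T v).
  have nc' : ~~ crossed T' v by rewrite -cE.
  by rewrite (negbTE (contra (@m_c T v) nc)) (negbTE (contra (@m_c T' v) nc')).
have BE c : one_sided T c = one_sided T' c.
  by apply/funext => k; rewrite /one_sided cE.
have sameE c i j : same_graph c T i j = same_graph c T' i j.
  have cg := same_graph_chain tri pU c.
  have cg' := same_graph_chain tri' pU' c.
  rewrite -BE in cg'.
  apply: (left_degree_determines cg cg') => -[_|k kN].
    by rewrite /left_degree !big_ord0.
  have := congr1 (fun q => nth 0%N q k) (dE c).
  rewrite /degree_code !nth_mkseq// -BE.
  have := forced_edge_le cg kN; have := forced_edge_le cg' kN; lia.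
have crossE i j : cross_rel true T i j = cross_rel true T' i j.
  apply: (cross_determines (cross_rel_graph tri true)
                           (cross_rel_graph tri' true)) => k.
  - by rewrite !(has_cross_rel) cE.
  - by rewrite !cross_rel_flip !(has_cross_rel) cE.
  - by rewrite !(many_cross_rel) mE.
  - by rewrite !cross_rel_flip !(many_cross_rel) mE.
have adjE x y : adj T x y = adj T' x y.
  have [sxy|sxy] := eqVneq (side x) (side y).
    wlog le : x y sxy / (pos x <= pos y)%N.
      move=> wl; have [/wl->//|/ltnW/wl h] := leqP (pos x) (pos y).
      by rewrite adj_sym h// adj_sym.
    have [lt|ge] := ltnP (pos x) (pos y).
      have := sameE (side x) (pos x) (pos y).
      by rewrite /same_graph lt sxy pos_len atK -{1 2}sxy atK.
    have -> : x = y by apply: (pos_inj sxy); apply/eqP; rewrite eqn_leq le.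
    by rewrite /adj eqxx.
  wlog sx : x y sxy / side x = true.
    move=> wl; have [sx|sx] := boolP (side x); first exact: wl.
    rewrite adj_sym (adj_sym T'); apply: wl; first by rewrite eq_sym.
    by move: sxy sx; case: (side x); case: (side y).
  have sy : side y = false by move: sxy; rewrite sx; case: (side y).
  have := crossE (pos x) (pos y); rewrite /cross_rel /=.
  have := atK x; have := pos_len x; have := atK y; have := pos_len y.
  by rewrite sx sy => -> -> -> ->.
apply/eqP; rewrite finset.eqEsubset; apply/andP; split.
  exact: (adj_determines_sub gp tri tri' adjE).
by apply: (adj_determines_sub gp tri' tri) => x y; rewrite adjE.
Qed.

Lemma PT_cells T : T \in PT_ p U -> exists K, cell_family p T K.
Proof. by rewrite !inE => /andP[/asboolP[h [K hK]] _]; exists K; split. Qed.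

Lemma PT_pointed T : T \in PT_ p U -> pointed_as T.
Proof.
rewrite inE => /andP[_ /forallP h] v inn.
have int := inner_interior inn.
have := h v; rewrite int /= /is_pointed int /= => /eqP <-.
by split=> [[s sT rs]|/existsP[s /andP[sT rs]]]; [apply/existsP; exists s; rewrite sT|exists s].
Qed.

(** A code consists of a mark for each vertex (no cross edge, one, or several)
    and two ballot sequences. The first mark is possible only for a pointed
    vertex or a chain end. *)
Lemma card_PT_le :
  (#|PT_ p U| <= (\prod_(v : I) (if v \in U :|: ends then 3 else 2)) *
    (size (ballots (len true) 0) * size (ballots (len false) 0)))%N.
Proof.
pose F (v : I) : pred (option bool) :=
  if v \in U :|: ends then predT else [pred o | o != None].
pose phi T : {ffun I -> option bool} :=
  [ffun v => if crossed T v then Some (many_crossed T v) else None].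
pose full T := (phi T, (degree_code T true, degree_code T false)).
pose L := [seq (f, q) | f <- enum (family F),
  q <- [seq (q1, q2) | q1 <- ballots (len true) 0, q2 <- ballots (len false) 0]].
have sizeL : size L = ((\prod_(v : I) (if v \in U :|: ends then 3 else 2)) *
    (size (ballots (len true) 0) * size (ballots (len false) 0)))%N.
  rewrite !size_allpairs -cardE card_family; congr (_ * _)%N.
  rewrite foldrE big_map -big_enum /=; apply: eq_bigr => v _.
  rewrite /F; case: ifP => _; first by rewrite card_option card_bool.
  by rewrite (eq_card (B := predC1 None))// cardC1 card_option card_bool.
rewrite -sizeL cardE -(size_map full); apply: uniq_leq_size.
  rewrite map_inj_in_uniq ?enum_uniq// => T T'; rewrite !mem_enum => TP TP' [pE e1 e2].
  have [K tri] := PT_cells TP; have [K' tri'] := PT_cells TP'.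
  have h v := congr1 (fun f : {ffun I -> option bool} => f v) pE.
  apply: (code_injective tri tri' (PT_pointed TP) (PT_pointed TP')).
  - by move=> v; have := h v; rewrite !ffunE; do 2 case: ifP.
  - by move=> v; have := h v; rewrite !ffunE => + cv; rewrite cv; case: ifP => // _ [].
  - by case.
move=> y /mapP[T]; rewrite mem_enum => TP -> {y}.
have [K tri] := PT_cells TP; have pU := PT_pointed TP.
apply/allpairsP; exists (phi T, (degree_code T true, degree_code T false)); split=> //=.
  rewrite mem_enum; apply/familyP => v; rewrite ffunE /F.
  have [//|nv] := boolP (v \in U :|: ends).
  have [//|nc] := boolP (crossed T v).
  by move: nv; rewrite (uncrossed_mem tri pU nc).
apply/allpairsP; exists (degree_code T true, degree_code T false); split=> //;
  exact: (degree_code_ballot tri pU).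
Qed.

End Coding.
End DoubleChain.

(** * Orientations in a double chain *)

Section TwoChains.
Variable R : realType.
Implicit Types (a b c o z P Q : plane R).

Lemma triangleP a b c z : triangle a b c z -> exists u v w : R,
  [/\ 0 <= u, 0 <= v, 0 <= w, u + v + w = 1 &
      forall x y, orient x y z = u * orient x y a + v * orient x y b + w * orient x y c].
Proof.
move=> [w [w0 w1 zE]]; exists (w ord0), (w (lift ord0 ord0)), (w (lift ord0 (lift ord0 ord0))).
split=> //; first by rewrite -w1 !big_ord_recl big_ord0 addr0 addrA.
move=> x y; rewrite zE orient_sum// !big_ord_recl big_ord0 addr0 addrA.
by rewrite !(tnth_nth a).
Qed.

Section OneChain.
Variables (n : nat) (u : 'I_n.+2 -> plane R) (o : plane R).
Let P := u ord0.
Let Q := u ord_max.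
Hypothesis neg : orient P Q o < 0.
Hypothesis tri : forall i, triangle P Q o (u i).

(** Coordinates with respect to the basis [P - o], [Q - o], scaled by the
    determinant of that basis. *)
Let cA z : R := - orient o z Q.
Let cB z : R := - orient o P z.

Let orient_coord x y z : - orient P Q o * orient x y z =
  - ((cA x * cB y - cA y * cB x) + (cA y * cB z - cA z * cB y) +
     (cA z * cB x - cA x * cB z)).
Proof. by rewrite /cA /cB /orient; ring. Qed.

Let coord_bounds i : [/\ 0 <= cA (u i), 0 <= cB (u i) &
  cA (u i) + cB (u i) <= - orient P Q o].
Proof.
have [a [b [c [a0 b0 c0 abc zE]]]] := triangleP (tri i).
have AE : cA (u i) = a * - orient P Q o.
  have := zE Q o; rewrite orient_abb orient_aba !mulr0 !addr0 => h.
  by rewrite /cA (orient_rot Q o (u i)) h /orient; ring.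
have BE : cB (u i) = b * - orient P Q o.
  have := zE o P; rewrite orient_abb orient_aba !mulr0 !addr0 add0r => h.
  by rewrite /cB h; rewrite /orient; ring.
have E0 : 0 <= - orient P Q o by rewrite oppr_ge0 ltW.
rewrite AE BE; split; [by apply: mulr_ge0|by apply: mulr_ge0|].
rewrite -mulrDl -[X in _ <= X]mul1r; apply: ler_wpM2r => //; lra.
Qed.

(** If the chain turned the other way, its inner vertices would lie across the
    line through [P] and [Q], outside the triangle with [o]. *)
Lemma chain_convex : convex_polygon_in_order u ->
  forall i j k : 'I_n.+2, (i < j)%N -> (j < k)%N -> 0 < orient (u i) (u j) (u k).
Proof.
case=> // h i j k ij jk.
have j0 : ((ord0 : 'I_n.+2) < j)%N by exact: leq_ltn_trans ij.
have jm : (j < (ord_max : 'I_n.+2))%N by apply: (leq_trans jk); rewrite -ltnS.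
have := h _ _ _ j0 jm; rewrite -/P -/Q.
have [a [b [c [a0 b0 c0 abc zE]]]] := triangleP (tri j).
have := zE P Q; rewrite orient_abb orient_aba !mulr0 !add0r => e.
have : c * orient P Q o <= 0 by rewrite mulr_ge0_le0// ltW.
by move: e; rewrite /orient; lra.
Qed.

(** Along the chain the first coordinate decreases and the second increases,
    because the chain is convex and stays in the triangle; the points [b] have
    both coordinates nonpositive, and the determinant is then a sum of terms
    of one sign. *)
Lemma chain_opposite : convex_polygon_in_order u ->
  forall (i j : 'I_n.+2) b, (i < j)%N -> 0 <= orient o b Q -> 0 <= orient o P b ->
  orient (u i) (u j) b <= 0.
Proof.
move=> cv i j b ij bQ bP; have E0 : 0 < - orient P Q o by rewrite oppr_gt0.
have [Ai Bi ABi] := coord_bounds i; have [Aj Bj ABj] := coord_bounds j.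
have AP : cA P = - orient P Q o by rewrite /cA /orient; ring.
have BP : cB P = 0 by rewrite /cB orient_abb oppr0.
have AQ : cA Q = 0 by rewrite /cA orient_abb oppr0.
have BQ : cB Q = - orient P Q o by rewrite /cB /orient; ring.
have [mA mB] : cA (u j) <= cA (u i) /\ cB (u i) <= cB (u j).
  have [i0|i0] := eqVneq i ord0.
    by rewrite i0 -/P AP BP; split=> //; lra.
  have [jm|jm] := eqVneq j ord_max.
    by rewrite jm -/Q AQ BQ; split=> //; lra.
  have i0' : ((ord0 : 'I_n.+2) < i)%N by rewrite lt0n.
  have jm' : (j < (ord_max : 'I_n.+2))%N by rewrite ltn_neqAle jm -ltnS ltn_ord.
  have o1 := mulr_gt0 E0 (chain_convex cv i0' ij).
  have o2 := mulr_gt0 E0 (chain_convex cv ij jm').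
  rewrite orient_coord -/P AP BP in o1; rewrite orient_coord -/Q AQ BQ in o2.
  set E := - orient P Q o in E0 ABi ABj o1 o2 *.
  move: (cA (u i)) (cB (u i)) (cA (u j)) (cB (u j)) Ai Bi Aj Bj ABi ABj o1 o2.
  move=> x y x' y' x0 y0 x'0 y'0 h1 h2 o1 o2.
  have k1 : (y - y') * (E - x) < (x' - x) * y by lra.
  have k2 : (x' - x) * (E - y) < (y - y') * x by lra.
  have hy : y <= y'.
    rewrite leNgt; apply/negP => yy.
    have : (y - y') * y <= (y - y') * (E - x) by apply: ler_wpM2l; lra.
    move=> /le_lt_trans/(_ k1) h3.
    have ypos : 0 < y by lra.
    rewrite ltr_pM2r// in h3.
    have : (x' - x) * x <= (x' - x) * (E - y) by apply: ler_wpM2l; lra.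
    move=> /le_lt_trans/(_ k2) h4.
    have [x1|x1] := ltP 0 x; first by rewrite ltr_pM2r// in h4; lra.
    have xx : x = 0 by lra.
    by move: h4; rewrite xx !mulr0 ltxx.
  split=> //; rewrite leNgt; apply/negP => xx.
  have : 0 <= (x' - x) * (E - y) by apply: mulr_ge0; lra.
  have : 0 <= (y' - y) * x by apply: mulr_ge0; lra.
  by lra.
have h1 : 0 <= cA (u i) * cB (u j) - cA (u j) * cB (u i).
  by rewrite subr_ge0; apply: ler_pM.
have h2 : 0 <= (cB (u j) - cB (u i)) * - cA b.
  by apply: mulr_ge0; rewrite ?subr_ge0// /cA opprK.
have h3 : 0 <= (cA (u i) - cA (u j)) * - cB b.
  by apply: mulr_ge0; rewrite ?subr_ge0// /cB opprK.
have := orient_coord (u i) (u j) b.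
rewrite -(pmulr_rle0 _ E0) => ->; lra.
Qed.

End OneChain.

Lemma open_segment_orient a b o : open_segment a b o -> exists2 k : R, 0 < k &
  forall z, orient o b z = - k * orient o a z.
Proof.
move=> /open_segmentP[t [t0 t1 ->]]; exists ((1 - t) / t); first by rewrite divr_gt0 ?subr_gt0.
move=> z; apply: (@mulfI _ t); first by rewrite gt_eqF.
have -> : t * (- ((1 - t) / t) * orient (lerp a b t) a z) =
  - (1 - t) * orient (lerp a b t) a z by field; rewrite gt_eqF.
by rewrite /orient /lerp /=; ring.
Qed.

(** The second chain lies in the angle at [o] opposite to the first one, since
    [o] is on both diagonals. *)
Lemma opposite_chains n m (u : 'I_n.+2 -> plane R) (v : 'I_m.+2 -> plane R) o :
  open_segment (u ord0) (v ord0) o -> open_segment (u ord_max) (v ord_max) o ->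
  orient (u ord0) (u ord_max) o < 0 ->
  (forall i, triangle (u ord0) (u ord_max) o (u i)) ->
  (forall j, triangle (v ord0) (v ord_max) o (v j)) ->
  convex_polygon_in_order u -> convex_polygon_in_order v ->
  [/\ orient (v ord0) (v ord_max) o < 0,
      forall i j k : 'I_n.+2, (i < j)%N -> (j < k)%N -> 0 < orient (u i) (u j) (u k) &
      forall (i j : 'I_n.+2) k, (i < j)%N -> orient (u i) (u j) (v k) <= 0].
Proof.
move=> o1 o2 neg tu tv cu cv.
have [k1 k10 e1] := open_segment_orient o1; have [k2 k20 e2] := open_segment_orient o2.
have negv : orient (v ord0) (v ord_max) o < 0.
  have -> : orient (v ord0) (v ord_max) o = k1 * k2 * orient (u ord0) (u ord_max) o.
    have -> : orient (v ord0) (v ord_max) o = orient o (v ord0) (v ord_max).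
      by rewrite /orient; ring.
    rewrite e1.
    have -> : orient o (u ord0) (v ord_max) = - orient o (v ord_max) (u ord0).
      by rewrite /orient; ring.
    by rewrite e2 /orient; ring.
  by rewrite pmulr_rlt0// mulr_gt0.
split=> //; first exact: (chain_convex neg tu cu).
move=> i j k ij; apply: (chain_opposite neg tu cu ij).
  have [a [b [c [a0 b0 c0 abc zE]]]] := triangleP (tv k).
  have -> : orient o (v k) (u ord_max) = orient (u ord_max) o (v k).
    by rewrite /orient; ring.
  rewrite zE orient_abb mulr0 addr0 addr_ge0// mulr_ge0//.
    have -> : orient (u ord_max) o (v ord0) = orient o (v ord0) (u ord_max).
      by rewrite /orient; ring.
    rewrite e1 mulNr oppr_ge0 pmulr_rle0//.
    have -> : orient o (u ord0) (u ord_max) = orient (u ord0) (u ord_max) o.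
      by rewrite /orient; ring.
    exact: ltW.
  have -> : orient (u ord_max) o (v ord_max) = orient o (v ord_max) (u ord_max).
    by rewrite /orient; ring.
  by rewrite e2 orient_abb mulr0.
have [a [b [c [a0 b0 c0 abc zE]]]] := triangleP (tv k).
rewrite zE orient_aba mulr0 addr0 addr_ge0// mulr_ge0//.
  have -> : orient o (u ord0) (v ord0) = - orient o (v ord0) (u ord0).
    by rewrite /orient; ring.
  by rewrite e1 orient_abb mulr0 oppr0.
have -> : orient o (u ord0) (v ord_max) = - orient o (v ord_max) (u ord0).
  by rewrite /orient; ring.
rewrite e2 mulNr opprK mulr_ge0 ?ltW//.
have -> : orient o (u ord_max) (u ord0) = - orient (u ord0) (u ord_max) o.
  by rewrite /orient; ring.
by rewrite oppr_gt0.
Qed.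

End TwoChains.

Section DoubleChainIsFrame.
Variables (R : realType) (l m : nat).
Notation J := (dc_index l m).
Variable A : J -> plane R.

Definition dc_side (x : J) : bool := if x is inl _ then true else false.
Definition dc_len (c : bool) : nat := if c then l.+1 else m.+1.

Section Order.
(** Each of [s1] and [s2] is the identity or the reversal, according to the
    direction in which the positions have to run on that chain. *)
Variables (s1 : 'I_l.+2 -> 'I_l.+2) (s2 : 'I_m.+2 -> 'I_m.+2).

Definition dc_pos (x : J) : nat :=
  match x with inl i => val (s1 i) | inr j => val (s2 j) end.
Definition dc_at (c : bool) (k : nat) : J :=
  if c then inl (s1 (inord k)) else inr (s2 (inord k)).

Hypothesis s1K : involutive s1.
Hypothesis s2K : involutive s2.

Lemma frame_of_order : general_position A ->
  (forall i j k : 'I_l.+2, (i < j)%N -> (j < k)%N ->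
     0 < orient (A (inl (s1 i))) (A (inl (s1 j))) (A (inl (s1 k)))) ->
  (forall i j k : 'I_m.+2, (i < j)%N -> (j < k)%N ->
     0 < orient (A (inr (s2 i))) (A (inr (s2 j))) (A (inr (s2 k)))) ->
  (forall (i j : 'I_l.+2) k, (i < j)%N ->
     orient (A (inl (s1 i))) (A (inl (s1 j))) (A (inr k)) <= 0) ->
  (forall (i j : 'I_m.+2) k, (i < j)%N ->
     orient (A (inr (s2 i))) (A (inr (s2 j))) (A (inl k)) <= 0) ->
  chain_frame A dc_side dc_pos dc_len dc_at.
Proof.
move=> gp h1 h2 h3 h4; split.
- split.
  + by move=> [i|j] /=; rewrite -ltnS ltn_ord.
  + by move=> [i|j] /=; rewrite inord_val ?s1K ?s2K.
  + by case.
  + by case=> k kl; rewrite /= ?s1K ?s2K inordK.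
  + by case.
- move=> [x|x] [y|y] [z|z] //= _ _ /andP[xy yz].
    by have := h1 _ _ _ xy yz; rewrite !s1K.
  by have := h2 _ _ _ xy yz; rewrite !s2K.
move=> [x|x] [y|y] [z|z] //= _ _ xy.
  rewrite lt_neqAle; have := h3 _ _ z xy; rewrite !s1K => ->; rewrite andbT.
  apply: (orient_neq0 gp) => //; apply/eqP => -[e].
  by move: xy; rewrite e ltnn.
rewrite lt_neqAle; have := h4 _ _ z xy; rewrite !s2K => ->; rewrite andbT.
apply: (orient_neq0 gp) => //; apply/eqP => -[e].
by move: xy; rewrite e ltnn.
Qed.

End Order.

Lemma convex_rev n (t : 'I_n.+2 -> plane R) : convex_polygon_in_order t ->
  convex_polygon_in_order (t \o (@rev_ord n.+2)).
Proof.
have r (i j : 'I_n.+2) : (i < j)%N -> (rev_ord j < rev_ord i)%N.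
  by move=> ij; have := ltn_ord j; move: ij => /=; lia.
case=> h; [right|left] => i j k ij jk /=.
  by have := h _ _ _ (r _ _ jk) (r _ _ ij); rewrite /orient; lra.
by have := h _ _ _ (r _ _ jk) (r _ _ ij); rewrite /orient; lra.
Qed.

Lemma triangle_swap (a b c z : plane R) : triangle a b c z -> triangle b a c z.
Proof.
move=> [w [w0 w1 ->]].
exists (fun i => w (tperm ord0 (lift ord0 ord0) i)); split=> //.
  by rewrite -w1 [RHS](reindex_inj (@perm_inj _ (tperm ord0 (lift ord0 ord0)))).
rewrite !big_ord_recl !big_ord0 !(tnth_nth a) /=.
rewrite tpermL tpermR tpermD//.
by rewrite !addr0 addrCA.
Qed.

(** The labels run in parallel along the two chains, while the positions run
    clockwise around the 4-gon on both; so one chain is reversed, and which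
    one depends on the orientation of the 4-gon. *)
Lemma double_chain_frame : double_chain A ->
  exists pos at_, chain_frame A dc_side pos dc_len at_ /\
  forall x, (pos x == 0%N) || (pos x == dc_len (dc_side x)) =
    match x with inl i => (i == ord0) || (i == ord_max)
               | inr j => (j == ord0) || (j == ord_max) end.
Proof.
move=> [gp cl cm [ o [ o1 o2 tl tm]]].
have rev0 n : rev_ord (ord0 : 'I_n.+2) = ord_max by apply: val_inj; rewrite /= subn1.
have revm n : rev_ord (ord_max : 'I_n.+2) = ord0 by apply: val_inj; rewrite /= subnn.
have ends_id n (i : 'I_n.+2) : (val i == 0%N) || (val i == n.+1) = (i == ord0) || (i == ord_max).
  by [].
have ends_rev n (i : 'I_n.+2) :
    (val (rev_ord i) == 0%N) || (val (rev_ord i) == n.+1) = (i == ord0) || (i == ord_max).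
  have h := ltn_ord i; rewrite -!val_eqE /=.
  by apply/idP/idP => /orP[/eqP e|/eqP e]; apply/orP; [right|left|right|left]; apply/eqP; move: e h => /=; lia.
have osym a b : open_segment a b o -> open_segment b a o.
  move=> /open_segmentP[t [t0 t1 ->]]; apply/open_segmentP; exists (1 - t).
  by split; [lra|lra|rewrite /lerp; congr pair; ring].
have D0 : orient (A (inl ord0)) (A (inl ord_max)) o != 0.
  have [k k0 e] := open_segment_orient (osym _ _ o1).
  apply/eqP => d.
  have [k' k'0 e'] := open_segment_orient o1.
  have z0 : orient o (A (inl ord0)) (A (inl ord_max)) = 0.
    by rewrite -d /orient; ring.
  have z1 : orient o (A (inr ord_max)) (A (inl ord_max)) = 0 by rewrite e' z0 mulr0.
  have := @orient_neq0 _ _ _ gp (inl ord0) (inl ord_max) (inr ord_max) isT isT isT.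
  move=> /eqP; apply.
  move: o1 => /open_segmentP[t [t0 t1 oE]].
  have : t * orient (A (inl ord0)) (A (inl ord_max)) (A (inr ord_max)) = 0.
    move: d; rewrite oE orient_lerp orient_aba mulr0 add0r; exact.
  by move=> /eqP; rewrite mulf_eq0 (gt_eqF t0) => /eqP.
move: D0; rewrite neq_lt => /orP[D|D].
  pose u := A \o inl : 'I_l.+2 -> plane R.
  pose v := A \o inr \o (@rev_ord m.+2) : 'I_m.+2 -> plane R.
  have tv j : triangle (v ord0) (v ord_max) o (v j).
    by rewrite /v /= rev0 revm; exact: triangle_swap.
  have p1 : open_segment (u ord0) (v ord0) o by rewrite /v /= rev0.
  have p2 : open_segment (u ord_max) (v ord_max) o by rewrite /v /= revm.
  have cv : convex_polygon_in_order v by exact: (convex_rev cm).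
  have [D' c1 c2] := opposite_chains p1 p2 D tl tv cl cv.
  have [_ c3 c4] := opposite_chains (osym _ _ p1) (osym _ _ p2) D' tv tl cv cl.
  exists (dc_pos id (@rev_ord m.+2)), (dc_at id (@rev_ord m.+2)); split.
    apply: frame_of_order => //; first exact: rev_ordK.
    by move=> i j k ij; rewrite -[k](@rev_ordK m.+2); exact: c2.
  by move=> [i|j] /=; [exact: ends_id|exact: ends_rev].
pose u := A \o inl \o (@rev_ord l.+2) : 'I_l.+2 -> plane R.
pose v := A \o inr : 'I_m.+2 -> plane R.
have tu j : triangle (u ord0) (u ord_max) o (u j).
  by rewrite /u /= rev0 revm; exact: triangle_swap.
have p1 : open_segment (u ord0) (v ord0) o by rewrite /u /= rev0.
have p2 : open_segment (u ord_max) (v ord_max) o by rewrite /u /= revm.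
have cu : convex_polygon_in_order u by exact: (convex_rev cl).
have Du : orient (u ord0) (u ord_max) o < 0.
  by rewrite /u /= rev0 revm; move: D; rewrite /orient; lra.
have [D' c1 c2] := opposite_chains p1 p2 Du tu tm cu cm.
have [_ c3 c4] := opposite_chains (osym _ _ p1) (osym _ _ p2) D' tm tu cm cu.
exists (dc_pos (@rev_ord l.+2) id), (dc_at (@rev_ord l.+2) id); split.
  apply: frame_of_order => //; first exact: rev_ordK.
  by move=> i j k ij; rewrite -[k](@rev_ordK l.+2); exact: c4.
by move=> [i|j] /=; [exact: ends_rev|exact: ends_id].
Qed.

End DoubleChainIsFrame.

(** * Catalan asymptotics *)

Section Asymptotics.
Variable R : realType.

Definition catalan_scale (n : nat) : R := 4 ^+ n / (n%:R * Num.sqrt n%:R).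

(** From the bounds between [4 ^ n / (2 * sqrt n)] and [4 ^ n / sqrt n] for
    the central binomial coefficient. *)
Lemma catalan_bounds n : (0 < n)%N ->
  catalan_scale n / 4 <= catalan R n <= catalan_scale n.
Proof.
move=> n0; have n0R : 0 < n%:R :> R by rewrite ltr0n.
set r := Num.sqrt (n%:R : R).
have r0 : 0 < r by rewrite sqrtr_gt0.
have rr : r * r = n%:R by rewrite -expr2 sqr_sqrtr// ltW.
set b : R := 'C(2 * n, n)%:R.
have b0 : 0 <= b by rewrite ler0n.
have p0 : 0 < 4 ^+ n :> R by rewrite exprn_gt0.
have e16 : (4 ^+ n * 4 ^+ n : R) = (16 ^ n)%:R.
  by rewrite -exprMn natrX; congr (_ ^+ _); lra.
have lo : 4 ^+ n <= 2 * r * b.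
  rewrite -(@ler_pXn2r _ 2)// ?nnegrE ?mulr_ge0 ?(ltW p0) ?(ltW r0)//.
  rewrite !expr2 e16.
  have -> : 2 * r * b * (2 * r * b) = 4 * (r * r) * (b * b) by ring.
  rewrite rr /b -!natrM ler_nat; exact: central_bin_lower.
have up : r * b <= 4 ^+ n.
  rewrite -(@ler_pXn2r _ 2)// ?nnegrE ?mulr_ge0 ?(ltW p0) ?(ltW r0)//.
  rewrite !expr2 e16.
  have -> : r * b * (r * b) = (r * r) * (b * b) by ring.
  rewrite rr /b -!natrM ler_nat; apply: leq_trans (central_bin_upper n).
  by rewrite leq_mul2r; apply/orP; right; lia.
have n1 : 1 <= n%:R :> R by rewrite ler1n.
rewrite /catalan /catalan_scale -/r -/b -[n.+1]addn1 natrD.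
have nz : n%:R != 0 :> R by rewrite gt_eqF.
have rz : r != 0 by rewrite gt_eqF.
have n1z : n%:R + 1 != 0 :> R by rewrite gt_eqF//; lra.
have den : 0 < n%:R * r * (n%:R + 1) by rewrite !mulr_gt0//; lra.
set x := 4 ^+ n in p0 e16 lo up *; set y := n%:R in n0R rr n1 nz n1z den *.
apply/andP; split; rewrite -subr_ge0.
  have -> : (y + 1)^-1 * b - x / (y * r) / 4 =
      (4 * y * r * b - x * (y + 1)) / (4 * (y * r * (y + 1))).
    by field; rewrite nz rz n1z.
  apply: divr_ge0; last by rewrite mulr_ge0// ltW.
  have : x * (y + 1) <= x * (2 * y) by rewrite ler_pM2l//; lra.
  have : x * (2 * y) <= 2 * r * b * (2 * y) by rewrite ler_wpM2r//; lra.
  lra.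
have -> : x / (y * r) - (y + 1)^-1 * b =
    (x * (y + 1) - y * (r * b)) / (y * r * (y + 1)).
  by field; rewrite nz rz n1z.
apply: divr_ge0; last by rewrite ltW.
have : y * (r * b) <= y * x by rewrite ler_pM2l.
lra.
Qed.

Lemma power_scale (q : R) l m : (0 < l)%N -> (0 < m)%N ->
  (4 * q) ^+ (l + m) * (l * m)%:R `^ (- (3 / 2)) =
  q ^+ (l + m) * catalan_scale l * catalan_scale m.
Proof.
move=> l0 m0.
have l0R : 0 < l%:R :> R by rewrite ltr0n.
have m0R : 0 < m%:R :> R by rewrite ltr0n.
have lm0 : 0 < (l * m)%:R :> R by rewrite natrM mulr_gt0.
have -> : ((l * m)%:R : R) `^ (- (3 / 2)) = (l%:R * Num.sqrt l%:R)^-1 * (m%:R * Num.sqrt m%:R)^-1.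
  rewrite powRN (_ : 3 / 2 = 1 + 2^-1 :> R); last by lra.
  rewrite powRD; last by apply/implyP => _; rewrite gt_eqF.
  rewrite powRr1 ?(ltW lm0)// powR12_sqrt ?(ltW lm0)// natrM sqrtrM ?(ltW l0R)//.
  by rewrite -invfM; congr (_^-1); ring.
by rewrite /catalan_scale exprMn (exprD 4); ring.
Qed.

Lemma same_bigO_catalan (q : R) : 0 < q ->
  same_bigO (fun l m => q ^+ (l + m) * catalan R l * catalan R m)
            (fun l m => (4 * q) ^+ (l + m) * (l * m)%:R `^ (- (3 / 2))).
Proof.
move=> q0; exists 16; first by lra.
move=> l m l0 m0; rewrite power_scale//.
have /andP[a1 a2] := catalan_bounds l0; have /andP[b1 b2] := catalan_bounds m0.
have pos n : 0 <= catalan_scale n.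
  by rewrite /catalan_scale divr_ge0 ?exprn_ge0// mulr_ge0// sqrtr_ge0.
have p1 := pos l; have p2 := pos m.
move: a1 a2 b1 b2 p1 p2.
move: (catalan_scale l) (catalan_scale m) (catalan R l) (catalan R m) => x y a b.
move=> a1 a2 b1 b2 x0 y0.
have Q0 : 0 <= q ^+ (l + m) by rewrite exprn_ge0// ltW.
have a0 : 0 <= a by lra.
have b0 : 0 <= b by lra.
have h1 : a * b <= x * y by apply: ler_pM.
have h2 : (x / 4) * (y / 4) <= a * b by apply: ler_pM => //; lra.
rewrite !ger0_norm ?mulr_ge0// -!mulrA.
move: (q ^+ (l + m)) Q0 => Q Q0.
have : Q * (a * b) <= Q * (x * y) by apply: ler_wpM2l.
have : Q * ((x / 4) * (y / 4)) <= Q * (a * b) by apply: ler_wpM2l.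
have : 0 <= Q * (x * y) by rewrite mulr_ge0// mulr_ge0.
by split; lra.
Qed.

Lemma size_ballots_catalan n : (size (ballots n.+1 0))%:R <= 16 * catalan R n.
Proof.
rewrite /catalan mulrCA mulrC ler_pdivlMr ?ltr0n// -natrM mulnC.
by rewrite -(natrM _ 16) ler_nat; exact: size_ballots_le.
Qed.

Lemma sum_sets_expr n (x : R) : \sum_(V : {set 'I_n}) x ^+ #|V| = (1 + x) ^+ n.
Proof.
rewrite addrC exprD1n (partition_big (fun V : {set 'I_n} => inord #|V| : 'I_n.+1) xpredT)//=.
apply: eq_bigr => k _.
rewrite (eq_bigl (fun V : {set 'I_n} => V \in [set V : {set 'I_n} | #|V| == k]%SET)); last first.
  move=> V; rewrite inE -val_eqE /= inordK// ltnS.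
  by rewrite -[X in (_ <= X)%N](card_ord n) max_card.
rewrite (eq_bigr (fun=> x ^+ k)); last by move=> V; rewrite inE => /eqP->.
by rewrite sumr_const card_draws card_ord.
Qed.

End Asymptotics.

(** * The bounds *)

Section Bounds.
Variables (R : realType) (l m : nat) (A : dc_index l m -> plane R).
Hypothesis dc : double_chain A.

Lemma val_inner n (i : 'I_n) : val (inner i) = i.+1.
Proof. by rewrite [LHS]lift0 lift_max. Qed.

Lemma inner_inj n : injective (@inner n).
Proof. by move=> i j e; apply: val_inj; have := congr1 val e; rewrite !val_inner => -[]. Qed.

Lemma inner_not_end n (i : 'I_n) : (inner i == ord0) || (inner i == ord_max) = false.
Proof. by rewrite -!val_eqE val_inner /= eqSS ltn_eqF. Qed.

Lemma not_end_inner n (i : 'I_n.+2) : ~~ ((i == ord0) || (i == ord_max)) ->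
  exists j, i = inner j.
Proof.
rewrite negb_or -!val_eqE /= => /andP[i0 im].
have h : (i.-1 < n)%N by have := ltn_ord i; lia.
by exists (Ordinal h); apply: val_inj; rewrite val_inner /=; lia.
Qed.

Lemma mem_union_inl (V : {set 'I_l}) (W : {set 'I_m}) i :
  (inl (inner i) \in interior_union V W) = (i \in V).
Proof.
rewrite inE; apply/orP/idP => [[/imsetP[j jV e]|/imsetP[j _ //]]|iV].
  by rewrite (inner_inj (inl_inj e)).
by left; exact: imset_f.
Qed.

Lemma mem_union_inr (V : {set 'I_l}) (W : {set 'I_m}) j :
  (inr (inner j) \in interior_union V W) = (j \in W).
Proof.
rewrite inE; apply/orP/idP => [[/imsetP[i _ //]|/imsetP[i iW e]]|jW].
  by rewrite (inner_inj (inr_inj e)).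
by right; exact: imset_f.
Qed.

Lemma interior_points_dc :
  interior_points A = interior_union [set: 'I_l]%SET [set: 'I_m]%SET.
Proof.
have [pos [at_ [frame endE]]] := double_chain_frame dc.
have [gp _ _ _] := dc.
apply/setP => x; apply/idP/idP => [int|].
  have : ~~ ((pos x == 0%N) || (pos x == dc_len l m (dc_side x))).
    by apply/negP => /(end_not_interior gp frame)/negP.
  rewrite endE; case: x int => x _ /not_end_inner[j ->].
    by rewrite mem_union_inl inE.
  by rewrite mem_union_inr inE.
have pl y : (pos y <= dc_len l m (dc_side y))%N.
  by move: y; case: frame => -[].
move=> xU; apply: (inner_interior frame).
have : ~~ ((pos x == 0%N) || (pos x == dc_len l m (dc_side x))).
  rewrite endE; case: x xU => x; rewrite inE => /orP[/imsetP[j _ e]|/imsetP[j _ e]] //.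
    by rewrite (inl_inj e) inner_not_end.
  by rewrite (inr_inj e) inner_not_end.
by rewrite negb_or lt0n => /andP[-> h]; rewrite ltn_neqAle h pl.
Qed.

(** Three options instead of two for each vertex in [V], [W] or among the four
    chain ends, and Catalan numbers of index two higher. This gives the
    constant: 2 ^ 4 * (3 / 2) ^ 4 * 16 ^ 2. *)
Lemma card_PT_union (V : {set 'I_l}) (W : {set 'I_m}) :
  #|PT_ A (interior_union V W)|%:R <=
    20736 * (2 ^+ (l + m) * (3 / 2) ^+ (#|V| + #|W|) * catalan R l * catalan R m).
Proof.
have h32 : 0 <= 3 / 2 :> R by lra.
have h31 : 1 <= 3 / 2 :> R by lra.
have [pos [at_ [frame endE]]] := double_chain_frame dc.
have [gp _ _ _] := dc.
set U := interior_union V W.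
have := card_PT_le gp frame U; set E := ends (@dc_side l m) pos (dc_len l m) => le.
have cE : (#|E| <= 4)%N.
  have sub : E \subset [set inl ord0; inl ord_max; inr ord0; inr ord_max]%SET.
    apply/fintype.subsetP => x; rewrite inE endE !inE.
    by case: x => x /orP[/eqP->|/eqP->]; rewrite eqxx ?orbT.
  apply: leq_trans (subset_leq_card sub) _.
  do 2 (apply: leq_trans (leq_card_setU _ _).1 _; rewrite cards1 addn1 ltnS).
  by apply: leq_trans (leq_card_setU _ _).1 _; rewrite !cards1.
have cU : (#|U| <= #|V| + #|W|)%N.
  apply: leq_trans (leq_card_setU _ _).1 _.
  by apply: leq_add; exact: leq_imset_card.
have cUE : (#|U :|: E| <= #|V| + #|W| + 4)%N.
  by apply: leq_trans (leq_card_setU _ _).1 _; exact: leq_add.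
have prodE : (\prod_(v : dc_index l m) (if v \in U :|: E then 3 else 2))%:R =
    2 ^+ (l + m + 4) * (3 / 2) ^+ #|U :|: E| :> R.
  rewrite natr_prod.
  rewrite (eq_bigr (fun v => 2 * (if v \in U :|: E then 3 / 2 else 1))) => [|v _]; last first.
    by case: ifP => _; lra.
  rewrite big_split /= prodr_const -big_mkcond /= prodr_const.
  congr (_ ^+ _ * _); rewrite card_sum !card_ord; lia.
have {}le : #|PT_ A U|%:R <= (\prod_(v : dc_index l m) (if v \in U :|: E then 3 else 2))%:R *
    ((size (ballots l.+1 0))%:R * (size (ballots m.+1 0))%:R) :> R.
  by rewrite -!natrM ler_nat.
apply: le_trans le _; rewrite prodE.
have c0 n : 0 <= catalan R n by rewrite /catalan mulr_ge0// invr_ge0.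
have h1 : (size (ballots l.+1 0))%:R * (size (ballots m.+1 0))%:R <=
    (16 * catalan R l) * (16 * catalan R m) :> R.
  by apply: ler_pM; rewrite ?ler0n//; exact: size_ballots_catalan.
have h2 : (3 / 2) ^+ #|U :|: E| <= (3 / 2) ^+ (#|V| + #|W| + 4) :> R.
  exact: (ler_weXn2l h31 cUE).
have h3 : 2 ^+ (l + m + 4) * (3 / 2) ^+ #|U :|: E| <=
   2 ^+ (l + m + 4) * (3 / 2) ^+ (#|V| + #|W| + 4) :> R.
  by apply: ler_wpM2l => //; rewrite exprn_ge0.
have p1 : 0 <= 2 ^+ (l + m + 4) * (3 / 2) ^+ #|U :|: E| :> R.
  by apply: mulr_ge0; apply: exprn_ge0 => //.
have p2 : 0 <= (size (ballots l.+1 0))%:R * (size (ballots m.+1 0))%:R :> R.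
  by rewrite mulr_ge0.
apply: le_trans (ler_pM p1 p2 h3 h1) _.
rewrite [2 ^+ (_ + 4)]exprD [(3 / 2) ^+ (_ + 4)]exprD.
rewrite le_eqVlt; apply/orP; left; apply/eqP.
move: (2 ^+ (l + m)) ((3 / 2) ^+ (#|V| + #|W|)) (catalan R l) (catalan R m) => x y a b.
by field.
Qed.

(** Each pseudo-triangulation is counted for the sets [V] and [W] of its own
    pointed inner points. *)
Lemma card_PT_sum : (#|PT A| <=
  \sum_(V : {set 'I_l}) \sum_(W : {set 'I_m}) #|PT_ A (interior_union V W)|)%N.
Proof.
pose vw T : {set 'I_l} * {set 'I_m} :=
  ([set i | is_pointed A T (inl (inner i))]%SET,
   [set j | is_pointed A T (inr (inner j))]%SET).
rewrite pair_big /= -sum1_card (partition_big vw xpredT)//=.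
apply: leq_sum => -[V W] _; rewrite sum1dep_card; apply: subset_leq_card.
apply/fintype.subsetP => T; rewrite !inE => /andP[TP /eqP[<- <-]]; rewrite TP /=.
apply/forallP => x; apply/implyP; rewrite interior_points_dc inE.
by move=> /orP[/imsetP[i _ ->]|/imsetP[j _ ->]];
  rewrite ?mem_union_inl ?mem_union_inr inE.
Qed.

Lemma card_PPT : #|PPT A|%:R <= 20736 * (3 ^+ (l + m) * catalan R l * catalan R m).
Proof.
rewrite /PPT interior_points_dc; apply: le_trans (card_PT_union _ _) _.
rewrite !cardsT !card_ord -exprMn.
by have -> : 2 * (3 / 2) = 3 :> R by field.
Qed.

Lemma card_PT : #|PT A|%:R <= 20736 * (5 ^+ (l + m) * catalan R l * catalan R m).
Proof.
have := card_PT_sum; rewrite -(ler_nat R) => /le_trans; apply.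
rewrite natr_sum; under eq_bigr do rewrite natr_sum.
apply: le_trans (_ : \sum_(V : {set 'I_l}) \sum_(W : {set 'I_m})
  ((3 / 2) ^+ #|V| * ((3 / 2) ^+ #|W| *
    (20736 * 2 ^+ (l + m) * catalan R l * catalan R m))) <= _).
  apply: ler_sum => V _; apply: ler_sum => W _.
  apply: le_trans (card_PT_union V W) _; rewrite [_ ^+ (#|V| + _)]exprD.
  rewrite le_eqVlt; apply/orP; left; apply/eqP.
  by move: (_ ^+ #|V|) (_ ^+ #|W|) (_ ^+ (l + m)) => x y z; ring.
under eq_bigr do rewrite -mulr_sumr -mulr_suml.
rewrite -mulr_suml !sum_sets_expr.
have -> : 1 + 3 / 2 = 5 / 2 :> R by field.
rewrite mulrA -exprD expr_div_n le_eqVlt; apply/orP; left; apply/eqP.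
have : 2 ^+ (l + m) != 0 :> R by rewrite expf_neq0.
by move: (2 ^+ (l + m)) => x x0; field.
Qed.

End Bounds.

Lemma bigO_trans (R : realType) (f g : nat -> nat -> R) (b : R) :
  (forall l m, 0 <= f l m) -> (forall l m, 0 <= g l m) -> 0 < b -> same_bigO f g ->
  exists2 c : R, 0 < c & forall l m, (0 < l)%N -> (0 < m)%N ->
    forall x, x <= b * f l m -> x <= c * g l m.
Proof.
move=> f0 g0 b0 [c c0 h]; exists (b * c); first exact: mulr_gt0.
move=> l m l0 m0 x xb; have [h1 _] := h l m l0 m0.
rewrite !ger0_norm// in h1; apply: le_trans xb _.
by rewrite -mulrA ler_pM2l.
Qed.

Theorem lemma20 (R : realType) :
  (exists2 c : R, 0 < c &
     forall (l m : nat) (A : dc_index l m -> plane R), double_chain A ->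
     forall (V : {set 'I_l}) (W : {set 'I_m}),
       #|PT_ A (interior_union V W)|%:R <=
         c * (2 ^+ (l + m) * (3 / 2) ^+ (#|V| + #|W|) * catalan R l * catalan R m))
  /\
  [/\ exists2 c : R, 0 < c &
        forall (l m : nat) (A : dc_index l m -> plane R), double_chain A ->
          #|PPT A|%:R <= c * (3 ^+ (l + m) * catalan R l * catalan R m),
      same_bigO (fun l m => 3 ^+ (l + m) * catalan R l * catalan R m)
                (fun l m => 12 ^+ (l + m) * (l * m)%:R `^ (- (3 / 2))) &
      exists2 c : R, 0 < c &
        forall (l m : nat) (A : dc_index l m -> plane R),
          (0 < l)%N -> (0 < m)%N -> double_chain A ->
          #|PPT A|%:R <= c * (12 ^+ (l + m) * (l * m)%:R `^ (- (3 / 2)))]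
  /\
  [/\ exists2 c : R, 0 < c &
        forall (l m : nat) (A : dc_index l m -> plane R), double_chain A ->
          #|PT A|%:R <= c * (5 ^+ (l + m) * catalan R l * catalan R m),
      same_bigO (fun l m => 5 ^+ (l + m) * catalan R l * catalan R m)
                (fun l m => 20 ^+ (l + m) * (l * m)%:R `^ (- (3 / 2))) &
      exists2 c : R, 0 < c &
        forall (l m : nat) (A : dc_index l m -> plane R),
          (0 < l)%N -> (0 < m)%N -> double_chain A ->
          #|PT A|%:R <= c * (20 ^+ (l + m) * (l * m)%:R `^ (- (3 / 2)))].
Proof.
have c0 n : 0 <= catalan R n by rewrite /catalan mulr_ge0// invr_ge0.
have k0 : 0 < 20736 :> R by rewrite ltr0n.
have f0 (q : R) : 0 <= q -> forall l m, 0 <= q ^+ (l + m) * catalan R l * catalan R m.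
  by move=> q0 l m; rewrite !mulr_ge0// exprn_ge0.
have g0 (q : R) : 0 <= q -> forall l m : nat, 0 <= q ^+ (l + m) * (l * m)%:R `^ (- (3 / 2)).
  by move=> q0 l m; rewrite mulr_ge0 ?exprn_ge0// powR_ge0.
have s12 : same_bigO (fun l m => 3 ^+ (l + m) * catalan R l * catalan R m)
    (fun l m => 12 ^+ (l + m) * (l * m)%:R `^ (- (3 / 2))).
  have := @same_bigO_catalan R 3; have -> : 4 * 3 = 12 :> R by ring.
  exact.
have s20 : same_bigO (fun l m => 5 ^+ (l + m) * catalan R l * catalan R m)
    (fun l m => 20 ^+ (l + m) * (l * m)%:R `^ (- (3 / 2))).
  have := @same_bigO_catalan R 5; have -> : 4 * 5 = 20 :> R by ring.
  exact.
split; [|split; split=> //].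
- by exists 20736; [exact: k0|move=> l m A dc V W; exact: card_PT_union].
- by exists 20736; [exact: k0|move=> l m A dc; exact: card_PPT].
- have [c cp h] := bigO_trans (f0 3 (ler0n _ _)) (g0 12 (ler0n _ _)) k0 s12.
  by exists c => // l m A l0 m0 dc; apply: h => //; exact: card_PPT.
- by exists 20736; [exact: k0|move=> l m A dc; exact: card_PT].
have [c cp h] := bigO_trans (f0 5 (ler0n _ _)) (g0 20 (ler0n _ _)) k0 s20.
by exists c => // l m A l0 m0 dc; apply: h => //; exact: card_PT.
Qed.
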